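(* Let $r\ge 4$ and let $f=f(x,\mu)$ be a real-valued $C^r$ function defined on a neighbourhood of $(0,0)\in\mathbb{R}\times\mathbb{R}$, regarded as a one-parameter family of maps $x\mapsto f(x,\mu)$. Suppose $f(0,\mu)=0$ for all $\mu$ in a neighbourhood of $0$, and $$f_x(0,0)=1,\quad f_{xx}(0,0)<0,\quad f_{x\mu}(0,0)>0.$$ Let $$g(y,\nu,a)=y+\nu y-y^2+a y^3 .$$ There exist a neighbourhood $N$ of $x=0$ and $\mu_0>0$ such that if $\mu\in(-\mu_0,\mu_0)\setminus\{0\}$ then $f(\cdot,\mu)$ has two fixed points in $N$. Moreover, there exist a neighbourhood $M$ of $y=0$, a $C^{r-1}$ function $\nu(\mu)$, and a $C^{r-3}$ function $a(\mu)$ with $$\nu(0)=0,\qquad \nu'(0)=f_{x\mu}(0,0),\qquad a(0)=\frac{2f_{xxx}}{3f_{xx}^2}\Big|_{(0,0)},$$ such that, with $\tilde g(y,\mu)=g(y,\nu(\mu),a(\mu))$: 1. if $\mu\in(-\mu_0,\mu_0)\setminus\{0\}$ then $f|_N$ and $\tilde g|_M$ are $C^{r-1}$-conjugate on the basins of attraction/repulsion of their corresponding fixed points (that is, for each fixed point of $f|_N$ there is a $C^{r-1}$-conjugacy from its basin of attraction or repulsion, according to its stability, to that of the corresponding fixed point of $\tilde g|_M$); 2. if $\mu=0$ then $f|_N$ is $C^1$-conjugate to $\tilde g|_M$.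
   Context: Subscripts denote partial derivatives. For fixed $\mu$, $f|_N$ denotes the map $x\mapsto f(x,\mu)$ restricted to $N$, and $\tilde g|_M$ the map $y\mapsto\tilde g(y,\mu)$ restricted to $M$. Two maps $F:U\to\mathbb{R}$ and $G:V\to\mathbb{R}$ are topologically conjugate if there is a homeomorphism $h:U\to V$ with $h\circ F=G\circ h$ (for restricted maps this relation is understood at points where both sides are defined, i.e. whose image remains in the domain). They are differentiably conjugate if $h$ is a diffeomorphism, and $C^s$-conjugate ($s\ge1$) if the diffeomorphism $h$ is of class $C^s$. If $x$ is a fixed point of $F$, then $h(x)$ is the corresponding fixed point of $G$. The basin of attraction of a stable fixed point in a neighbourhood is the set of points of the neighbourhood whose forward orbits stay in the neighbourhood and converge to the fixed point; the basin of repulsion of an unstable fixed point is the set of points of the neighbourhood whose backward orbits stay in the neighbourhood and converge to the fixed point (the maps are locally invertible). *)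

(* Defs.v *)
From Stdlib Require Import Reals.
From Coquelicot Require Import Coquelicot.

Open Scope R_scope.

(* A map defined on part of R or R^2 is a total function that is only ever
   evaluated on its domain; its values elsewhere are irrelevant. *)

Definition d_x (f : R -> R -> R) (x mu : R) : R := Derive (fun z => f z mu) x.
Definition d_mu (f : R -> R -> R) (x mu : R) : R := Derive (fun z => f x z) mu.

(* [ex_diff_n f n x mu] asks that all iterated partial derivatives of order at
   most [n] exist and are continuous at the point. *)
Definition C_on_2d (n : nat) (D : R * R -> Prop) (f : R -> R -> R) : Prop :=
  open D /\ forall x mu, D (x, mu) -> ex_diff_n f n x mu.

(* [Derive_n] is total, so openness of [D] is what makes the pointwise
   condition meaningful. *)
Definition C_on (n : nat) (D : R -> Prop) (h : R -> R) : Prop :=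
  open D /\
  forall x, D x -> forall k, (k <= n)%nat ->
    ex_derive_n h k x /\ continuous (Derive_n h k) x.

Definition open_nbhd (x : R) (D : R -> Prop) : Prop := open D /\ D x.

Definition sym_interval (e : R) : R -> Prop := fun x => - e < x < e.

Definition C_diffeo (s : nat) (U V : R -> Prop) (h : R -> R) : Prop :=
  C_on s U h /\ (forall x, U x -> V (h x)) /\
  exists k : R -> R,
    C_on s V k /\ (forall y, V y -> U (k y)) /\
    (forall x, U x -> k (h x) = x) /\ (forall y, V y -> h (k y) = y).

(* [F] need not map [U] into itself: [h o F] is defined only at the points of
   [U] whose image by [F] is again in [U]. *)
Definition C_conjugacy (s : nat) (U V : R -> Prop) (F G h : R -> R) : Prop :=
  C_diffeo s U V h /\ forall x, U x -> U (F x) -> h (F x) = G (h x).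

Definition fixed_in (D : R -> Prop) (F : R -> R) (p : R) : Prop :=
  D p /\ F p = p.

Definition lyapunov_stable (F : R -> R) (p : R) : Prop :=
  forall eps : posreal, exists delta : posreal,
    forall x, Rabs (x - p) < delta ->
      forall n, Rabs (Nat.iter n F x - p) < eps.

Definition stable (F : R -> R) (p : R) : Prop :=
  lyapunov_stable F p /\
  exists delta : posreal, forall x, Rabs (x - p) < delta ->
    is_lim_seq (fun n => Nat.iter n F x) p.

Definition unstable (F : R -> R) (p : R) : Prop := ~ lyapunov_stable F p.

Definition basin_attraction (D : R -> Prop) (F : R -> R) (p x : R) : Prop :=
  (forall n, D (Nat.iter n F x)) /\ is_lim_seq (fun n => Nat.iter n F x) p.

Definition basin_repulsion (D : R -> Prop) (F : R -> R) (p x : R) : Prop :=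
  exists u : nat -> R,
    u 0%nat = x /\ (forall n, D (u n)) /\ (forall n, F (u (S n)) = u n) /\
    is_lim_seq u p.

(* The conjugacy sends [p] to [q], which is what makes [q] the fixed point
   corresponding to [p]. *)
Definition conjugate_on_basins (s : nat) (N M : R -> Prop) (F G : R -> R)
    (p q : R) : Prop :=
  (stable F p /\ stable G q /\
   exists h, C_conjugacy s (basin_attraction N F p) (basin_attraction M G q) F G h
     /\ h p = q)
  \/
  (unstable F p /\ unstable G q /\
   exists h, C_conjugacy s (basin_repulsion N F p) (basin_repulsion M G q) F G h
     /\ h p = q).

Definition g (y nu a : R) : R := y + nu * y - y ^ 2 + a * y ^ 3.

(* Main.v *)
Require Import Defs.
From Stdlib Require Import Reals Ranalysis5 Lra Lia Psatz.
From Stdlib Require Import ClassicalEpsilon FunctionalExtensionality PropExtensionality.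
From Coquelicot Require Import Coquelicot.

(** Write [f(x, mu) = x (1 + nu(mu) + x chi(x, mu))]. Dividing by [x] costs one
    derivative each time ([hadamard]), so [nu] is of class C^(r-1), [chi] of class
    C^(r-2) and [chi_x] of class C^(r-3). The fixed points are [0] and the zero
    [x1(mu)] of [nu + x chi], which is decreasing in [x] because
    [chi(0, 0) = f_xx(0, 0) / 2 < 0]; the implicit function theorem makes [x1] smooth.
    The family [g] has the same form with [chi] replaced by [-1 + a y]. The multiplier at
    [0] is [1 + nu] in both families, and the multipliers at the other fixed point agree
    when [a = chi_x / (x1 chi_x - chi)^2] at [(x1, mu)] ([matching_parameters]). This
    formula is regular at [mu = 0], has the right number of derivatives, and takes there
    the value [2 f_xxx / (3 f_xx^2)].

    For [mu <> 0] one fixed point is a source and the other, above it, is a sink. A sink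
    is linearized by a coordinate [phi] with [phi o F = F'(p) phi] ([koenigs]). Its
    logarithmic derivative [phi'' / phi'] solves a linear equation
    [v = A + B (v o F)] with a factor [B] smaller than one near [p]; continuous solutions of such
    equations are as smooth as the coefficients ([linear_equation_C_on]). The dynamics
    propagates [phi] over the whole basin, which is an interval from the source to the end
    of the neighbourhood, and is mapped by [phi] onto a ray. Two rays differ by a
    linear map, which commutes with the linear dynamics, so equality of the multipliers
    suffices for a conjugacy between the two basins ([sink_conjugacy]), wherever
    the ends of the two neighbourhoods lie. The source is treated in the same way
    through [x |-> - F^-1(- x)].

    For [mu = 0] the point [0] is parabolic, attracting on the right and repelling on the
    left. On the right half there is a coordinate [phi] with [phi o F = phi - 1] and
    [phi' = (1 + o(1)) / (b x^2)], where [b = - chi(0, 0)] ([parabolic_abel]): [1 / x^2] is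
    corrected by the exponential of the solution of another linear equation, now with
    factor one, whose series converges because [x - F x] dominates a multiple of [x^2]
    and telescopes. Then [- 1 / phi] has derivative [b] at [0] and conjugates [F] to
    [t |-> t / (1 + t)]. The analogous coordinate of the inverse on the left half has
    the same derivative at [0], so both glue to a C^1 diffeomorphism from the
    neighbourhood onto the line ([fold_parabolic_normal_form]), and the conjugacy between
    two such maps is one of these diffeomorphisms followed by the inverse of the other. *)

(** * Functions of class C^n of one variable *)

Lemma pred_ext (U V : R -> Prop) : (forall x, U x <-> V x) -> U = V.
Proof.
  intros H. apply functional_extensionality. intros x.
  apply propositional_extensionality. apply H.
Qed.

Lemma pos_below (a b c d : R) :
  0 < a -> 0 < b -> 0 < c -> 0 < d -> exists e, 0 < e /\ e < a /\ e < b /\ e < c /\ e < d.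
Proof.
  intros ha hb hc hd. exists (Rmin (Rmin a b) (Rmin c d) / 2).
  assert (g := Rmin_l (Rmin a b) (Rmin c d)). assert (g' := Rmin_r (Rmin a b) (Rmin c d)).
  assert (g1 := Rmin_l a b). assert (g2 := Rmin_r a b).
  assert (g3 := Rmin_l c d). assert (g4 := Rmin_r c d).
  assert (0 < Rmin (Rmin a b) (Rmin c d)) by (repeat apply Rmin_glb_lt; assumption).
  lra.
Qed.

Lemma between_Rmin_Rmax (l u a b x : R) :
  l < a < u -> l < b < u -> Rmin a b <= x <= Rmax a b -> l < x < u.
Proof. unfold Rmin, Rmax. destruct Rle_dec; lra. Qed.

Lemma open_oo (a b : R) : open (fun x => a < x < b).
Proof. apply open_and; [apply open_gt | apply open_lt]. Qed.

Lemma is_derive_slope (f : R -> R) (x l : R) :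
  (forall eps : posreal,
     locally x (fun y => exists s, f y - f x = s * (y - x) /\ Rabs (s - l) < eps)) ->
  is_derive f x l.
Proof.
  intros H. apply is_derive_Reals. intros eps heps.
  destruct (H (mkposreal eps heps)) as [d hd]. exists d. intros h hh hd'.
  destruct (hd (x + h)) as [s [hs1 hs2]].
  - change (Rabs (x + h - x) < d). now replace (x + h - x) with h by ring.
  - rewrite hs1. replace (s * (x + h - x) / h) with s by (field; exact hh). exact hs2.
Qed.

Lemma continuous_eps (f : R -> R) (x : R) :
  continuous f x <->
  forall eps : posreal, locally x (fun y => Rabs (f y - f x) < eps).
Proof.
  split.
  - intros H eps. apply (H (fun z => Rabs (z - f x) < eps)). exists eps. intros z hz. exact hz.
  - intros H P [eps hP]. destruct (H eps) as [d hd]. exists d.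
    intros y hy. now apply hP, hd.
Qed.

Lemma C_on_ext n D (f g : R -> R) :
  (forall x, D x -> f x = g x) -> C_on n D f -> C_on n D g.
Proof.
  intros He [ho H]. split; [exact ho|]. intros x hx k hk.
  assert (hloc : locally x (fun t => f t = g t)).
  { generalize (ho x hx). apply filter_imp. exact He. }
  destruct (H x hx k hk) as [h1 h2]. split.
  - exact (ex_derive_n_ext_loc f g k x hloc h1).
  - apply continuous_ext_loc with (Derive_n f k); [|exact h2].
    apply locally_locally in hloc. generalize hloc. apply filter_imp.
    intros y hy. apply Derive_n_ext_loc. exact hy.
Qed.

Lemma C_on_sub n (D E : R -> Prop) f :
  open E -> (forall x, E x -> D x) -> C_on n D f -> C_on n E f.
Proof. intros ho hs [_ H]. split; [exact ho|]. intros x hx. apply H, hs, hx. Qed.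

Lemma C_on_interval (l u l' u' : R) n f :
  l <= l' -> u' <= u -> C_on n (fun x => l < x < u) f -> C_on n (fun x => l' < x < u') f.
Proof. intros hl hu. apply C_on_sub; [apply open_oo|intros; lra]. Qed.

Lemma C_on_le n m D f : (m <= n)%nat -> C_on n D f -> C_on m D f.
Proof. intros hm [ho H]. split; [exact ho|]. intros x hx k hk. apply H; [exact hx|lia]. Qed.

Lemma C_on_0 D f : C_on 0 D f <-> open D /\ forall x, D x -> continuous f x.
Proof.
  split; intros [ho H]; split; try exact ho.
  - intros x hx. exact (proj2 (H x hx 0%nat (le_n 0))).
  - intros x hx k hk. replace k with 0%nat by lia. split; [exact I | exact (H x hx)].
Qed.

(** Splitting off the first derivative, rather than the last one as [Derive_n]
    does, is what turns the Leibniz, chain and inverse function rules into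
    short inductions. *)
Lemma C_on_S n D f :
  C_on (S n) D f <-> (forall x, D x -> ex_derive f x) /\ C_on n D (Derive f).
Proof.
  assert (hc : forall k x, Derive_n (Derive f) k x = Derive_n f (S k) x).
  { intros k x. change (Derive f) with (Derive_n f 1). rewrite Derive_n_comp.
    now rewrite Nat.add_1_r. }
  assert (hex : forall k x, ex_derive_n (Derive f) (S k) x <-> ex_derive_n f (S (S k)) x).
  { intros k x. simpl. split; apply ex_derive_ext; intros t; rewrite hc; reflexivity. }
  split.
  - intros [ho H]. split; [intros x hx; exact (proj1 (H x hx 1%nat ltac:(lia)))|].
    split; [exact ho|]. intros x hx k hk.
    destruct (H x hx (S k) ltac:(lia)) as [h1 h2]. split.
    + destruct k; [exact I|]. exact (proj2 (hex k x) h1).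
    + refine (continuous_ext _ _ x _ h2). intros t. symmetry. apply hc.
  - intros [hd [ho H]]. split; [exact ho|]. intros x hx [|k] hk.
    + split; [exact I|]. apply (ex_derive_continuous f). exact (hd x hx).
    + destruct (H x hx k ltac:(lia)) as [h1 h2]. split.
      * destruct k; [exact (hd x hx)|]. exact (proj1 (hex k x) h1).
      * refine (continuous_ext _ _ x _ h2). intros t. apply hc.
Qed.

Lemma C_on_local n (D : R -> Prop) f :
  (forall x, D x -> exists E : R -> Prop, E x /\ C_on n E f) -> open D -> C_on n D f.
Proof.
  intros H ho. split; [exact ho|]. intros x hx k hk.
  destruct (H x hx) as [E [hE [_ h]]]. exact (h x hE k hk).
Qed.

(* [C_on] is used from here on through the characterizations above. *)
Opaque C_on.

Lemma C_on_open {n D f} : C_on n D f -> open D.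
Proof. intros h. apply (C_on_le n 0) in h; [|lia]. apply C_on_0 in h. apply h. Qed.

Lemma C_on_S_intro n D (f f' : R -> R) :
  (forall x, D x -> is_derive f x (f' x)) -> C_on n D f' -> C_on (S n) D f.
Proof.
  intros hd hc. apply C_on_S. split.
  - intros x hx. exists (f' x). exact (hd x hx).
  - apply C_on_ext with f'; [|exact hc]. intros x hx. symmetry. apply is_derive_unique, hd, hx.
Qed.

Lemma C_on_is_derive {n D f x} : C_on (S n) D f -> D x -> is_derive f x (Derive f x).
Proof. intros h hx. apply Derive_correct. apply C_on_S in h. exact (proj1 h x hx). Qed.

Lemma C_on_Derive {n D f} : C_on (S n) D f -> C_on n D (Derive f).
Proof. intros h. apply C_on_S in h. exact (proj2 h). Qed.

Lemma C_on_continuous {n D f x} : C_on n D f -> D x -> continuous f x.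
Proof.
  intros h hx. apply (C_on_le n 0) in h; [|lia]. apply C_on_0 in h. exact (proj2 h x hx).
Qed.

Lemma C_on_const n (D : R -> Prop) c : open D -> C_on n D (fun _ => c).
Proof.
  revert c. induction n as [|n IH]; intros c ho.
  - apply C_on_0. split; [exact ho|]. intros. apply continuous_const.
  - apply C_on_S_intro with (fun _ => 0); [|exact (IH 0 ho)].
    intros x _. apply (is_derive_const c).
Qed.

Lemma C_on_id n (D : R -> Prop) : open D -> C_on n D (fun x => x).
Proof.
  intros ho. destruct n.
  - apply C_on_0. split; [exact ho|]. intros. apply continuous_id.
  - apply C_on_S_intro with (fun _ => 1); [|exact (C_on_const n D 1 ho)].
    intros x _. apply (is_derive_id x).
Qed.

Lemma C_on_plus n D f g : C_on n D f -> C_on n D g -> C_on n D (fun x => f x + g x).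
Proof.
  revert f g. induction n as [|n IH]; intros f g hf hg.
  - apply C_on_0 in hf. apply C_on_0 in hg. apply C_on_0. split; [apply hf|].
    intros x hx. apply (continuous_plus f g); [apply hf|apply hg]; exact hx.
  - apply C_on_S_intro with (fun x => Derive f x + Derive g x).
    + intros x hx. apply (is_derive_plus f g); eapply C_on_is_derive; eauto.
    + apply IH; apply C_on_Derive; assumption.
Qed.

Lemma C_on_mult n D f g : C_on n D f -> C_on n D g -> C_on n D (fun x => f x * g x).
Proof.
  revert f g. induction n as [|n IH]; intros f g hf hg.
  - apply C_on_0 in hf. apply C_on_0 in hg. apply C_on_0. split; [apply hf|].
    intros x hx. apply (continuous_mult f g); [apply hf|apply hg]; exact hx.
  - apply C_on_S_intro with (fun x => Derive f x * g x + f x * Derive g x).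
    + intros x hx. apply (is_derive_mult f g); try (eapply C_on_is_derive; eauto).
      intros a b. apply Rmult_comm.
    + apply C_on_plus; apply IH; try (apply C_on_Derive; assumption);
        apply (C_on_le (S n)); auto.
Qed.

Lemma C_on_scal n D c f : C_on n D f -> C_on n D (fun x => c * f x).
Proof. intros h. apply C_on_mult; [apply C_on_const; exact (C_on_open h)|exact h]. Qed.

Lemma C_on_opp n D f : C_on n D f -> C_on n D (fun x => - f x).
Proof.
  intros h. apply C_on_ext with (fun x => (-1) * f x); [intros; ring|]. now apply C_on_scal.
Qed.

Lemma C_on_comp n (D E : R -> Prop) f g :
  C_on n D f -> C_on n E g -> (forall x, D x -> E (f x)) -> C_on n D (fun x => g (f x)).
Proof.
  revert f g. induction n as [|n IH]; intros f g hf hg hm.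
  - apply C_on_0 in hf. apply C_on_0 in hg. apply C_on_0. split; [apply hf|].
    intros x hx. apply (continuous_comp f g); [apply hf|apply hg]; auto.
  - apply C_on_S_intro with (fun x => Derive f x * Derive g (f x)).
    + intros x hx. apply (is_derive_comp g f); eapply C_on_is_derive; eauto.
    + apply C_on_mult; [now apply C_on_Derive|]. apply (IH f (Derive g)); auto.
      * apply (C_on_le (S n)); auto.
      * now apply C_on_Derive.
Qed.

Lemma C_on_inv n D f :
  C_on n D f -> (forall x, D x -> f x <> 0) -> C_on n D (fun x => / f x).
Proof.
  revert f. induction n as [|n IH]; intros f hf h0.
  - apply C_on_0 in hf. apply C_on_0. split; [apply hf|]. intros x hx.
    apply (continuous_comp f Rinv); [now apply hf|]. apply continuous_Rinv. now apply h0.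
  - apply C_on_S_intro with (fun x => (- Derive f x) * (/ f x * / f x)).
    + intros x hx.
      replace (- Derive f x * (/ f x * / f x)) with (- Derive f x / f x ^ 2).
      * apply is_derive_inv; [eapply C_on_is_derive; eauto|now apply h0].
      * field. now apply h0.
    + apply C_on_mult; [apply C_on_opp; now apply C_on_Derive|].
      apply C_on_mult; apply IH; auto; apply (C_on_le (S n)); auto.
Qed.

Lemma C_on_exp n (D : R -> Prop) : open D -> C_on n D exp.
Proof.
  intros ho. induction n as [|n IH].
  - apply C_on_0. split; [exact ho|]. intros x _. apply continuous_exp.
  - apply C_on_S_intro with exp; [|exact IH]. intros x _. apply is_derive_exp.
Qed.

Lemma C_on_iter n (D : R -> Prop) F k :
  C_on n D F -> (forall x, D x -> D (F x)) -> C_on n D (Nat.iter k F).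
Proof.
  intros hF hm.
  assert (hm' : forall j x, D x -> D (Nat.iter j F x)).
  { intros j x hx. induction j as [|j IH]; [exact hx|]. simpl. auto. }
  induction k as [|k IH].
  - apply (C_on_id n D (C_on_open hF)).
  - apply (C_on_comp n D D (Nat.iter k F) F); auto.
Qed.

(** * Monotone functions, inverse functions and diffeomorphisms *)

Lemma mean_value (f f' : R -> R) (a b : R) :
  (forall x, Rmin a b <= x <= Rmax a b -> is_derive f x (f' x)) ->
  exists c, Rmin a b <= c <= Rmax a b /\ f b - f a = f' c * (b - a).
Proof.
  intros h. apply MVT_gen; [intros x hx; apply h; lra|].
  intros x hx. apply continuity_pt_filterlim. apply (ex_derive_continuous f).
  exists (f' x). auto.
Qed.

Lemma derive_pos_increasing (l u : R) (f f' : R -> R) :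
  (forall x, l < x < u -> is_derive f x (f' x)) ->
  (forall x, l < x < u -> 0 < f' x) ->
  forall x y, l < x -> x < y -> y < u -> f x < f y.
Proof.
  intros hd hp x y hx hxy hy.
  destruct (mean_value f f' x y) as [c [hc1 hc2]].
  - intros z hz. rewrite Rmin_left, Rmax_right in hz by lra. apply hd. lra.
  - rewrite Rmin_left, Rmax_right in hc1 by lra.
    assert (0 < f' c) by (apply hp; lra). nra.
Qed.

Lemma IVT_ge (f : R -> R) (a b y : R) :
  a <= b -> (forall x, a <= x <= b -> continuous f x) -> f a <= y <= f b ->
  exists x, a <= x <= b /\ f x = y.
Proof.
  intros hab hc hy.
  destruct (Req_dec (f a) y) as [e|ne]; [exists a; split; [lra|exact e]|].
  destruct (Req_dec (f b) y) as [e|ne']; [exists b; split; [lra|exact e]|].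
  assert (hlt : a < b) by (destruct (Req_dec a b); [subst; lra|lra]).
  destruct (IVT_interv (fun x => f x - y) a b) as [x [hx1 hx2]]; try lra.
  - intros x hx. apply continuity_pt_filterlim.
    apply (continuous_minus f (fun _ => y)); [now apply hc|apply continuous_const].
  - exists x. split; [exact hx1|lra].
Qed.

(** The inverse function theorem for an increasing function onto [V]: the
    slope of the inverse between two values is the reciprocal of a value of
    the derivative, and higher regularity follows from [k' = 1 / h'(k)]. *)
Lemma C_diffeo_of_increasing (n : nat) (l u : R) (V : R -> Prop) (h : R -> R) :
  C_on (S n) (fun x => l < x < u) h ->
  (forall x, l < x < u -> 0 < Derive h x) ->
  open V ->
  (forall x, l < x < u -> V (h x)) ->
  (forall y, V y -> exists x, l < x < u /\ h x = y) ->
  C_diffeo (S n) (fun x => l < x < u) V h.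
Proof.
  intros hC hpos hV hin hsur.
  assert (hder : forall x, l < x < u -> is_derive h x (Derive h x)).
  { intros x hx. exact (C_on_is_derive hC hx). }
  assert (hinc := derive_pos_increasing l u h (Derive h) hder hpos).
  assert (hk : exists k : R -> R, forall y, V y -> l < k y < u /\ h (k y) = y).
  { exists (fun y => epsilon (inhabits 0) (fun x => l < x < u /\ h x = y)).
    intros y hy. apply (epsilon_spec (inhabits 0) (fun x => l < x < u /\ h x = y)). auto. }
  destruct hk as [k hk].
  assert (hkh : forall x, l < x < u -> k (h x) = x).
  { intros x hx. destruct (hk (h x) (hin x hx)) as [h1 h2].
    destruct (Rtotal_order (k (h x)) x) as [c|[c|c]]; auto; exfalso.
    - assert (h (k (h x)) < h x) by (apply hinc; lra). lra.
    - assert (h x < h (k (h x))) by (apply hinc; lra). lra. }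
  assert (hkc : forall y, V y -> continuous k y).
  { intros y hy. apply continuous_eps. intros eps. destruct (hk y hy) as [h1 h2].
    set (x := k y) in *.
    destruct (pos_below eps eps (x - l) (u - x)) as [e he]; try apply cond_pos; try lra.
    assert (hlo : h (x - e) < y) by (rewrite <- h2; apply hinc; lra).
    assert (hhi : y < h (x + e)) by (rewrite <- h2; apply hinc; lra).
    assert (ho : locally y (fun z => (h (x - e) < z < h (x + e)) /\ V z)).
    { apply (filter_and (fun z => h (x - e) < z < h (x + e)) V).
      - apply (open_oo _ _ y). lra.
      - apply hV, hy. }
    generalize ho. apply filter_imp. intros z [hz hVz].
    destruct (hk z hVz) as [h3 h4].
    assert (k z < x + e).
    { destruct (Rlt_or_le (k z) (x + e)) as [c|c]; auto. exfalso.
      destruct (Req_dec (k z) (x + e)) as [c'|c']; [rewrite c' in h4; lra|].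
      assert (h (x + e) < h (k z)) by (apply hinc; lra). lra. }
    assert (x - e < k z).
    { destruct (Rlt_or_le (x - e) (k z)) as [c|c]; auto. exfalso.
      destruct (Req_dec (k z) (x - e)) as [c'|c']; [rewrite c' in h4; lra|].
      assert (h (k z) < h (x - e)) by (apply hinc; lra). lra. }
    apply Rabs_def1; lra. }
  assert (hkd : forall y, V y -> is_derive k y (/ Derive h (k y))).
  { intros y hy. destruct (hk y hy) as [h1 h2]. apply is_derive_slope. intros eps.
    assert (hDc : continuous (fun x => / Derive h x) (k y)).
    { apply (@C_on_continuous n (fun x => l < x < u)); [|exact h1]. apply C_on_inv.
      - now apply C_on_Derive.
      - intros x hx. specialize (hpos x hx). lra. }
    destruct (proj1 (continuous_eps _ _) hDc eps) as [d hd].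
    assert (ho : locally y (fun z => Rabs (k z - k y) < d /\ V z)).
    { apply (filter_and _ V); [|apply hV, hy].
      exact (proj1 (continuous_eps _ _) (hkc y hy) d). }
    generalize ho. apply filter_imp. intros z [hz hVz]. destruct (hk z hVz) as [h3 h4].
    destruct (mean_value h (Derive h) (k y) (k z)) as [c [hc1 hc2]].
    { intros x hx. apply hder. exact (between_Rmin_Rmax _ _ _ _ _ h1 h3 hx). }
    assert (hcI := between_Rmin_Rmax _ _ _ _ _ h1 h3 hc1).
    exists (/ Derive h c). split.
    - rewrite h2, h4 in hc2. rewrite hc2. field. specialize (hpos c hcI). lra.
    - apply hd. change (Rabs (c - k y) < d).
      apply Rabs_def2 in hz. revert hc1. unfold Rmin, Rmax.
      destruct Rle_dec; intros; apply Rabs_def1; lra. }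
  assert (hkC : forall m, (m <= S n)%nat -> C_on m V k).
  { induction m as [|m IH]; intros hm.
    - apply C_on_0. split; [exact hV|exact hkc].
    - apply C_on_S_intro with (fun y => / Derive h (k y)); [exact hkd|].
      apply C_on_inv.
      + apply (C_on_comp m V (fun x => l < x < u) k (Derive h)).
        * apply IH. lia.
        * apply (C_on_le n); [lia|]. now apply C_on_Derive.
        * intros y hy. apply (hk y hy).
      + intros y hy. specialize (hpos (k y) (proj1 (hk y hy))). lra. }
  split; [exact hC|]. split; [exact hin|]. exists k.
  split; [apply hkC; auto|]. split; [|split; [exact hkh|]]; intros y hy; apply (hk y hy).
Qed.

Lemma C_diffeo_comp s (U V W : R -> Prop) h1 h2 :
  C_diffeo s U V h1 -> C_diffeo s V W h2 -> C_diffeo s U W (fun x => h2 (h1 x)).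
Proof.
  intros [a1 [b1 [k1 [c1 [d1 [e1 f1]]]]]] [a2 [b2 [k2 [c2 [d2 [e2 f2]]]]]].
  split; [apply (C_on_comp s U V); auto|]. split; [auto|].
  exists (fun y => k1 (k2 y)). split; [apply (C_on_comp s W V); auto|].
  split; [auto|]. split.
  - intros x hx. rewrite e2; auto.
  - intros y hy. rewrite f1; auto.
Qed.

(** The conjugacies are compositions of the coordinate of the first map with
    the inverse of the coordinate of the second one. *)
Lemma C_diffeo_through s (U V W : R -> Prop) h1 h2 :
  C_diffeo s U W h1 -> C_diffeo s V W h2 ->
  exists h, C_diffeo s U V h /\ forall x, U x -> h2 (h x) = h1 x.
Proof.
  intros H1 [a2 [b2 [k2 [c2 [d2 [e2 f2]]]]]].
  exists (fun x => k2 (h1 x)). split.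
  - apply (C_diffeo_comp s U W V h1 k2 H1). split; [exact c2|]. split; [exact d2|].
    exists h2. auto.
  - intros x hx. apply f2. apply H1. exact hx.
Qed.

(** * Functions of class C^n of two variables *)

Definition rect (s m : R) : R * R -> Prop :=
  fun z => - s < fst z < s /\ - m < snd z < m.

Lemma open_2d (D : R * R -> Prop) :
  open D <-> forall x y, D (x, y) -> locally_2d (fun u v => D (u, v)) x y.
Proof.
  split.
  - intros ho x y h. apply locally_2d_locally. generalize (ho (x, y) h).
    apply filter_imp. now intros [u v].
  - intros h [x y] hD. generalize (proj1 (locally_2d_locally _ _ _) (h x y hD)).
    apply filter_imp. now intros [u v].
Qed.

Lemma open_slices (D : R * R -> Prop) x y :
  open D -> D (x, y) -> locally x (fun u => D (u, y)) /\ locally y (fun v => D (x, v)).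
Proof.
  intros ho h. destruct (proj1 (open_2d D) ho x y h) as [d hd].
  split; exists d; intros z hz; apply hd; try exact hz;
    rewrite Rminus_diag, Rabs_R0; apply cond_pos.
Qed.

Lemma open_rect s m : open (rect s m).
Proof.
  apply open_2d. intros x y [hx hy]. simpl in *.
  destruct (pos_below (x + s) (s - x) (y + m) (m - y)) as [d [hd h]]; try lra.
  exists (mkposreal d hd). simpl. intros u v hu hv. unfold rect; simpl.
  apply Rabs_def2 in hu. apply Rabs_def2 in hv. lra.
Qed.

Lemma open_sym_interval e : open (sym_interval e).
Proof. apply open_oo. Qed.

Lemma locally_2d_rect (P : R -> R -> Prop) :
  locally_2d P 0 0 -> exists e, 0 < e /\ forall x y, rect e e (x, y) -> P x y.
Proof.
  intros [d hd]. exists d. split; [apply cond_pos|].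
  intros x y [hx hy]; simpl in *. apply hd; rewrite Rminus_0_r; apply Rabs_def1; lra.
Qed.

Lemma C2_ext n D (f g : R -> R -> R) :
  (forall x y, D (x, y) -> f x y = g x y) -> C_on_2d n D f -> C_on_2d n D g.
Proof.
  intros he [ho H]. split; [exact ho|]. intros x y hD.
  apply ex_diff_n_ext_loc with f; [|now apply H].
  destruct (proj1 (open_2d D) ho x y hD) as [d hd]. exists d. intros u v hu hv. auto.
Qed.

Lemma C2_sub n (D E : R * R -> Prop) f :
  open E -> (forall z, E z -> D z) -> C_on_2d n D f -> C_on_2d n E f.
Proof. intros ho hs [_ H]. split; [exact ho|]. intros x y h. apply H, hs, h. Qed.

Lemma C2_le n m D f : (m <= n)%nat -> C_on_2d n D f -> C_on_2d m D f.
Proof. intros hm [ho H]. split; [exact ho|]. intros x y h. apply (ex_diff_n_m n m hm). auto. Qed.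

Lemma C2_continuous {n D f x y} : C_on_2d n D f -> D (x, y) -> continuity_2d_pt f x y.
Proof. intros [_ H] h. specialize (H x y h). destruct n; apply H. Qed.

Lemma C2_S n D f :
  C_on_2d (S n) D f <->
  (forall x y, D (x, y) -> continuity_2d_pt f x y /\
     ex_derive (fun z => f z y) x /\ ex_derive (fun z => f x z) y) /\
  C_on_2d n D (d_x f) /\ C_on_2d n D (d_mu f).
Proof.
  split.
  - intros [ho H]. split; [|split; split; try exact ho].
    + intros x y h. destruct (H x y h) as [a [b [c _]]]. auto.
    + intros x y h. destruct (H x y h) as [a [b [c [d e]]]]. exact d.
    + intros x y h. destruct (H x y h) as [a [b [c [d e]]]]. exact e.
  - intros [H [[ho h1] [_ h2]]]. split; [exact ho|]. intros x y h.
    destruct (H x y h) as [a [b c]].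
    exact (conj a (conj b (conj c (conj (h1 x y h) (h2 x y h))))).
Qed.

Lemma C2_open {n D f} : C_on_2d n D f -> open D.
Proof. intros [h _]. exact h. Qed.

Lemma C2_0 D f : C_on_2d 0 D f <-> open D /\ forall x y, D (x, y) -> continuity_2d_pt f x y.
Proof.
  split; intros [ho H]; split; try exact ho; intros x y h.
  - exact (proj1 (H x y h)).
  - split; [exact (H x y h)|exact I].
Qed.

Opaque C_on_2d.

Lemma C2_is_derive_x {n D f x y} :
  C_on_2d (S n) D f -> D (x, y) -> is_derive (fun z => f z y) x (d_x f x y).
Proof. intros H h. apply C2_S in H. exact (Derive_correct _ _ (proj1 (proj2 (proj1 H x y h)))). Qed.

Lemma C2_is_derive_mu {n D f x y} :
  C_on_2d (S n) D f -> D (x, y) -> is_derive (fun z => f x z) y (d_mu f x y).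
Proof. intros H h. apply C2_S in H. exact (Derive_correct _ _ (proj2 (proj2 (proj1 H x y h)))). Qed.

Lemma C2_d_x {n D f} : C_on_2d (S n) D f -> C_on_2d n D (d_x f).
Proof. intros H. apply C2_S in H. apply H. Qed.

Lemma C2_d_mu {n D f} : C_on_2d (S n) D f -> C_on_2d n D (d_mu f).
Proof. intros H. apply C2_S in H. apply H. Qed.

Lemma C2_S_intro n D (f fx fm : R -> R -> R) :
  (forall x y, D (x, y) -> continuity_2d_pt f x y /\
     is_derive (fun z => f z y) x (fx x y) /\ is_derive (fun z => f x z) y (fm x y)) ->
  C_on_2d n D fx -> C_on_2d n D fm -> C_on_2d (S n) D f.
Proof.
  intros H h1 h2. apply C2_S. split; [|split].
  - intros x y h. destruct (H x y h) as [a [b c]].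
    split; [exact a|]. split; [exists (fx x y)|exists (fm x y)]; assumption.
  - apply C2_ext with fx; [|exact h1]. intros x y h. symmetry. apply is_derive_unique.
    now apply H.
  - apply C2_ext with fm; [|exact h2]. intros x y h. symmetry. apply is_derive_unique.
    now apply H.
Qed.

Lemma slice_x_continuous (f : R -> R -> R) x y :
  continuity_2d_pt f x y -> continuous (fun z => f z y) x.
Proof.
  intros H. apply continuous_eps. intros eps. destruct (H eps) as [d hd]. exists d.
  intros z hz. apply hd; [exact hz|]. rewrite Rminus_diag. rewrite Rabs_R0. apply cond_pos.
Qed.

Lemma continuity_2d_pt_comp (k p q : R -> R -> R) x y :
  continuity_2d_pt k (p x y) (q x y) -> continuity_2d_pt p x y -> continuity_2d_pt q x y ->
  continuity_2d_pt (fun u v => k (p u v) (q u v)) x y.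
Proof.
  intros hk hp hq eps. destruct (hk eps) as [d hd].
  generalize (locally_2d_and _ _ _ _ (hp d) (hq d)). apply locally_2d_impl.
  apply locally_2d_forall. intros u v [h1 h2]. auto.
Qed.

Lemma C2_slice_x n D f y :
  C_on_2d n D f -> C_on n (fun x => D (x, y)) (fun x => f x y).
Proof.
  assert (ho : open D -> open (fun x => D (x, y))).
  { intros ho x hx. exact (proj1 (open_slices D x y ho hx)). }
  revert f. induction n as [|n IH]; intros f H.
  - apply C_on_0. split; [exact (ho (C2_open H))|]. intros x hx.
    apply slice_x_continuous. exact (C2_continuous H hx).
  - apply C_on_S_intro with (fun x => d_x f x y).
    + intros x hx. exact (C2_is_derive_x H hx).
    + apply IH. now apply C2_d_x.
Qed.

Lemma chain_rule_curve (f : R -> R -> R) (D : R * R -> Prop) (c : R -> R) mu c' :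
  C_on_2d 1 D f -> D (c mu, mu) -> is_derive c mu c' ->
  is_derive (fun t => f (c t) t) mu (d_x f (c mu) mu * c' + d_mu f (c mu) mu).
Proof.
  intros H hD hc.
  assert (h := is_derive_filterdiff f (c mu) mu (d_x f) (d_mu f (c mu) mu)).
  assert (hf : filterdiff (fun u : R * R => f (fst u) (snd u)) (locally (c mu, mu))
     (fun u : R * R => fst u * d_x f (c mu) mu + snd u * d_mu f (c mu) mu)).
  { apply h.
    - generalize (C2_open H _ hD). apply filter_imp. intros [u v] huv. simpl.
      exact (C2_is_derive_x H huv).
    - exact (C2_is_derive_mu H hD).
    - apply continuity_2d_pt_filterlim. apply (@C2_continuous 0 D); [|exact hD].
      now apply C2_d_x. }
  apply filterdiff_differentiable_pt_lim in hf.
  apply is_derive_Reals in hc. apply is_derive_Reals.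
  replace (d_x f (c mu) mu * c' + d_mu f (c mu) mu)
    with (d_x f (c mu) mu * c' + d_mu f (c mu) mu * 1) by ring.
  apply (derivable_pt_lim_comp_2d f c (fun t => t)); auto. apply derivable_pt_lim_id.
Qed.

Lemma C2_curve n D f (E : R -> Prop) c :
  C_on_2d n D f -> C_on n E c -> (forall mu, E mu -> D (c mu, mu)) ->
  C_on n E (fun mu => f (c mu) mu).
Proof.
  revert f. induction n as [|n IH]; intros f H hc hm.
  - apply C_on_0. apply C_on_0 in hc. split; [apply hc|]. intros mu hmu.
    apply continuous_eps. intros eps.
    destruct (C2_continuous H (hm mu hmu) eps) as [d hd].
    generalize (filter_and _ _ (proj1 (continuous_eps _ _) (proj2 hc mu hmu) d)
                  (locally_ball mu d)).
    apply filter_imp. intros t [h1 h2]. apply hd; [exact h1|exact h2].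
  - assert (hc' := C_on_le (S n) n E c (Nat.le_succ_diag_r n) hc).
    apply C_on_S_intro with (fun mu => d_x f (c mu) mu * Derive c mu + d_mu f (c mu) mu).
    + intros mu hmu. apply (chain_rule_curve f D); auto.
      * apply (C2_le (S n)); [lia|exact H].
      * exact (C_on_is_derive hc hmu).
    + apply C_on_plus; [apply C_on_mult|].
      * apply IH; auto. now apply C2_d_x.
      * now apply C_on_Derive.
      * apply IH; auto. now apply C2_d_mu.
Qed.

(** ** Division by the first variable *)

(** The moments [j] are there for the induction on the regularity: each
    differentiation in [x] brings out one more factor [t]. *)
Definition ray_moment (j : nat) (k : R -> R -> R) (x mu : R) : R :=
  RInt (fun t => t ^ j * k (t * x) mu) 0 1.

Lemma rect_scale s m x mu t :
  rect s m (x, mu) -> 0 <= t <= 1 -> rect s m (t * x, mu).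
Proof.
  intros [h1 h2] ht; simpl in *. split; simpl; [|exact h2].
  split; destruct (Rle_or_lt 0 x); nra.
Qed.

Lemma continuous_pow j x : continuous (fun t => t ^ j) x.
Proof. apply (ex_derive_continuous (fun t => t ^ j)). auto_derive. exact I. Qed.

Lemma ray_integrand_continuous s m j k x mu t :
  C_on_2d 0 (rect s m) k -> rect s m (x, mu) -> 0 <= t <= 1 ->
  continuous (fun t => t ^ j * k (t * x) mu) t.
Proof.
  intros H h ht. apply (continuous_mult (fun t => t ^ j) (fun t => k (t * x) mu)).
  - apply continuous_pow.
  - apply (continuous_comp (fun t => t * x) (fun z => k z mu)).
    + apply (ex_derive_continuous (fun t => t * x)). auto_derive. exact I.
    + apply slice_x_continuous. apply (@C2_continuous 0 (rect s m)); [exact H|].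
      now apply rect_scale.
Qed.

Lemma ray_integrand_integrable s m j k x mu :
  C_on_2d 0 (rect s m) k -> rect s m (x, mu) ->
  ex_RInt (fun t => t ^ j * k (t * x) mu) 0 1.
Proof.
  intros H h. apply (ex_RInt_continuous (V := R_CompleteNormedModule)). intros t ht.
  rewrite Rmin_left, Rmax_right in ht by lra. now apply (ray_integrand_continuous s m).
Qed.

Lemma ray_moment_continuous s m j k x mu :
  C_on_2d 0 (rect s m) k -> rect s m (x, mu) -> continuity_2d_pt (ray_moment j k) x mu.
Proof.
  intros H h eps.
  assert (hxs := h). destruct hxs as [hx hmu]. simpl in hx, hmu.
  set (a := (Rabs x + s) / 2). set (b := (Rabs mu + m) / 2).
  assert (ha : Rabs x < a < s).
  { assert (Rabs x < s) by (apply Rabs_def1; lra). unfold a; lra. }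
  assert (hb : Rabs mu < b < m).
  { assert (Rabs mu < m) by (apply Rabs_def1; lra). unfold b; lra. }
  destruct (uniform_continuity_2d k (-a) a (-b) b) with (eps := pos_div_2 eps) as [d hd].
  { intros u v hu hv. apply (@C2_continuous 0 (rect s m)); [exact H|]. split; simpl; lra. }
  destruct (pos_below d d (a - Rabs x) (b - Rabs mu)) as [e [he he']];
    try apply cond_pos; try lra.
  exists (mkposreal e he). simpl. intros u v hu hv.
  assert (hua : Rabs u <= a).
  { assert (g := Rabs_triang (u - x) x). replace (u - x + x) with u in g by ring. lra. }
  assert (hvb : Rabs v <= b).
  { assert (g := Rabs_triang (v - mu) mu). replace (v - mu + mu) with v in g by ring. lra. }
  apply Rabs_le_between in hua. apply Rabs_le_between in hvb.
  assert (hua' : rect s m (u, v)) by (split; simpl; lra).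
  assert (hxa : -a <= x <= a).
  { apply Rabs_le_between. lra. }
  assert (hmub : -b <= mu <= b).
  { apply Rabs_le_between. lra. }
  unfold ray_moment.
  rewrite <- (RInt_minus (fun t => t ^ j * k (t * u) v)
      (fun t => t ^ j * k (t * x) mu)); try (now apply (ray_integrand_integrable s m)).
  apply Rle_lt_trans with ((1 - 0) * (eps / 2)).
  2: { assert (0 < eps) by apply cond_pos. lra. }
  apply abs_RInt_le_const; [lra| |].
  - apply (ex_RInt_minus (fun t => t ^ j * k (t * u) v)
      (fun t => t ^ j * k (t * x) mu)); now apply (ray_integrand_integrable s m).
  - intros t ht. unfold minus, plus, opp; simpl.
    replace (t ^ j * k (t * u) v + - (t ^ j * k (t * x) mu))
      with (t ^ j * (k (t * u) v - k (t * x) mu)) by ring.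
    rewrite Rabs_mult.
    assert (g1 : Rabs (k (t * u) v - k (t * x) mu) < eps / 2).
    { apply hd.
      - split; nra.
      - lra.
      - split; nra.
      - lra.
      - replace (t * u - t * x) with (t * (u - x)) by ring. rewrite Rabs_mult.
        rewrite (Rabs_pos_eq t) by lra. assert (0 <= Rabs (u - x)) by apply Rabs_pos. nra.
      - lra. }
    assert (g2 : 0 <= Rabs (t ^ j) <= 1).
    { split; [apply Rabs_pos|]. rewrite Rabs_pos_eq by (apply pow_le; lra).
      rewrite <- (pow1 j). apply pow_incr. lra. }
    assert (0 <= Rabs (k (t * u) v - k (t * x) mu)) by apply Rabs_pos. nra.
Qed.

Lemma continuity_2d_pow2 j x t : continuity_2d_pt (fun _ v => v ^ j) x t.
Proof.
  apply (continuity_1d_2d_pt_comp (fun v => v ^ j) (fun _ v => v)).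
  - apply continuity_pt_filterlim. apply continuous_pow.
  - apply continuity_2d_pt_id2.
Qed.

Lemma ray_moment_is_derive_x s m j k x mu :
  C_on_2d 1 (rect s m) k -> rect s m (x, mu) ->
  is_derive (fun z => ray_moment j k z mu) x (ray_moment (S j) (d_x k) x mu).
Proof.
  intros H h.
  assert (Hd : forall u t, rect s m (t * u, mu) ->
    is_derive (fun z => t ^ j * k (t * z) mu) u (t ^ S j * d_x k (t * u) mu)).
  { intros u t hut.
    replace (t ^ S j * d_x k (t * u) mu) with (t ^ j * (t * d_x k (t * u) mu))
      by (simpl; ring).
    apply (is_derive_scal (fun z => k (t * z) mu)).
    apply (is_derive_comp (fun z => k z mu) (fun z => t * z)).
    - apply (C2_is_derive_x H hut).
    - auto_derive; [exact I|ring]. }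
  assert (hloc := proj1 (open_slices _ x mu (open_rect s m) h)).
  assert (hR : ray_moment (S j) (d_x k) x mu =
    RInt (fun t => Derive (fun u => t ^ j * k (t * u) mu) x) 0 1).
  { apply RInt_ext. intros t ht. rewrite Rmin_left, Rmax_right in ht by lra.
    symmetry. apply is_derive_unique. apply Hd. apply rect_scale; [exact h|lra]. }
  rewrite hR.
  apply (is_derive_RInt_param (fun u t => t ^ j * k (t * u) mu)).
  - generalize hloc. apply filter_imp. intros u hu t ht.
    rewrite Rmin_left, Rmax_right in ht by lra.
    eexists. apply Hd. now apply rect_scale.
  - intros t ht. rewrite Rmin_left, Rmax_right in ht by lra.
    assert (hc : continuity_2d_pt (fun u v => v * u) x t).
    { apply continuity_2d_pt_mult; [apply continuity_2d_pt_id2|apply continuity_2d_pt_id1]. }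
    assert (hr := rect_scale s m x mu t h ht).
    apply continuity_2d_pt_ext_loc with (fun u v => v ^ S j * d_x k (v * u) mu).
    + destruct (proj1 (open_2d _) (open_rect s m) _ _ hr) as [d hd].
      generalize (hc d). apply locally_2d_impl. apply locally_2d_forall.
      intros u v huv. symmetry. apply is_derive_unique. apply Hd. apply hd; [exact huv|].
      rewrite Rminus_diag, Rabs_R0. apply cond_pos.
    + apply continuity_2d_pt_mult; [apply continuity_2d_pow2|].
      apply (continuity_2d_pt_comp (d_x k) (fun u v => v * u) (fun _ _ => mu)).
      * apply (@C2_continuous 0 (rect s m)); [now apply C2_d_x|exact hr].
      * exact hc.
      * apply continuity_2d_pt_const.
  - generalize hloc. apply filter_imp. intros u hu.
    apply (ray_integrand_integrable s m); [apply (C2_le 1); auto|exact hu].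
Qed.

Lemma ray_moment_is_derive_mu s m j k x mu :
  C_on_2d 1 (rect s m) k -> rect s m (x, mu) ->
  is_derive (fun z => ray_moment j k x z) mu (ray_moment j (d_mu k) x mu).
Proof.
  intros H h.
  assert (Hd : forall v t, rect s m (t * x, v) ->
    is_derive (fun z => t ^ j * k (t * x) z) v (t ^ j * d_mu k (t * x) v)).
  { intros v t hut. apply (is_derive_scal (fun z => k (t * x) z)).
    apply (C2_is_derive_mu H hut). }
  assert (hloc := proj2 (open_slices _ x mu (open_rect s m) h)).
  assert (hR : ray_moment j (d_mu k) x mu =
    RInt (fun t => Derive (fun v => t ^ j * k (t * x) v) mu) 0 1).
  { apply RInt_ext. intros t ht. rewrite Rmin_left, Rmax_right in ht by lra.
    symmetry. apply is_derive_unique. apply Hd. apply rect_scale; [exact h|lra]. }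
  rewrite hR.
  apply (is_derive_RInt_param (fun v t => t ^ j * k (t * x) v)).
  - generalize hloc. apply filter_imp. intros u hu t ht.
    rewrite Rmin_left, Rmax_right in ht by lra.
    eexists. apply Hd. now apply rect_scale.
  - intros t ht. rewrite Rmin_left, Rmax_right in ht by lra.
    assert (hc : continuity_2d_pt (fun _ v => v * x) mu t).
    { apply continuity_2d_pt_mult; [apply continuity_2d_pt_id2|apply continuity_2d_pt_const]. }
    assert (hr := rect_scale s m x mu t h ht).
    apply continuity_2d_pt_ext_loc with (fun u v => v ^ j * d_mu k (v * x) u).
    + destruct (proj1 (open_2d _) (open_rect s m) _ _ hr) as [d hd].
      generalize (locally_2d_and _ _ _ _ (hc d) (continuity_2d_pt_id1 mu t d)).
      apply locally_2d_impl. apply locally_2d_forall.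
      intros u v [h1 h2]. symmetry. apply is_derive_unique. apply Hd. apply hd; assumption.
    + apply continuity_2d_pt_mult; [apply continuity_2d_pow2|].
      apply (continuity_2d_pt_comp (d_mu k) (fun _ v => v * x) (fun u _ => u)).
      * apply (@C2_continuous 0 (rect s m)); [now apply C2_d_mu|exact hr].
      * exact hc.
      * apply continuity_2d_pt_id1.
  - generalize hloc. apply filter_imp. intros u hu.
    apply (ray_integrand_integrable s m); [apply (C2_le 1); auto|exact hu].
Qed.

Lemma ray_moment_C2 n s m j k :
  C_on_2d n (rect s m) k -> C_on_2d n (rect s m) (ray_moment j k).
Proof.
  revert j k. induction n as [|n IH]; intros j k H.
  - apply C2_0. split; [apply open_rect|]. intros x mu h. now apply (ray_moment_continuous s m).
  - assert (H1 : C_on_2d 1 (rect s m) k) by (apply (C2_le (S n)); [lia|exact H]).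
    apply C2_S_intro with (ray_moment (S j) (d_x k)) (ray_moment j (d_mu k)).
    + intros x mu h. split; [|split].
      * apply (ray_moment_continuous s m); [apply (C2_le (S n)); [lia|exact H]|exact h].
      * now apply (ray_moment_is_derive_x s m).
      * now apply (ray_moment_is_derive_mu s m).
    + apply IH. now apply C2_d_x.
    + apply IH. now apply C2_d_mu.
Qed.

(** Hadamard's lemma: the quotient is [int_0^1 f_x(t x, mu) dt]. *)
Lemma hadamard n s m f :
  C_on_2d (S n) (rect s m) f ->
  exists q, C_on_2d n (rect s m) q /\
    forall x mu, rect s m (x, mu) -> f x mu = f 0 mu + x * q x mu.
Proof.
  intros H. exists (ray_moment 0 (d_x f)).
  split; [apply ray_moment_C2; now apply C2_d_x|]. intros x mu h.
  assert (hd : forall t, 0 <= t <= 1 ->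
    is_derive (fun t => f (t * x) mu) t (x * d_x f (t * x) mu)).
  { intros t ht. apply (is_derive_comp (fun z => f z mu) (fun t => t * x)).
    - apply (C2_is_derive_x H). now apply rect_scale.
    - auto_derive; [exact I|ring]. }
  assert (hi : is_RInt (fun t => x * (t ^ 0 * d_x f (t * x) mu)) 0 1
                 (f (1 * x) mu - f (0 * x) mu)).
  { apply (is_RInt_ext (fun t => x * d_x f (t * x) mu)); [intros; simpl; ring|].
    apply (is_RInt_derive (fun t => f (t * x) mu)).
    - intros t ht. rewrite Rmin_left, Rmax_right in ht by lra. now apply hd.
    - intros t ht. rewrite Rmin_left, Rmax_right in ht by lra.
      apply (continuous_ext (fun t => x * (t ^ 0 * d_x f (t * x) mu))); [intros; simpl; ring|].
      apply (continuous_mult (fun _ => x) (fun t => t ^ 0 * d_x f (t * x) mu));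
        [apply continuous_const|].
      apply (ray_integrand_continuous s m); auto.
      apply (C2_le n); [lia|]. now apply C2_d_x. }
  assert (hi2 : is_RInt (fun t => x * (t ^ 0 * d_x f (t * x) mu)) 0 1
                  (x * ray_moment 0 (d_x f) x mu)).
  { apply (is_RInt_scal (fun t => t ^ 0 * d_x f (t * x) mu)).
    apply (RInt_correct (V := R_CompleteNormedModule)).
    apply (ray_integrand_integrable s m); auto. apply (C2_le n); [lia|]. now apply C2_d_x. }
  assert (e := is_RInt_unique _ _ _ _ hi). rewrite (is_RInt_unique _ _ _ _ hi2) in e.
  rewrite Rmult_1_l, Rmult_0_l in e. lra.
Qed.

(** ** The implicit function theorem *)

(** The slope of [c] is minus a ratio of intermediate values of the partial
    derivatives of [psi], by the mean value theorem in each variable. *)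
Lemma implicit_is_derive (psi : R -> R -> R) s m (c : R -> R) v mu :
  C_on_2d 1 (rect s m) psi ->
  (forall x y, rect s m (x, y) -> d_x psi x y < 0) ->
  (forall t, sym_interval m t -> - s < c t < s /\ psi (c t) t = v) ->
  sym_interval m mu -> continuous c mu ->
  is_derive c mu (- d_mu psi (c mu) mu / d_x psi (c mu) mu).
Proof.
  intros H hneg hc hmu hcont. apply is_derive_slope. intros eps.
  assert (hcm : rect s m (c mu, mu)) by (split; simpl; [now apply hc|exact hmu]).
  set (px := d_x psi (c mu) mu). set (pm := d_mu psi (c mu) mu).
  assert (hpx : px < 0) by now apply hneg.
  (* the quotient [(p, q) |-> - p / q] is continuous at the values at [(c mu, mu)] *)
  assert (hq : continuity_2d_pt (fun p q => - p * / q) pm px).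
  { apply continuity_2d_pt_mult.
    - apply continuity_2d_pt_opp. apply continuity_2d_pt_id1.
    - apply continuity_2d_pt_inv; [apply continuity_2d_pt_id2|lra]. }
  destruct (hq eps) as [d hd].
  destruct (C2_continuous (C2_d_x H) hcm d) as [d1 hd1].
  destruct (C2_continuous (C2_d_mu H) hcm d) as [d2 hd2].
  assert (hl := filter_and _ _ (filter_and _ _ (proj1 (continuous_eps _ _) hcont d1)
    (locally_ball mu d1)) (filter_and _ _ (locally_ball mu d2) (open_sym_interval m mu hmu))).
  generalize hl. apply filter_imp. intros t [[t1 t2] [t3 t4]].
  assert (t2' : Rabs (t - mu) < d1) by exact t2.
  assert (t3' : Rabs (t - mu) < d2) by exact t3.
  destruct (hc t t4) as [hct ht0]. destruct (hc mu hmu) as [hcmu hmu0].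
  destruct (mean_value (fun z => psi z t) (fun z => d_x psi z t) (c mu) (c t))
    as [xi [hxi1 hxi2]].
  { intros z hz. apply (@C2_is_derive_x 0 (rect s m)); [exact H|].
    split; simpl; [|exact t4]. exact (between_Rmin_Rmax _ _ _ _ _ hcmu hct hz). }
  destruct (mean_value (fun z => psi (c mu) z) (fun z => d_mu psi (c mu) z) mu t)
    as [ze [hze1 hze2]].
  { intros z hz. apply (@C2_is_derive_mu 0 (rect s m)); [exact H|].
    split; simpl; [exact hcmu|]. exact (between_Rmin_Rmax _ _ _ _ _ hmu t4 hz). }
  assert (hxr : rect s m (xi, t)).
  { split; simpl; [|exact t4]. exact (between_Rmin_Rmax _ _ _ _ _ hcmu hct hxi1). }
  assert (hn := hneg _ _ hxr).
  exists (- d_mu psi (c mu) ze * / d_x psi xi t). split.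
  - rewrite ht0 in hxi2. rewrite hmu0 in hze2.
    assert (d_x psi xi t * (c t - c mu) = - d_mu psi (c mu) ze * (t - mu)) by lra.
    apply (Rmult_eq_reg_l (d_x psi xi t)); [|lra]. rewrite H0. field. lra.
  - apply (hd (d_mu psi (c mu) ze) (d_x psi xi t)).
    + apply hd2.
      * rewrite Rminus_diag, Rabs_R0. apply cond_pos.
      * apply Rabs_def2 in t3'. revert hze1. unfold Rmin, Rmax.
        destruct Rle_dec; intros; apply Rabs_def1; lra.
    + apply hd1.
      * apply Rabs_def2 in t1. revert hxi1. unfold Rmin, Rmax.
        destruct Rle_dec; intros; apply Rabs_def1; lra.
      * exact t2'.
Qed.

Lemma implicit_C_on n (psi : R -> R -> R) s m (c : R -> R) v :
  C_on_2d (S n) (rect s m) psi ->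
  (forall x y, rect s m (x, y) -> d_x psi x y < 0) ->
  (forall t, sym_interval m t -> - s < c t < s /\ psi (c t) t = v) ->
  (forall t, sym_interval m t -> continuous c t) ->
  C_on (S n) (sym_interval m) c.
Proof.
  intros H hneg hc hcont.
  assert (hr : forall t, sym_interval m t -> rect s m (c t, t)).
  { intros t ht. split; simpl; [now apply hc|exact ht]. }
  assert (G : forall k, (k <= S n)%nat -> C_on k (sym_interval m) c).
  { induction k as [|k IH]; intros hk.
    - apply C_on_0. split; [apply open_sym_interval|exact hcont].
    - apply C_on_S_intro with (fun t => - d_mu psi (c t) t * / d_x psi (c t) t).
      + intros t ht. apply (implicit_is_derive psi s m c v t); auto.
        apply (C2_le (S n)); [lia|exact H].
      + assert (hkc := IH ltac:(lia)). apply C_on_mult; [apply C_on_opp|apply C_on_inv].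
        * apply (C2_curve k (rect s m)); auto. apply (C2_le n); [lia|]. now apply C2_d_mu.
        * apply (C2_curve k (rect s m)); auto. apply (C2_le n); [lia|]. now apply C2_d_x.
        * intros t ht. specialize (hneg _ _ (hr t ht)). lra. }
  apply G. auto.
Qed.

(** Just below and just above [c mu] the function [psi] lies on different sides of
    [v], strictly, hence also at nearby parameters, whose solutions are trapped. *)
Lemma implicit_continuous (psi : R -> R -> R) s m (c : R -> R) v mu :
  C_on_2d 1 (rect s m) psi ->
  (forall x y, rect s m (x, y) -> d_x psi x y < 0) ->
  (forall t, sym_interval m t -> - s < c t < s /\ psi (c t) t = v) ->
  sym_interval m mu -> continuous c mu.
Proof.
  intros H hneg hc hmu. apply continuous_eps. intros eps.
  destruct (hc mu hmu) as [h1 h2].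
  destruct (pos_below eps eps (c mu + s) (s - c mu)) as [e he]; try apply cond_pos; try lra.
  assert (dec : forall t x y, sym_interval m t -> - s < x -> x < y -> y < s ->
            psi y t < psi x t).
  { intros t x y ht hx hxy hy.
    assert (- psi x t < - psi y t); [|lra].
    apply (derive_pos_increasing (-s) s (fun z => - psi z t) (fun z => - d_x psi z t)); auto.
    - intros z hz. apply (is_derive_opp (fun z => psi z t)).
      apply (@C2_is_derive_x 0 (rect s m)); [exact H|]. split; simpl; auto.
    - intros z hz. assert (d_x psi z t < 0); [|lra]. apply hneg. split; simpl; auto. }
  assert (nh : forall x, - s < x < s -> psi x mu - v <> 0 ->
     locally mu (fun t => Rabs (psi x t - psi x mu) < Rabs (psi x mu - v))).
  { intros x hx hne.
    assert (hpos : 0 < Rabs (psi x mu - v)) by now apply Rabs_pos_lt.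
    destruct (@C2_continuous 1 _ _ x mu H) with (eps := mkposreal _ hpos) as [d hd].
    { split; simpl; auto. }
    exists d. intros t ht. apply hd; [|exact ht]. rewrite Rminus_diag, Rabs_R0. apply cond_pos. }
  assert (hp : 0 < psi (c mu - e) mu - v)
    by (apply Rlt_0_minus; rewrite <- h2; apply dec; auto; lra).
  assert (hn : psi (c mu + e) mu - v < 0)
    by (apply Rlt_minus; rewrite <- h2; apply dec; auto; lra).
  assert (ip : - s < c mu - e < s) by lra. assert (iq : - s < c mu + e < s) by lra.
  generalize (filter_and _ _ (open_sym_interval m mu hmu)
     (filter_and _ _ (nh (c mu - e) ip (Rgt_not_eq _ _ hp))
       (nh (c mu + e) iq (Rlt_not_eq _ _ hn)))).
  apply filter_imp. intros t [ht [t1 t2]].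
  rewrite (Rabs_pos_eq (psi (c mu - e) mu - v)) in t1 by lra.
  rewrite (Rabs_left (psi (c mu + e) mu - v)) in t2 by lra.
  apply Rabs_def2 in t1. apply Rabs_def2 in t2.
  destruct (hc t ht) as [g1 g2].
  assert (c mu - e < c t).
  { destruct (Rlt_or_le (c mu - e) (c t)) as [q|q]; auto. exfalso.
    destruct (Req_dec (c t) (c mu - e)) as [q'|q']; [rewrite q' in g2; lra|].
    assert (psi (c mu - e) t < psi (c t) t) by (apply dec; auto; lra). lra. }
  assert (c t < c mu + e).
  { destruct (Rlt_or_le (c t) (c mu + e)) as [q|q]; auto. exfalso.
    destruct (Req_dec (c t) (c mu + e)) as [q'|q']; [rewrite q' in g2; lra|].
    assert (psi (c t) t < psi (c mu + e) t) by (apply dec; auto; lra). lra. }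
  apply Rabs_def1; lra.
Qed.

(** * The linear equation [v = a + b * (v o F)] *)

Fixpoint lin_iter (F a b : R -> R) (n : nat) (x : R) : R :=
  match n with 0 => 0 | S m => a x + b x * lin_iter F a b m (F x) end.

Fixpoint lin_tail (F b W : R -> R) (n : nat) (x : R) : R :=
  match n with 0 => W x | S m => Rabs (b x) * lin_tail F b W m (F x) end.

(** [W] is a supersolution of the equation for absolute values, so the iterates
    of the right-hand side from [0] form a Cauchy sequence with remainders
    [lin_tail F b W n]. A constant [W] serves near an attracting fixed point,
    a linear one at a parabolic fixed point, where the sum telescopes. *)
Lemma linear_equation_continuous (J : R -> Prop) (F a b W : R -> R) :
  (forall x, J x -> J (F x)) ->
  (forall x, J x -> continuous F x /\ continuous a x /\ continuous b x) ->
  (forall x, J x -> 0 <= W x /\ Rabs (a x) + Rabs (b x) * W (F x) <= W x) ->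
  (forall x, J x -> forall eps : posreal, exists n,
     locally x (fun y => J y /\ lin_tail F b W n y <= eps)) ->
  exists v : R -> R, forall x, J x ->
    continuous v x /\ v x = a x + b x * v (F x) /\ Rabs (v x) <= W x.
Proof.
  intros hJ hc hW hT.
  set (u := lin_iter F a b). set (T := lin_tail F b W).
  assert (u0 : forall x, u 0%nat x = 0) by reflexivity.
  assert (uS : forall n x, u (S n) x = a x + b x * u n (F x)) by reflexivity.
  assert (T0 : forall x, T 0%nat x = W x) by reflexivity.
  assert (TS : forall n x, T (S n) x = Rabs (b x) * T n (F x)) by reflexivity.
  fold T in hT. clearbody u T.
  assert (hb : forall n x, J x -> Rabs (u n x) <= W x).
  { induction n as [|n IH]; intros x hx.
    - rewrite u0, Rabs_R0. now apply hW.
    - rewrite uS. assert (h1 := Rabs_triang (a x) (b x * u n (F x))). rewrite Rabs_mult in h1.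
      assert (h2 := IH (F x) (hJ x hx)). assert (h3 := Rabs_pos (b x)).
      assert (h4 := hW x hx). nra. }
  assert (hd : forall n m x, J x -> Rabs (u (n + m)%nat x - u n x) <= T n x).
  { induction n as [|n IH]; intros m x hx.
    - rewrite u0, T0, Rminus_0_r. now apply hb.
    - rewrite Nat.add_succ_l, !uS, TS.
      replace (a x + b x * u (n + m)%nat (F x) - (a x + b x * u n (F x)))
        with (b x * (u (n + m)%nat (F x) - u n (F x))) by ring.
      rewrite Rabs_mult. apply Rmult_le_compat_l; [apply Rabs_pos|]. auto. }
  assert (hcu : forall n x, J x -> continuous (u n) x).
  { induction n as [|n IH]; intros x hx.
    - apply (continuous_ext (fun _ => 0)); [intros t; now rewrite u0|apply continuous_const].
    - destruct (hc x hx) as [c1 [c2 c3]].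
      apply (continuous_ext (fun x => a x + b x * u n (F x))); [intros t; now rewrite uS|].
      apply (continuous_plus a (fun x => b x * u n (F x))); [exact c2|].
      apply (continuous_mult b (fun x => u n (F x))); [exact c3|].
      apply (continuous_comp F (u n)); auto. }
  assert (hlim : forall x, J x -> is_lim_seq (fun n => u n x) (real (Lim_seq (fun n => u n x)))).
  { intros x hx. apply Lim_seq_correct'. apply ex_lim_seq_cauchy_corr. intros eps.
    destruct (hT x hx (pos_div_2 (pos_div_2 eps))) as [N hN].
    apply locally_singleton in hN. destruct hN as [_ hN]. exists N. intros n m hn hm.
    assert (e1 := hd N (n - N)%nat x hx). assert (e2 := hd N (m - N)%nat x hx).
    replace (N + (n - N))%nat with n in e1 by lia. replace (N + (m - N))%nat with m in e2 by lia.
    assert (e3 := Rabs_triang (u n x - u N x) (- (u m x - u N x))). rewrite Rabs_Ropp in e3.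
    replace (u n x - u N x + - (u m x - u N x)) with (u n x - u m x) in e3 by ring.
    simpl in hN. assert (0 < eps) by apply cond_pos. lra. }
  set (v := fun x => real (Lim_seq (fun n => u n x))).
  assert (hvb : forall n x, J x -> Rabs (v x - u n x) <= T n x).
  { intros n x hx.
    assert (hl : is_lim_seq (fun m => Rabs (u (m + n)%nat x - u n x)) (Rabs (v x - u n x))).
    { apply (is_lim_seq_abs _ (Finite (v x - u n x))).
      apply (is_lim_seq_minus' (fun m => u (m + n)%nat x) (fun _ => u n x)).
      - apply -> (is_lim_seq_incr_n (fun m => u m x) n). apply hlim, hx.
      - apply is_lim_seq_const. }
    assert (hle : forall m, Rabs (u (m + n)%nat x - u n x) <= T n x).
    { intros m. rewrite Nat.add_comm. now apply hd. }
    assert (h := is_lim_seq_le _ _ _ _ hle hl (is_lim_seq_const (T n x))).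
    exact h. }
  exists v. intros x hx. split; [|split].
  - apply continuous_eps. intros eps.
    destruct (hT x hx (pos_div_2 (pos_div_2 eps))) as [N hN].
    assert (hNx := locally_singleton _ _ hN).
    assert (hcN := proj1 (continuous_eps _ _) (hcu N x hx) (pos_div_2 eps)).
    generalize (filter_and _ _ hN hcN). apply filter_imp. intros y [[hy1 hy2] hy3].
    simpl in *.
    assert (e1 := hvb N x hx). assert (e2 := hvb N y hy1).
    assert (e3 := Rabs_triang (v y - u N y) (u N y - u N x - (v x - u N x))).
    assert (e4 := Rabs_triang (u N y - u N x) (- (v x - u N x))). rewrite Rabs_Ropp in e4.
    replace (v y - u N y + (u N y - u N x - (v x - u N x))) with (v y - v x) in e3 by ring.
    replace (u N y - u N x + - (v x - u N x)) with (u N y - u N x - (v x - u N x)) in e4 by ring.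
    assert (0 < eps) by apply cond_pos. lra.
  - assert (l1 : is_lim_seq (fun n => u (S n) x) (v x)).
    { apply -> (is_lim_seq_incr_1 (fun n => u n x)). now apply hlim. }
    assert (l2 : is_lim_seq (fun n => u (S n) x) (a x + b x * v (F x))).
    { apply (is_lim_seq_ext (fun n => a x + b x * u n (F x))); [intros n; now rewrite uS|].
      apply (is_lim_seq_plus' (fun _ => a x) (fun n => b x * u n (F x)));
        [apply is_lim_seq_const|].
      apply (is_lim_seq_scal_l (fun n => u n (F x)) (b x) (v (F x))). apply hlim. auto. }
    apply is_lim_seq_unique in l1. apply is_lim_seq_unique in l2. rewrite l1 in l2.
    now injection l2.
  - assert (h := hvb 0%nat x hx). now rewrite u0, T0, Rminus_0_r in h.
Qed.

Lemma linear_equation_contracting (J : R -> Prop) (F a b : R -> R) (theta K : R) :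
  open J -> 0 <= theta < 1 -> 0 < K ->
  (forall x, J x -> J (F x)) ->
  (forall x, J x -> continuous F x /\ continuous a x /\ continuous b x) ->
  (forall x, J x -> Rabs (a x) <= K /\ Rabs (b x) <= theta) ->
  exists v : R -> R, forall x, J x -> continuous v x /\ v x = a x + b x * v (F x).
Proof.
  intros hJ ht hK0 hinv hc hb.
  set (W := K / (1 - theta)). assert (hW : 0 < W) by (apply Rdiv_lt_0_compat; lra).
  destruct (linear_equation_continuous J F a b (fun _ => W)) as [v hv]; auto.
  - intros x hx. split; [lra|]. destruct (hb x hx) as [h1 h2].
    assert (h3 : W * (1 - theta) = K) by (unfold W; field; lra). nra.
  - intros x hx eps.
    assert (hT : forall n y, J y -> 0 <= lin_tail F b (fun _ => W) n y <= theta ^ n * W).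
    { induction n as [|n IH]; intros y hy; simpl; [lra|].
      assert (h1 := IH (F y) (hinv y hy)).
      assert (h2 := proj2 (hb y hy)). assert (h3 := Rabs_pos (b y)).
      split; [nra|]. rewrite Rmult_assoc. apply Rmult_le_compat; lra. }
    destruct (pow_lt_1_zero theta ltac:(rewrite Rabs_pos_eq; lra) (eps / W)) as [N hN].
    { apply Rdiv_lt_0_compat; [apply cond_pos|lra]. }
    exists N. specialize (hN N (le_n N)). rewrite Rabs_pos_eq in hN by (apply pow_le; lra).
    generalize (hJ x hx). apply filter_imp. intros y hy. split; [exact hy|].
    apply Rle_trans with (1 := proj2 (hT N y hy)).
    apply Rmult_lt_compat_r with (r := W) in hN; [|lra].
    replace (eps / W * W) with (pos eps) in hN by (field; lra). lra.
  - exists v. intros x hx. destruct (hv x hx) as [h1 [h2 _]]. now split.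
Qed.

(** ** Regularity of continuous solutions near an attracting fixed point *)

Definition around (p e : R) : R -> Prop := fun x => p - e < x < p + e.

Lemma open_around p e : open (around p e).
Proof. apply open_oo. Qed.

Lemma around_abs p e x : around p e x <-> Rabs (x - p) < e.
Proof.
  unfold around. split; intros h.
  - apply Rabs_def1; lra.
  - apply Rabs_def2 in h. lra.
Qed.

Lemma continuous_near (f : R -> R) p (eps : R) :
  0 < eps -> continuous f p -> exists e, 0 < e /\ forall x, around p e x -> Rabs (f x - f p) < eps.
Proof.
  intros he hc. destruct (proj1 (continuous_eps f p) hc (mkposreal eps he)) as [d hd].
  exists d. split; [apply cond_pos|]. intros x hx. apply hd. now apply around_abs.
Qed.

Lemma around_sub p e e' x : e' <= e -> around p e' x -> around p e x.
Proof. unfold around. lra. Qed.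

Lemma continuous_primitive (l u p : R) (v : R -> R) :
  l < p < u -> (forall x, l < x < u -> continuous v x) ->
  exists V, V p = 0 /\ forall x, l < x < u -> is_derive V x (v x).
Proof.
  intros hp hc. exists (fun x => RInt v p x). split; [apply (RInt_point (V := R_CompleteNormedModule))|].
  intros x hx. apply (is_derive_RInt v (fun x => RInt v p x) p x); [|now apply hc].
  generalize (open_oo l u x hx). apply filter_imp. intros y hy.
  apply (RInt_correct (V := R_CompleteNormedModule)).
  apply ex_RInt_continuous. intros z hz. apply hc.
  exact (between_Rmin_Rmax _ _ _ _ _ hp hy hz).
Qed.

Lemma derive_zero_const (l u : R) (f : R -> R) :
  (forall x, l < x < u -> is_derive f x 0) ->
  forall x y, l < x < u -> l < y < u -> f x = f y.
Proof.
  intros hd x y hx hy. destruct (mean_value f (fun _ => 0) x y) as [c [_ hc]]; [|lra].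
  intros z hz. apply hd. exact (between_Rmin_Rmax _ _ _ _ _ hx hy hz).
Qed.

Lemma around_invariant F p e theta x :
  (forall x, around p e x -> Rabs (F x - p) <= theta * Rabs (x - p)) -> theta < 1 ->
  forall e', e' <= e -> around p e' x -> around p e' (F x).
Proof.
  intros hF ht e' he hx. assert (h := hF x (around_sub p e e' x he hx)).
  apply around_abs in hx. apply around_abs. assert (0 <= Rabs (x - p)) by apply Rabs_pos. nra.
Qed.

Lemma open_preimage (J E : R -> Prop) (F : R -> R) :
  open J -> open E -> (forall x, J x -> continuous F x) -> open (fun x => J x /\ E (F x)).
Proof.
  intros hJ hE hc x [h1 h2]. apply filter_and; [now apply hJ|].
  apply (hc x h1 E). now apply hE.
Qed.

(** The equation transports regularity from [F x] back to [x], and every orbit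
    enters an arbitrarily small neighbourhood of [p]. *)
Lemma linear_equation_extend m (A B u F : R -> R) p e theta e' :
  0 <= theta < 1 -> 0 < e' <= e ->
  (forall x, around p e x -> Rabs (F x - p) <= theta * Rabs (x - p)) ->
  C_on m (around p e) A -> C_on m (around p e) B -> C_on m (around p e) F ->
  (forall x, around p e x -> u x = A x + B x * u (F x)) ->
  C_on m (around p e') u -> C_on m (around p e) u.
Proof.
  intros ht he hF hA hB hFm hu hloc.
  assert (G : forall n x, around p e x -> theta ^ n * Rabs (x - p) < e' ->
     exists E : R -> Prop, E x /\ C_on m E u).
  { induction n as [|n IH]; intros x hx hn.
    - exists (around p e'). split; [|exact hloc]. apply around_abs. simpl in hn. lra.
    - assert (hx' := around_invariant F p e theta x hF ltac:(lra) e ltac:(lra) hx).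
      destruct (IH (F x) hx') as [E [hE1 hE2]].
      { apply Rle_lt_trans with (2 := hn). simpl. assert (h := hF x hx).
        assert (0 <= theta ^ n) by (apply pow_le; lra). nra. }
      exists (fun y => around p e y /\ E (F y)). split; [now split|].
      assert (ho : open (fun y => around p e y /\ E (F y))).
      { apply open_preimage; [apply open_around|exact (C_on_open hE2)|].
        intros y hy. exact (C_on_continuous hFm hy). }
      apply C_on_ext with (fun y => A y + B y * u (F y)).
      + intros y [hy _]. symmetry. now apply hu.
      + apply C_on_plus; [|apply C_on_mult].
        * apply (C_on_sub m (around p e)); [exact ho|tauto|exact hA].
        * apply (C_on_sub m (around p e)); [exact ho|tauto|exact hB].
        * apply (C_on_comp m _ E F u); [|exact hE2|tauto].
          apply (C_on_sub m (around p e)); [exact ho|tauto|exact hFm]. }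
  apply C_on_local; [|apply open_around]. intros x hx.
  destruct (pow_lt_1_zero theta ltac:(rewrite Rabs_pos_eq; lra) (e' / e)) as [N hN].
  { apply Rdiv_lt_0_compat; lra. }
  apply (G N x hx). specialize (hN N (le_n N)).
  rewrite Rabs_pos_eq in hN by (apply pow_le; lra). apply around_abs in hx.
  assert (h0 : theta ^ N * e < e').
  { apply Rmult_lt_reg_r with (/ e); [apply Rinv_0_lt_compat; lra|].
    rewrite Rmult_assoc, Rinv_r, Rmult_1_r by lra. exact hN. }
  assert (0 <= theta ^ N) by (apply pow_le; lra).
  assert (0 <= Rabs (x - p)) by apply Rabs_pos. nra.
Qed.

(** If the equation could be differentiated, the derivative of [u] would solve
    [v = (A' + B' (u o F)) + B F' (v o F)]. This equation does have a continuous
    solution [v]; the primitive of [v] with the value [u p] at [p] differs from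
    [u] by a function [d] with [d = B (d o F) - int_p B' (d o F)], and on a small
    interval such a function is bounded by arbitrarily small constants. *)
Lemma linear_equation_C1_near (A B u F : R -> R) p e theta :
  0 <= theta < 1 -> 0 < e ->
  (forall x, around p e x -> Rabs (F x - p) <= theta * Rabs (x - p)) ->
  C_on 1 (around p e) A -> C_on 1 (around p e) B -> C_on 1 (around p e) F ->
  (forall x, around p e x -> Rabs (B x) <= theta /\ Rabs (Derive F x) <= 1) ->
  (forall x, around p e x -> continuous u x /\ u x = A x + B x * u (F x)) ->
  exists e', 0 < e' <= e /\ C_on 1 (around p e') u.
Proof.
  intros ht he hF hA hB hF1 hb hu.
  assert (hpe : around p e p) by (unfold around; lra).
  assert (hFp : F p = p).
  { assert (h := hF p hpe). rewrite Rminus_diag, Rabs_R0, Rmult_0_r in h.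
     apply Rminus_diag_uniq.
    destruct (Req_dec (F p - p) 0); auto. apply Rabs_pos_lt in H. lra. }
  set (a := fun x => Derive A x + Derive B x * u (F x)).
  assert (hinv : forall e' x, e' <= e -> around p e' x -> around p e' (F x)).
  { intros e' x. apply (around_invariant F p e theta); auto; lra. }
  assert (hcF : forall x, around p e x -> continuous F x).
  { intros x hx. exact (C_on_continuous hF1 hx). }
  assert (hcu : forall x, around p e x -> continuous (fun x => u (F x)) x).
  { intros x hx. apply (continuous_comp F u); [now apply hcF|]. apply hu. apply hinv; auto; lra. }
  assert (hcB' : forall x, around p e x -> continuous (Derive B) x).
  { intros x hx. exact (C_on_continuous (C_on_Derive hB) hx). }
  assert (hca : forall x, around p e x -> continuous a x).
  { intros x hx. apply (continuous_plus (Derive A) (fun x => Derive B x * u (F x))).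
    - exact (C_on_continuous (C_on_Derive hA) hx).
    - apply (continuous_mult (Derive B) (fun x => u (F x))); auto. }
  destruct (continuous_near a p 1 ltac:(lra) (hca p hpe)) as [e1 [he1 ha1]].
  destruct (continuous_near (Derive B) p 1 ltac:(lra) (hcB' p hpe)) as [e2 [he2 hB2]].
  destruct (pos_below e e e1 e2) as [e3 he3]; try lra.
  set (K := Rabs (a p) + 1). set (C := Rabs (Derive B p) + 1).
  assert (hK : forall x, around p e3 x -> Rabs (a x) <= K /\ Rabs (Derive B x) <= C).
  { intros x hx.
    assert (h1 := ha1 x (around_sub p e1 e3 x ltac:(lra) hx)).
    assert (h2 := hB2 x (around_sub p e2 e3 x ltac:(lra) hx)).
    assert (h3 := Rabs_triang_inv (a x) (a p)).
    assert (h4 := Rabs_triang_inv (Derive B x) (Derive B p)). unfold K, C. lra. }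
  assert (hK0 : 0 < K) by (unfold K; assert (g := Rabs_pos (a p)); lra).
  assert (hC0 : 0 < C) by (unfold C; assert (g := Rabs_pos (Derive B p)); lra).
  set (b := fun x => B x * Derive F x).
  assert (hbb : forall x, around p e x -> Rabs (b x) <= theta).
  { intros x hx. unfold b. rewrite Rabs_mult. destruct (hb x hx) as [h1 h2].
     assert (g2 := Rabs_pos (Derive F x)). nra. }
  destruct (linear_equation_contracting (around p e3) F a b theta K) as [v hv]; auto.
  { apply open_around. }
  { intros x hx. apply hinv; [lra|exact hx]. }
  { intros x hx. assert (hx' := around_sub p e e3 x ltac:(lra) hx).
    split; [auto|]. split; [auto|]. apply (continuous_mult B (Derive F)).
    - exact (C_on_continuous hB hx').
    - exact (C_on_continuous (C_on_Derive hF1) hx'). }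
  { intros x hx. split; [now apply hK|]. apply hbb. apply (around_sub p e e3); [lra|exact hx]. }
  (* [w] is the candidate: the primitive of [v] through [(p, u p)] *)
  destruct (continuous_primitive (p - e3) (p + e3) p v) as [V [hV0 hV]];
    [lra|intros x hx; now apply hv|].
  set (w := fun x => u p + V x).
  assert (hw : forall x, around p e3 x -> is_derive w x (v x)).
  { intros x hx. evar_last.
    - apply (is_derive_plus (fun _ => u p) V); [apply is_derive_const|now apply hV].
    - apply plus_zero_l. }
  set (d := fun x => u x - w x).
  assert (hd0 : d p = 0) by (unfold d, w; rewrite hV0; ring).
  assert (hdc : forall x, around p e3 x -> continuous d x).
  { intros x hx. apply (continuous_minus u w).
    - apply hu. apply (around_sub p e e3); [lra|exact hx].
    - apply (ex_derive_continuous w). exists (v x). now apply hw. }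
  (* [D = d - B (d o F)], written without [u], whose differentiability is at stake *)
  set (D := fun x => A x + B x * w (F x) - w x).
  assert (hD : forall x, around p e3 x -> is_derive D x (- (Derive B x * d (F x)))).
  { intros x hx. assert (hx' := around_sub p e e3 x ltac:(lra) hx).
    assert (hFx := hinv e3 x ltac:(lra) hx).
    assert (i1 := C_on_is_derive hA hx'). assert (i2 := C_on_is_derive hB hx').
    assert (i3 := C_on_is_derive hF1 hx').
    assert (i4 := is_derive_comp w F x _ _ (hw (F x) hFx) i3).
    assert (i5 := is_derive_mult B (fun x => w (F x)) x _ _ i2 i4 Rmult_comm).
    assert (i6 := is_derive_plus A _ x _ _ i1 i5).
    assert (i7 := is_derive_minus _ w x _ _ i6 (hw x hx)).
    evar_last; [exact i7|]. destruct (hv x hx) as [_ e4']. rewrite e4'.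
    unfold minus, plus, opp, mult, scal; simpl. unfold mult; simpl. unfold a, b, d. ring. }
  assert (hdD : forall x, around p e3 x -> d x - B x * d (F x) = D x).
  { intros x hx. unfold d, D. rewrite (proj2 (hu x (around_sub p e e3 x ltac:(lra) hx))) at 1.
    ring. }
  assert (hDp : D p = 0) by (rewrite <- hdD by (unfold around; lra); rewrite hFp, hd0; ring).
  destruct (continuous_near d p 1 ltac:(lra) (hdc p ltac:(unfold around; lra)))
    as [e4 [he4 hd4]].
  assert (hq : 0 < (1 - theta) / (2 * C)) by (apply Rdiv_lt_0_compat; lra).
  destruct (pos_below e3 e3 e4 ((1 - theta) / (2 * C))) as [e5 he5]; try lra.
  assert (he5C : e5 * C <= (1 - theta) / 2).
  { apply Rle_trans with ((1 - theta) / (2 * C) * C); [|right; field; lra].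
    apply Rmult_le_compat_r; lra. }
  assert (hp5 : around p e5 p) by (unfold around; lra).
  set (ka := (1 + theta) / 2).
  assert (hit : forall n x, around p e5 x -> Rabs (d x) <= ka ^ n).
  { induction n as [|n IH]; intros x hx.
    - simpl. rewrite <- (Rminus_0_r (d x)), <- hd0. left. apply hd4.
      apply (around_sub p e4 e5); [lra|exact hx].
    - assert (hx3 := around_sub p e3 e5 x ltac:(lra) hx).
      assert (hxe := around_sub p e e3 x ltac:(lra) hx3).
      destruct (mean_value D (fun x => - (Derive B x * d (F x))) p x) as [c [hc1 hc2]].
      { intros z hz. apply hD. apply (around_sub p e3 e5); [lra|].
        exact (between_Rmin_Rmax _ _ _ _ _ hp5 hx hz). }
      assert (hcz : around p e5 c).
      { exact (between_Rmin_Rmax _ _ _ _ _ hp5 hx hc1). }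
      rewrite hDp, Rminus_0_r in hc2. rewrite <- hdD in hc2 by exact hx3.
      assert (hdx : d x = B x * d (F x) + - (Derive B c * d (F c)) * (x - p)) by lra.
      rewrite hdx.
      assert (t1 := Rabs_triang (B x * d (F x)) (- (Derive B c * d (F c)) * (x - p))).
      rewrite Rabs_mult, (Rabs_mult (- (Derive B c * d (F c)))), Rabs_Ropp, Rabs_mult in t1.
      assert (t2 := proj1 (hb x hxe)).
      assert (t3 := proj2 (hK c (around_sub p e3 e5 c ltac:(lra) hcz))).
      assert (t4 := IH _ (hinv e5 x ltac:(lra) hx)).
      assert (t5 := IH _ (hinv e5 c ltac:(lra) hcz)).
      apply around_abs in hx.
      assert (p1 := Rabs_pos (B x)). assert (p2 := Rabs_pos (d (F x))).
      assert (p3 := Rabs_pos (Derive B c)). assert (p4 := Rabs_pos (d (F c))).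
      assert (p5 := Rabs_pos (x - p)).
      assert (s1 : Rabs (B x) * Rabs (d (F x)) <= theta * ka ^ n)
        by (apply Rmult_le_compat; lra).
      assert (s2 : Rabs (Derive B c) * Rabs (d (F c)) <= C * ka ^ n)
        by (apply Rmult_le_compat; lra).
      assert (s3 : Rabs (Derive B c) * Rabs (d (F c)) * Rabs (x - p) <= C * ka ^ n * e5).
      { apply Rmult_le_compat; try lra. apply Rmult_le_pos; lra. }
      assert (s4 : C * ka ^ n * e5 <= (1 - theta) / 2 * ka ^ n).
      { replace (C * ka ^ n * e5) with (e5 * C * ka ^ n) by ring.
        apply Rmult_le_compat_r; lra. }
      simpl. unfold ka at 1. lra. }
  assert (hdz : forall x, around p e5 x -> u x = w x).
  { intros x hx. destruct (Req_dec (d x) 0) as [z|nz]; [unfold d in z; lra|exfalso].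
    apply Rabs_pos_lt in nz.
    destruct (pow_lt_1_zero ka) with (y := Rabs (d x)) as [N hN].
    { rewrite Rabs_pos_eq; unfold ka; lra. }
    { lra. }
    specialize (hN N (le_n N)). rewrite Rabs_pos_eq in hN by (apply pow_le; unfold ka; lra).
    assert (h := hit N x hx). lra. }
  exists e5. split; [lra|]. apply C_on_ext with w; [intros x hx; symmetry; auto|].
  apply C_on_S_intro with v.
  + intros x hx. apply hw. apply (around_sub p e3 e5); [lra|exact hx].
  + apply C_on_0. split; [apply open_around|]. intros x hx. apply hv.
    apply (around_sub p e3 e5); [lra|exact hx].
Qed.

Lemma linear_equation_C_on m (F : R -> R) p e theta :
  0 <= theta < 1 -> 0 < e ->
  (forall x, around p e x -> Rabs (F x - p) <= theta * Rabs (x - p)) ->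
  (forall x, around p e x -> Rabs (Derive F x) <= 1) ->
  C_on m (around p e) F ->
  forall A B u : R -> R,
  C_on m (around p e) A -> C_on m (around p e) B ->
  (forall x, around p e x -> Rabs (B x) <= theta) ->
  (forall x, around p e x -> continuous u x /\ u x = A x + B x * u (F x)) ->
  C_on m (around p e) u.
Proof.
  intros ht he hF hF'. induction m as [|m IH]; intros hFm A B u hA hB hb hu.
  - apply C_on_0. split; [apply open_around|]. intros x hx. now apply hu.
  - assert (le1 : (1 <= S m)%nat) by lia.
    assert (hA1 := C_on_le _ _ _ _ le1 hA). assert (hB1 := C_on_le _ _ _ _ le1 hB).
    assert (hF1 := C_on_le _ _ _ _ le1 hFm).
    assert (lem : (m <= S m)%nat) by lia.
    assert (hum : C_on m (around p e) u).
    { apply (IH (C_on_le _ _ _ _ lem hFm) A B u); auto;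
        apply (C_on_le (S m)); auto. }
    assert (hu1 : C_on 1 (around p e) u).
    { destruct (linear_equation_C1_near A B u F p e theta) as [e' [he' hC]]; auto.
      apply (linear_equation_extend 1 A B u F p e theta e'); auto. intros x hx. now apply hu. }
    assert (hinv : forall x, around p e x -> around p e (F x)).
    { intros x hx. apply (around_invariant F p e theta); auto; lra. }
    assert (hd : forall x, around p e x ->
      Derive u x = (Derive A x + Derive B x * u (F x)) + B x * Derive F x * Derive u (F x)).
    { intros x hx. apply is_derive_unique.
      apply (is_derive_ext_loc (fun x => A x + B x * u (F x))).
      - generalize (open_around p e x hx). apply filter_imp. intros y hy. symmetry. now apply hu.
      - assert (i1 := C_on_is_derive hA1 hx). assert (i2 := C_on_is_derive hB1 hx).
        assert (i3 := C_on_is_derive hF1 hx).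
        assert (i4 := is_derive_comp u F x _ _ (C_on_is_derive hu1 (hinv x hx)) i3).
        assert (i5 := is_derive_mult B (fun x => u (F x)) x _ _ i2 i4 Rmult_comm).
        evar_last; [exact (is_derive_plus A _ x _ _ i1 i5)|].
        unfold plus, mult, scal; simpl. unfold mult; simpl. ring. }
    apply C_on_S_intro with (Derive u).
    + intros x hx. exact (C_on_is_derive hu1 hx).
    + apply (IH (C_on_le _ _ _ _ lem hFm)
        (fun x => Derive A x + Derive B x * u (F x)) (fun x => B x * Derive F x)).
      * apply C_on_plus; [now apply C_on_Derive|]. apply C_on_mult; [now apply C_on_Derive|].
        apply (C_on_comp m _ (around p e) F u); auto. now apply (C_on_le (S m)).
      * apply C_on_mult; [now apply (C_on_le (S m))|now apply C_on_Derive].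
      * intros x hx. rewrite Rabs_mult. assert (h1 := hb x hx). assert (h2 := hF' x hx).
         assert (h4 := Rabs_pos (Derive F x)). nra.
      * intros x hx. split; [|now apply hd].
        exact (C_on_continuous (C_on_Derive hu1) hx).
Qed.

(** * Linearization at an attracting fixed point *)

(** The logarithmic derivative [v = phi'' / phi'] of a coordinate in which [F] is
    multiplication by [F'(p)] solves [v = F''/F' + F' (v o F)], a linear equation
    whose factor [F'] is less than one near [p]. Integrating [v] twice gives [phi]. *)
Lemma koenigs_local n (F : R -> R) p r :
  0 < r -> C_on (S (S n)) (around p r) F -> F p = p -> 0 < Derive F p < 1 ->
  exists e phi, 0 < e <= r /\ C_on (S (S n)) (around p e) phi /\ phi p = 0 /\
    (forall x, around p e x -> 0 < Derive phi x) /\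
    (forall x, around p e x -> around p e (F x) /\ phi (F x) = Derive F p * phi x).
Proof.
  intros hr hF hp hlam. set (lam := Derive F p) in *. set (theta := (1 + lam) / 2).
  assert (hpr : around p r p) by (unfold around; lra).
  assert (hF' := C_on_Derive hF). assert (hF'' := C_on_Derive hF').
  assert (hc1 := C_on_continuous hF' hpr).
  destruct (pos_below lam lam ((1 - lam) / 2) 1) as [q hq]; try lra.
  destruct (continuous_near (Derive F) p q (proj1 hq) hc1) as [e1 [he1 hd1]].
  destruct (pos_below r r e1 e1) as [e2 he2]; try lra.
  assert (hFb : forall x, around p e2 x -> 0 < Derive F x <= theta).
  { intros x hx. assert (h := hd1 x (around_sub p e1 e2 x ltac:(lra) hx)).
    apply Rabs_def2 in h. fold lam in h. unfold theta. lra. }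
  set (N := fun x => Derive (Derive F) x * / Derive F x).
  assert (hN : C_on n (around p e2) N).
  { assert (sub : forall x, around p e2 x -> around p r x).
    { intros x. apply around_sub. lra. }
    apply C_on_mult.
    - apply (C_on_sub n (around p r)); auto. apply open_around.
    - apply C_on_inv.
      + apply (C_on_sub n (around p r)); auto; [apply open_around|]. apply (C_on_le (S n)); auto.
      + intros x hx. specialize (hFb x hx). lra. }
  assert (hp2 : around p e2 p) by (unfold around; lra).
  destruct (continuous_near N p 1 ltac:(lra) (C_on_continuous hN hp2)) as [e3 [he3 hN3]].
  destruct (pos_below e2 e2 e3 e3) as [e he]; try lra.
  assert (to2 : forall x, around p e x -> around p e2 x) by (intros x; apply around_sub; lra).
  assert (tor : forall x, around p e x -> around p r x) by (intros x; apply around_sub; lra).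
  assert (hpe : around p e p) by (unfold around; lra).
  assert (ht : 0 <= theta < 1) by (unfold theta; lra).
  assert (hFe : C_on (S (S n)) (around p e) F).
  { apply (C_on_sub _ (around p r)); auto. apply open_around. }
  assert (hder : forall x, around p e x -> is_derive F x (Derive F x)).
  { intros x hx. exact (C_on_is_derive hFe hx). }
  assert (hder2 : forall x, around p e x -> is_derive (Derive F) x (Derive (Derive F) x)).
  { intros x hx. exact (C_on_is_derive (C_on_Derive hFe) hx). }
  assert (hcon : forall x, around p e x -> Rabs (F x - p) <= theta * Rabs (x - p)).
  { intros x hx. destruct (mean_value F (Derive F) p x) as [c [hc hc2]].
    - intros z hz. apply hder. exact (between_Rmin_Rmax _ _ _ _ _ hpe hx hz).
    - rewrite hp in hc2. rewrite hc2, Rabs_mult. apply Rmult_le_compat_r; [apply Rabs_pos|].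
      assert (hce : around p e2 c).
      { apply to2. exact (between_Rmin_Rmax _ _ _ _ _ hpe hx hc). }
      specialize (hFb c hce). rewrite Rabs_pos_eq; lra. }
  assert (hinv : forall x, around p e x -> around p e (F x)).
  { intros x hx. apply (around_invariant F p e theta); auto; lra. }
  set (K := Rabs (N p) + 1).
  assert (hK0 : 0 < K) by (unfold K; assert (g := Rabs_pos (N p)); lra).
  destruct (linear_equation_contracting (around p e) F N (Derive F) theta K) as [v hv]; auto.
  { apply open_around. }
  { intros x hx. split; [exact (C_on_continuous hFe hx)|]. split.
    - exact (C_on_continuous hN (to2 x hx)).
    - exact (C_on_continuous (C_on_Derive hFe) hx). }
  { intros x hx. specialize (hFb x (to2 x hx)).
    assert (h1 := hN3 x (around_sub p e3 e x ltac:(lra) hx)).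
    assert (h2 := Rabs_triang_inv (N x) (N p)).
    rewrite (Rabs_pos_eq (Derive F x)) by lra. unfold K. lra. }
  assert (hvn : C_on n (around p e) v).
  { apply (linear_equation_C_on n F p e theta) with (A := N) (B := Derive F); auto; try lra.
    - intros x hx. specialize (hFb x (to2 x hx)). rewrite Rabs_pos_eq; lra.
    - apply (C_on_le (S (S n))); [lia|exact hFe].
    - apply (C_on_sub n (around p e2)); auto. apply open_around.
    - apply (C_on_le (S n)); [lia|]. now apply C_on_Derive.
    - intros x hx. specialize (hFb x (to2 x hx)). rewrite Rabs_pos_eq; lra. }
  destruct (continuous_primitive (p - e) (p + e) p v) as [L [hL0 hL]];
    [lra|intros x hx; now apply hv|].
  assert (hLn : C_on (S n) (around p e) L) by (apply C_on_S_intro with v; auto).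
  assert (hEn : C_on (S n) (around p e) (fun x => exp (L x))).
  { apply (C_on_comp (S n) (around p e) (fun _ => True) L exp); auto.
    apply C_on_exp. apply open_true. }
  (* [ln (phi')] satisfies [L = ln F' - ln F'(p) + L o F] *)
  assert (hLF : forall x, around p e x -> L x = L (F x) + ln (Derive F x) - ln lam).
  { intros x hx.
    assert (hz : L x - L (F x) - ln (Derive F x) = L p - L (F p) - ln (Derive F p)).
    { apply (derive_zero_const (p - e) (p + e) (fun x => L x - L (F x) - ln (Derive F x)));
        [|exact hx|exact hpe].
      intros y hy. assert (hFy := hFb y (to2 y hy)).
      assert (i1 := is_derive_comp L F y _ _ (hL (F y) (hinv y hy)) (hder y hy)).
      assert (i2 : is_derive ln (Derive F y) (/ Derive F y)) by (apply is_derive_ln; lra).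
      assert (i3 := is_derive_comp ln (Derive F) y _ _ i2 (hder2 y hy)).
      assert (i4 := is_derive_minus _ _ y _ _ (is_derive_minus L _ y _ _ (hL y hy) i1) i3).
      evar_last; [exact i4|]. destruct (hv y hy) as [_ e4]. rewrite e4.
      unfold minus, plus, opp, scal; simpl. unfold mult; simpl. unfold N. ring. }
    rewrite hp, hL0 in hz. fold lam in hz. lra. }
  destruct (continuous_primitive (p - e) (p + e) p (fun x => exp (L x))) as [phi [hphi0 hphi]].
  { lra. }
  { intros x hx. exact (C_on_continuous hEn hx). }
  exists e, phi. split; [lra|]. split; [apply C_on_S_intro with (fun x => exp (L x)); auto|].
  split; [exact hphi0|]. split.
  + intros x hx. rewrite (is_derive_unique phi x _ (hphi x hx)). apply exp_pos.
  + intros x hx. split; [now apply hinv|].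
    assert (hz : phi (F x) - lam * phi x = phi (F p) - lam * phi p).
    { apply (derive_zero_const (p - e) (p + e) (fun x => phi (F x) - lam * phi x));
        [|exact hx|exact hpe].
      intros y hy. assert (hFy := hFb y (to2 y hy)).
      assert (i1 := is_derive_comp phi F y _ _ (hphi (F y) (hinv y hy)) (hder y hy)).
      assert (i2 := is_derive_scal phi y lam _ (hphi y hy)).
      evar_last; [exact (is_derive_minus _ _ y _ _ i1 i2)|].
      rewrite (hLF y hy). unfold Rminus at 1. rewrite !exp_plus, exp_Ropp, !exp_ln by lra.
      unfold minus, plus, opp, scal; simpl. unfold mult; simpl. field. lra. }
    rewrite hp, hphi0 in hz. lra.
Qed.

(** * Monotone orbits and basins *)

Definition mirror (F : R -> R) : R -> R := fun x => - F (- x).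

Lemma iter_mirror F n x : Nat.iter n (mirror F) x = - Nat.iter n F (- x).
Proof.
  induction n as [|n IH]; simpl; [ring|]. rewrite IH. unfold mirror. now rewrite Ropp_involutive.
Qed.

Lemma continuous_Ropp x : continuous Ropp x.
Proof. apply (ex_derive_continuous (fun x => - x)). auto_derive. exact I. Qed.

Lemma iter_decreasing_cvg F p x :
  p <= x -> F p = p -> (forall y, p < y <= x -> p <= F y < y /\ continuous F y) ->
  (forall n, p <= Nat.iter n F x <= x) /\ is_lim_seq (fun n => Nat.iter n F x) p.
Proof.
  intros hx hp hF.
  assert (hb : forall n, p <= Nat.iter n F x <= x).
  { induction n as [|n IH]; simpl; [lra|].
    destruct (Req_dec (Nat.iter n F x) p) as [e|ne]; [rewrite e; lra|].
    destruct (hF (Nat.iter n F x)); lra. }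
  split; [exact hb|].
  assert (hdec : forall n, Nat.iter (S n) F x <= Nat.iter n F x).
  { intros n. simpl. specialize (hb n).
    destruct (Req_dec (Nat.iter n F x) p) as [e|ne]; [rewrite e; lra|].
    destruct (hF (Nat.iter n F x)); lra. }
  destruct (ex_finite_lim_seq_decr (fun n => Nat.iter n F x) p hdec (fun n => proj1 (hb n)))
    as [L hL].
  assert (h1 : Rbar_le p L).
  { apply (is_lim_seq_le (fun _ => p) (fun n => Nat.iter n F x)); auto; [|apply is_lim_seq_const].
    intros n. apply hb. }
  assert (h2 : Rbar_le L x).
  { apply (is_lim_seq_le (fun n => Nat.iter n F x) (fun _ => x)); auto; [|apply is_lim_seq_const].
    intros n. apply hb. }
  simpl in h1, h2. destruct (Req_dec L p) as [e|ne]; [now rewrite <- e|exfalso].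
  destruct (hF L ltac:(lra)) as [h3 h4].
  assert (l1 : is_lim_seq (fun n => F (Nat.iter n F x)) (F L)).
  { apply (filterlim_comp _ _ _ (fun n => Nat.iter n F x) F eventually (locally L) (locally (F L)));
      [exact hL|exact h4]. }
  assert (l2 : is_lim_seq (fun n => F (Nat.iter n F x)) L).
  { exact (proj1 (is_lim_seq_incr_1 (fun n => Nat.iter n F x) L) hL). }
  apply is_lim_seq_unique in l1. apply is_lim_seq_unique in l2. rewrite l1 in l2.
  injection l2. lra.
Qed.

Lemma iter_increasing_cvg F p x :
  x <= p -> F p = p -> (forall y, x <= y < p -> y < F y <= p /\ continuous F y) ->
  (forall n, x <= Nat.iter n F x <= p) /\ is_lim_seq (fun n => Nat.iter n F x) p.
Proof.
  intros hx hp hF.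
  destruct (iter_decreasing_cvg (mirror F) (- p) (- x)) as [h1 h2].
  - lra.
  - unfold mirror. now rewrite Ropp_involutive, hp.
  - intros y hy. destruct (hF (- y) ltac:(lra)) as [g1 g2]. unfold mirror. split; [lra|].
    apply (continuous_comp (fun x => F (- x)) Ropp); [|apply continuous_Ropp].
    apply (continuous_comp Ropp F); [apply continuous_Ropp|exact g2].
  - assert (e : forall n, Nat.iter n (mirror F) (- x) = - Nat.iter n F x).
    { intros n. now rewrite iter_mirror, Ropp_involutive. }
    split.
    + intros n. specialize (h1 n). rewrite e in h1. lra.
    + apply is_lim_seq_opp. apply (is_lim_seq_ext _ _ _ e). exact h2.
Qed.

Record sink (l u p : R) (F : R -> R) : Prop := {
  sink_in : l < p < u;
  sink_fix : F p = p;
  sink_incr : forall x y, l < x -> x < y -> y < u -> F x < F y;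
  sink_left : forall x, l < x < p -> x < F x;
  sink_right : forall x, p < x < u -> F x < x;
  sink_cont : forall x, l < x < u -> continuous F x }.

Lemma sink_iter l u p F x :
  sink l u p F -> l < x < u ->
  (forall n, l < Nat.iter n F x < u /\ Rabs (Nat.iter n F x - p) <= Rabs (x - p)) /\
  is_lim_seq (fun n => Nat.iter n F x) p.
Proof.
  intros [hin hfix hinc hl hr hc] hx. destruct (Rle_or_lt p x) as [c|c].
  - destruct (iter_decreasing_cvg F p x c hfix) as [h1 h2].
    { intros y hy. assert (F p < F y) by (apply hinc; lra). assert (F y < y) by (apply hr; lra).
      split; [lra|]. apply hc. lra. }
    split; [|exact h2]. intros n. specialize (h1 n). split; [lra|].
    rewrite !Rabs_pos_eq; lra.
  - destruct (iter_increasing_cvg F p x ltac:(lra) hfix) as [h1 h2].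
    { intros y hy. assert (F y < F p) by (apply hinc; lra). assert (y < F y) by (apply hl; lra).
      split; [lra|]. apply hc. lra. }
    split; [|exact h2]. intros n. specialize (h1 n). split; [lra|].
    rewrite <- (Rabs_Ropp (x - p)), <- (Rabs_Ropp (_ - p)), !Rabs_pos_eq; lra.
Qed.

Lemma sink_invariant l u p F x : sink l u p F -> l < x < u -> l < F x < u.
Proof. intros hs hx. exact (proj1 (proj1 (sink_iter l u p F x hs hx) 1%nat)). Qed.

Lemma sink_shrink l u u' p F : sink l u p F -> p < u' <= u -> sink l u' p F.
Proof.
  intros [h1 h2 h3 h4 h5 h6] hu. constructor; auto; try lra.
  - intros x y a b c. apply h3; lra.
  - intros x a. apply h5; lra.
  - intros x a. apply h6; lra.
Qed.

Lemma sink_stable l u p F : sink l u p F -> stable F p.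
Proof.
  intros hs. assert (hin := sink_in _ _ _ _ hs).
  split.
  - intros eps. destruct (pos_below eps eps (p - l) (u - p)) as [e he];
      try apply cond_pos; try lra.
    exists (mkposreal e (proj1 he)). simpl. intros x hx n. assert (hx' := Rabs_def2 _ _ hx).
    destruct (proj1 (sink_iter l u p F x hs ltac:(lra)) n). lra.
  - destruct (pos_below (p - l) (p - l) (u - p) (u - p)) as [e he]; try lra.
    exists (mkposreal e (proj1 he)). simpl. intros x hx. apply Rabs_def2 in hx.
    apply (sink_iter l u p F x hs). lra.
Qed.

Lemma unstable_of_escape F p q :
  p < q -> (forall x, p < x < q -> is_lim_seq (fun n => Nat.iter n F x) q) -> unstable F p.
Proof.
  intros hpq hF hst.
  destruct (hst (mkposreal ((q - p) / 2) ltac:(lra))) as [d hd]. simpl in hd.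
  destruct (pos_below d d (q - p) (q - p)) as [e he]; try apply cond_pos; try lra.
  set (x := p + e). assert (hx : Rabs (x - p) < d) by (unfold x; rewrite Rabs_pos_eq; lra).
  assert (hl := hF x ltac:(unfold x; lra)).
  apply is_lim_seq_spec in hl. destruct (hl (mkposreal ((q - p) / 2) ltac:(lra))) as [N hN].
  specialize (hN N (le_n N)). simpl in hN. specialize (hd x hx N).
  apply Rabs_def2 in hN. apply Rabs_def2 in hd. lra.
Qed.

(** * Linearization on a whole basin *)

Lemma increasing_le_of_lt (f : R -> R) (l u : R) :
  (forall x y, l < x -> x < y -> y < u -> f x < f y) ->
  forall x y, l < x < u -> l < y < u -> f x < f y -> x < y.
Proof.
  intros hi x y hx hy h. destruct (Rtotal_order x y) as [c|[c|c]]; auto; exfalso.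
  - subst. lra.
  - assert (f y < f x) by (apply hi; lra). lra.
Qed.

Lemma C_diffeo_onto_ray n l u u0 phi :
  C_on (S n) (fun x => l < x < u) phi -> (forall x, l < x < u -> 0 < Derive phi x) ->
  l < u0 < u -> (forall K, exists x, l < x < u0 /\ phi x < K) ->
  C_diffeo (S n) (fun x => l < x < u0) (fun y => y < phi u0) phi.
Proof.
  intros hC hp hu0 hinf.
  assert (hinc := derive_pos_increasing l u phi (Derive phi)
    (fun x hx => C_on_is_derive hC hx) hp).
  apply C_diffeo_of_increasing.
  - apply (C_on_interval l u); [lra|lra|exact hC].
  - intros x hx. apply hp. lra.
  - apply open_lt.
  - intros x hx. apply hinc; lra.
  - intros y hy. destruct (hinf y) as [a [ha1 ha2]].
    destruct (IVT_ge phi a u0 y) as [x [hx1 hx2]]; try lra.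
    + intros z hz. apply (C_on_continuous hC). lra.
    + exists x. split; [|exact hx2].
      assert (x <> u0) by (intros e; subst; lra). lra.
Qed.

Lemma C_diffeo_affine_ray s c d y0 :
  0 < c -> C_diffeo s (fun y => y < y0) (fun y => y < c * y0 + d) (fun y => c * y + d).
Proof.
  intros hc.
  assert (hA : forall c d z, C_on s (fun y => y < z) (fun y => c * y + d)).
  { intros c' d' z. assert (ho : open (fun y => y < z)) by apply open_lt.
    apply C_on_plus; [|now apply C_on_const]. apply C_on_scal. now apply C_on_id. }
  split; [apply hA|]. split; [intros; nra|].
  exists (fun z => / c * z + - d / c). split; [apply hA|]. split; [|split].
  - intros z hz. apply Rmult_lt_reg_l with c; [lra|].
    replace (c * (/ c * z + - d / c)) with (z - d) by (field; lra). lra.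
  - intros x _. field. lra.
  - intros z _. field. lra.
Qed.

Lemma inv_pow_unbounded lam K : 0 < lam < 1 -> exists k : nat, K < (/ lam) ^ k.
Proof.
  intros hl. destruct (Pow_x_infinity (/ lam)) with (b := K + 1) as [N hN].
  - rewrite Rabs_pos_eq.
    + rewrite <- Rinv_1. apply Rinv_lt_contravar; lra.
    + left. apply Rinv_0_lt_compat. lra.
  - exists N. specialize (hN N (le_n N)). rewrite Rabs_pos_eq in hN; [lra|].
    apply pow_le. left. apply Rinv_0_lt_compat. lra.
Qed.

(** The local coordinate [phi0] propagates along the basin through
    [phi = lam^-k (phi0 o F^k)], which does not depend on [k] once the orbit has
    reached the domain of [phi0]: the sequence is eventually constant in [k], and
    [Lim_seq] selects its final value. *)
Lemma koenigs n l u p F :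
  sink l u p F -> C_on (S (S n)) (fun x => l < x < u) F ->
  (forall x, l < x < u -> 0 < Derive F x) -> Derive F p < 1 ->
  exists phi, C_on (S (S n)) (fun x => l < x < u) phi /\ phi p = 0 /\
    (forall x, l < x < u -> 0 < Derive phi x) /\
    (forall x, l < x < u -> phi (F x) = Derive F p * phi x).
Proof.
  intros hs hC hpos hlam. set (lam := Derive F p) in *.
  assert (hin := sink_in _ _ _ _ hs). assert (hfix := sink_fix _ _ _ _ hs).
  assert (hl0 : 0 < lam) by (apply hpos; exact hin).
  destruct (pos_below (p - l) (p - l) (u - p) (u - p)) as [r hr]; try lra.
  assert (hrI : forall x, around p r x -> l < x < u) by (unfold around; intros; lra).
  destruct (koenigs_local n F p r) as [e [phi0 [he [hphi [h0 [hd0 hF0]]]]]]; try apply hr; auto.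
  { apply (C_on_sub _ (fun x => l < x < u)); [apply open_around|exact hrI|exact hC]. }
  fold lam in hF0.
  set (seqphi := fun x k => phi0 (Nat.iter k F x) / lam ^ k).
  set (phi := fun x => real (Lim_seq (seqphi x))).
  assert (hphi_eq : forall x k, around p e (Nat.iter k F x) -> phi x = seqphi x k).
  { intros x k hk.
    assert (hst : forall j, around p e (Nat.iter (j + k) F x) /\ seqphi x (j + k)%nat = seqphi x k).
    { induction j as [|j [IH1 IH2]]; [split; [exact hk|reflexivity]|].
      destruct (hF0 _ IH1) as [g1 g2]. split; [exact g1|]. rewrite <- IH2.
      unfold seqphi. simpl. rewrite g2. field. split; [apply pow_nonzero|]; lra. }
    unfold phi. rewrite <- (Lim_seq_incr_n (seqphi x) k).
    rewrite (Lim_seq_ext _ (fun _ => seqphi x k)); [now rewrite Lim_seq_const|].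
    intros j. apply hst. }
  assert (hk : forall x, l < x < u -> exists k, around p e (Nat.iter k F x)).
  { intros x hx. destruct (sink_iter l u p F x hs hx) as [_ hlim].
    apply is_lim_seq_spec in hlim. destruct (hlim (mkposreal e (proj1 he))) as [N hN].
    exists N. apply around_abs. apply (hN N (le_n N)). }
  assert (hinv : forall x, l < x < u -> l < F x < u) by (intros x; now apply (sink_invariant l u p)).
  assert (hit : forall k, C_on (S (S n)) (fun x => l < x < u) (Nat.iter k F)).
  { intros k. now apply C_on_iter. }
  assert (hfun : forall x, l < x < u -> phi (F x) = lam * phi x).
  { intros x hx. destruct (hk (F x) (hinv x hx)) as [k hk'].
    rewrite (hphi_eq (F x) k hk').
    rewrite (hphi_eq x (S k)); [|now rewrite Nat.iter_succ_r].
    unfold seqphi. rewrite <- Nat.iter_succ_r. simpl. field. split; [apply pow_nonzero|]; lra. }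
  assert (hphiC : C_on (S (S n)) (fun x => l < x < u) phi).
  { apply C_on_local; [|apply open_oo]. intros x hx. destruct (hk x hx) as [k hk'].
    exists (fun y => l < y < u /\ around p e (Nat.iter k F y)). split; [now split|].
    assert (ho : open (fun y => l < y < u /\ around p e (Nat.iter k F y))).
    { apply open_preimage; [apply open_oo|apply open_around|].
      intros y hy. exact (C_on_continuous (hit k) hy). }
    apply C_on_ext with (fun y => / lam ^ k * phi0 (Nat.iter k F y)).
    - intros y [_ hy]. rewrite (hphi_eq y k hy). unfold seqphi. field. apply pow_nonzero; lra.
    - apply C_on_scal. apply (C_on_comp _ _ (around p e) (Nat.iter k F) phi0).
      + apply (C_on_sub _ (fun x => l < x < u)); [exact ho|tauto|apply hit].
      + exact hphi.
      + tauto. }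
  assert (hder : forall x, l < x < u -> lam * Derive phi x = Derive phi (F x) * Derive F x).
  { intros x hx.
    assert (i1 := is_derive_comp phi F x _ _ (C_on_is_derive hphiC (hinv x hx))
                   (C_on_is_derive hC hx)).
    assert (i2 := is_derive_scal phi x lam _ (C_on_is_derive hphiC hx)).
    apply is_derive_unique in i1. apply is_derive_unique in i2.
    transitivity (Derive (fun x => phi (F x)) x).
    - rewrite <- i2. apply Derive_ext_loc. generalize (open_oo l u x hx). apply filter_imp.
      intros y hy. symmetry. now apply hfun.
    - refine (eq_trans i1 _). unfold scal; simpl. unfold mult; simpl. ring. }
  assert (hloc : forall x, around p e x -> phi x = phi0 x).
  { intros x hx. rewrite (hphi_eq x 0%nat hx). unfold seqphi. simpl. field. }
  exists phi. split; [exact hphiC|]. split; [|split; [|exact hfun]].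
  - rewrite hloc; [exact h0|]. unfold around; lra.
  - assert (G : forall k x, l < x < u -> around p e (Nat.iter k F x) -> 0 < Derive phi x).
    { induction k as [|k IH]; intros x hx hx'.
      - rewrite (Derive_ext_loc phi phi0); [now apply hd0|].
        generalize (open_around p e x hx'). apply filter_imp. exact hloc.
      - assert (g1 : 0 < Derive phi (F x)).
        { apply IH; [now apply hinv|]. now rewrite <- Nat.iter_succ_r. }
        assert (g2 := hpos x hx). assert (g3 := hder x hx).
        apply Rmult_lt_reg_l with lam; [exact hl0|]. rewrite Rmult_0_r, g3.
        now apply Rmult_lt_0_compat. }
    intros x hx. destruct (hk x hx) as [k hk']. now apply (G k).
Qed.

(** Points on the left of [p] have backward orbits in the basin, along which the
    coordinate is multiplied by [1 / F'(p) > 1], so the basin is mapped onto a ray;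
    a linear change of scale normalizes it. This scale is the freedom which
    lets a conjugacy match the right ends of two basins. *)
Lemma sink_coordinate n l u p F u0 :
  sink l u p F -> C_on (S (S n)) (fun x => l < x < u) F ->
  (forall x, l < x < u -> 0 < Derive F x) -> Derive F p < 1 ->
  (forall y, l < y < p -> exists x, l < x < p /\ F x = y) -> p < u0 < u ->
  exists phi, C_diffeo (S (S n)) (fun x => l < x < u0) (fun y => y < 1) phi /\ phi p = 0 /\
    (forall x, l < x < u0 -> phi (F x) = Derive F p * phi x).
Proof.
  intros hs hC hpos hlam hsur hu0.
  destruct (koenigs n l u p F hs hC hpos hlam) as [phi [hphi [h0 [hd hF]]]].
  set (lam := Derive F p) in *. assert (hin := sink_in _ _ _ _ hs).
  assert (hl0 : 0 < lam) by (apply hpos; exact hin).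
  assert (hinc := derive_pos_increasing l u phi (Derive phi)
    (fun x hx => C_on_is_derive hphi hx) hd).
  assert (hq : 0 < phi u0) by (rewrite <- h0; apply hinc; lra).
  assert (hinf : forall K, exists x, l < x < u0 /\ phi x < K).
  { set (x0 := (l + p) / 2).
    assert (hx0 : l < x0 < p) by (unfold x0; lra).
    assert (hn : phi x0 < 0) by (rewrite <- h0; apply hinc; lra).
    assert (B : forall k : nat, exists x, l < x < p /\ phi x = (/ lam) ^ k * phi x0).
    { induction k as [|k [x [hx1 hx2]]]; [exists x0; split; [exact hx0|simpl; ring]|].
      destruct (hsur x hx1) as [z [hz1 hz2]]. exists z. split; [exact hz1|].
      assert (g := hF z ltac:(lra)). rewrite hz2, hx2 in g.
      apply Rmult_eq_reg_l with lam; [|lra]. rewrite <- g. simpl. field. lra. }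
    intros K. destruct (inv_pow_unbounded lam (- K / - phi x0) ltac:(lra)) as [k hk].
    destruct (B k) as [x [hx1 hx2]]. exists x. split; [lra|]. rewrite hx2.
    apply Rmult_lt_compat_r with (r := - phi x0) in hk; [|lra].
    replace (- K / - phi x0 * - phi x0) with (- K) in hk by (field; lra). lra. }
  assert (D1 := C_diffeo_onto_ray (S n) l u u0 phi hphi hd ltac:(lra) hinf).
  assert (D2 := C_diffeo_affine_ray (S (S n)) (/ phi u0) 0 (phi u0)
                 (Rinv_0_lt_compat _ hq)).
  replace (fun y => y < / phi u0 * phi u0 + 0) with (fun y => y < 1) in D2.
  2: { apply pred_ext. intros y. replace (/ phi u0 * phi u0 + 0) with 1 by (field; lra). tauto. }
  exists (fun x => / phi u0 * phi x + 0).
  split; [exact (C_diffeo_comp _ _ _ _ _ _ D1 D2)|]. split; [rewrite h0; ring|].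
  intros x hx. rewrite hF by lra. ring.
Qed.

Record expandable_sink (n : nat) (l u u0 p : R) (F : R -> R) : Prop := {
  es_sink : sink l u p F;
  es_C : C_on (S (S n)) (fun x => l < x < u) F;
  es_pos : forall x, l < x < u -> 0 < Derive F x;
  es_lt1 : Derive F p < 1;
  es_sur : forall y, l < y < p -> exists x, l < x < p /\ F x = y;
  es_u0 : p < u0 < u }.

Lemma sink_conjugacy n l u u0 p F l' u' u0' q G :
  expandable_sink n l u u0 p F -> expandable_sink n l' u' u0' q G ->
  Derive F p = Derive G q ->
  exists h, C_diffeo (S (S n)) (fun x => l < x < u0) (fun y => l' < y < u0') h /\ h p = q /\
    forall x, l < x < u0 -> h (F x) = G (h x).
Proof.
  intros [s1 s2 s3 s4 s5 s6] [t1 t2 t3 t4 t5 t6] he.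
  destruct (sink_coordinate n l u p F u0) as [phi [D1 [z1 f1]]]; auto.
  destruct (sink_coordinate n l' u' q G u0') as [psi [D2 [z2 f2]]]; auto.
  destruct (C_diffeo_through _ _ _ _ phi psi D1 D2) as [h [hD hh]].
  assert (hinj : forall y z, l' < y < u0' -> l' < z < u0' -> psi y = psi z -> y = z).
  { destruct D2 as [_ [_ [k [_ [_ [hk _]]]]]]. intros y z hy hz e.
    rewrite <- (hk y hy), <- (hk z hz). now rewrite e. }
  assert (hm : forall x, l < x < u0 -> l' < h x < u0') by apply hD.
  assert (iF : forall x, l < x < u0 -> l < F x < u0).
  { intros x. apply (sink_invariant l u0 p). apply (sink_shrink l u); auto; lra. }
  assert (iG : forall x, l' < x < u0' -> l' < G x < u0').
  { intros x. apply (sink_invariant l' u0' q). apply (sink_shrink l' u'); auto; lra. }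
  exists h. split; [exact hD|].
  assert (hin := sink_in _ _ _ _ s1). assert (hin' := sink_in _ _ _ _ t1). split.
  - apply hinj; try lra; [apply hm; lra|]. rewrite hh by lra. lra.
  - intros x hx. apply hinj; auto. rewrite hh by auto. rewrite f1 by exact hx.
    rewrite f2 by auto. rewrite hh by exact hx. now rewrite he.
Qed.

(** * Maps with a source below a sink *)

Lemma mirror_is_derive k y l : is_derive k (- y) l -> is_derive (mirror k) y l.
Proof.
  intros h. unfold mirror.
  assert (i0 : is_derive Ropp y (- (1))).
  { auto_derive; [exact I|ring]. }
  assert (i1 := is_derive_comp k Ropp y _ _ h i0).
  assert (i2 := is_derive_opp _ y _ i1).
  evar_last; [exact i2|]. unfold opp, scal; simpl. unfold mult; simpl. ring.
Qed.

Lemma mirror_C_on n (l u l' u' : R) k :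
  l' = - u -> u' = - l ->
  C_on n (fun x => l < x < u) k -> C_on n (fun x => l' < x < u') (mirror k).
Proof.
  intros -> -> hC. unfold mirror. apply C_on_opp.
  apply (C_on_comp n _ (fun x => l < x < u) (fun x => - x) k); [|exact hC|intros; lra].
  apply C_on_opp. apply C_on_id. apply open_oo.
Qed.

Lemma mirror_C_diffeo s l u l' u' a b a' b' h :
  a = - u -> b = - l -> a' = - u' -> b' = - l' ->
  C_diffeo s (fun x => l < x < u) (fun y => l' < y < u') h ->
  C_diffeo s (fun x => a < x < b) (fun y => a' < y < b') (mirror h).
Proof.
  intros -> -> -> -> [h1 [h2 [k [k1 [k2 [k3 k4]]]]]].
  split; [now apply (mirror_C_on s l u)|]. split.
  - intros x hx. unfold mirror. specialize (h2 (- x) ltac:(lra)). lra.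
  - exists (mirror k). split; [now apply (mirror_C_on s l' u')|]. unfold mirror. split; [|split].
    + intros y hy. specialize (k2 (- y) ltac:(lra)). lra.
    + intros x hx. rewrite Ropp_involutive, k3; lra.
    + intros y hy. rewrite Ropp_involutive, k4; lra.
Qed.

(** The bound [3/2 d] only leaves some room on both sides between the
    neighbourhood of radius [d], where conjugacies live, and the domain, of
    radius [2 d]. *)
Lemma local_inverse n d F :
  0 < d -> C_on (S n) (fun x => - (2 * d) < x < 2 * d) F ->
  (forall x, - (2 * d) < x < 2 * d -> 0 < Derive F x) ->
  F (- (3 / 2 * d)) < - (3 / 2 * d) ->
  exists k,
    C_on (S n) (fun y => - (3 / 2 * d) < y < F (3 / 2 * d)) k /\
    (forall y, - (3 / 2 * d) < y < F (3 / 2 * d) ->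
       - (3 / 2 * d) < k y < 3 / 2 * d /\ F (k y) = y /\ is_derive k y (/ Derive F (k y))) /\
    (forall x, - (2 * d) < x < 2 * d -> - (3 / 2 * d) < F x < F (3 / 2 * d) -> k (F x) = x).
Proof.
  intros hd hC hpos hlow.
  assert (hder : forall x, - (2 * d) < x < 2 * d -> is_derive F x (Derive F x)).
  { intros x hx. exact (C_on_is_derive hC hx). }
  assert (hinc := derive_pos_increasing _ _ F (Derive F) hder hpos).
  assert (D : C_diffeo (S n) (fun x => - (3 / 2 * d) < x < 3 / 2 * d)
                (fun y => F (- (3 / 2 * d)) < y < F (3 / 2 * d)) F).
  { apply C_diffeo_of_increasing.
    - apply (C_on_interval (- (2 * d)) (2 * d)); [lra|lra|exact hC].
    - intros x hx. apply hpos. lra.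
    - apply open_oo.
    - intros x hx. split; apply hinc; lra.
    - intros y hy. destruct (IVT_ge F (- (3 / 2 * d)) (3 / 2 * d) y) as [x [hx1 hx2]]; try lra.
      + intros z hz. apply (C_on_continuous hC). lra.
      + exists x. split; [|exact hx2].
        assert (x <> - (3 / 2 * d)) by (intros ->; lra).
        assert (x <> 3 / 2 * d) by (intros ->; lra). lra. }
  destruct D as [_ [_ [k [k1 [k2 [k3 k4]]]]]].
  assert (kb : forall y, - (3 / 2 * d) < y < F (3 / 2 * d) ->
             F (- (3 / 2 * d)) < y < F (3 / 2 * d)) by (intros; lra).
  assert (kC : C_on (S n) (fun y => - (3 / 2 * d) < y < F (3 / 2 * d)) k).
  { apply (C_on_sub _ _ _ _ (open_oo _ _) kb k1). }
  exists k. split; [exact kC|]. split.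
  - intros y hy. assert (hy' := kb y hy). assert (g := k2 y hy'). split; [exact g|].
    split; [now apply k4|].
    assert (i1 := C_on_is_derive kC hy).
    assert (i2 := is_derive_comp F k y _ _ (hder (k y) ltac:(lra)) i1).
    assert (i3 : is_derive (fun x => F (k x)) y 1).
    { apply (is_derive_ext_loc (fun x => x)); [|apply (is_derive_id y)].
      generalize (open_oo _ _ y hy'). apply filter_imp. intros z hz. symmetry. now apply k4. }
    assert (e : Derive k y * Derive F (k y) = 1).
    { apply is_derive_unique in i2. apply is_derive_unique in i3.
      exact (eq_trans (eq_sym i2) i3). }
    assert (g2 := hpos (k y) ltac:(lra)).
    replace (/ Derive F (k y)) with (Derive k y); [exact i1|].
    apply Rmult_eq_reg_r with (Derive F (k y)); [|lra]. rewrite e. field. lra.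
  - intros x hx hy. assert (g := k2 (F x) (kb _ hy)). assert (e := k4 (F x) (kb _ hy)).
    destruct (Rtotal_order (k (F x)) x) as [c|[c|c]]; auto; exfalso.
    + assert (F (k (F x)) < F x) by (apply hinc; lra). lra.
    + assert (F x < F (k (F x))) by (apply hinc; lra). lra.
Qed.

Record source_sink (n : nat) (d : R) (F : R -> R) (lo hi : R) : Prop := {
  ss_order : - d < lo /\ lo < hi /\ hi < d;
  ss_C : C_on (S (S n)) (fun x => - (2 * d) < x < 2 * d) F;
  ss_pos : forall x, - (2 * d) < x < 2 * d -> 0 < Derive F x;
  ss_lo : F lo = lo;
  ss_hi : F hi = hi;
  ss_left : forall x, - (2 * d) < x < lo -> F x < x;
  ss_mid : forall x, lo < x < hi -> x < F x;
  ss_right : forall x, hi < x < 2 * d -> F x < x;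
  ss_lt1 : Derive F hi < 1;
  ss_gt1 : 1 < Derive F lo }.

Arguments ss_order {n d F lo hi}.
Arguments ss_C {n d F lo hi}.
Arguments ss_pos {n d F lo hi}.
Arguments ss_lo {n d F lo hi}.
Arguments ss_hi {n d F lo hi}.

Lemma source_sink_incr {n d F lo hi} x y :
  source_sink n d F lo hi -> - (2 * d) < x -> x < y -> y < 2 * d -> F x < F y.
Proof.
  intros hs. apply (derive_pos_increasing _ _ F (Derive F)).
  - intros z hz. exact (C_on_is_derive (ss_C hs) hz).
  - apply (ss_pos hs).
Qed.

Lemma source_sink_forward {n d F lo hi} :
  source_sink n d F lo hi -> expandable_sink n lo (2 * d) d hi F.
Proof.
  intros hs. assert (hinc := fun x y => source_sink_incr x y hs).
  destruct hs as [[h1 [h2 h3]] hC hpos elo ehi hl hm hr g1 g2].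
  assert (hc : forall x, - (2 * d) < x < 2 * d -> continuous F x).
  { intros x hx. exact (C_on_continuous hC hx). }
  constructor.
  - constructor; auto; try lra.
    + intros x y a b c. apply hinc; lra.
    + intros x hx. apply hc. lra.
  - apply (C_on_interval (- (2 * d)) (2 * d)); [lra|lra|exact hC].
  - intros x hx. apply hpos. lra.
  - exact g1.
  - intros y hy. destruct (IVT_ge F lo y y) as [x [hx1 hx2]]; try lra.
    + intros x hx. apply hc. lra.
    + specialize (hm y hy). lra.
    + exists x. split; [|exact hx2]. assert (x <> lo) by (intros ->; lra). lra.
  - lra.
Qed.

(** Reversing time and orientation exchanges the roles of the source and the sink. *)
Lemma source_sink_backward {n d F lo hi} :
  source_sink n d F lo hi ->
  exists k, expandable_sink n (- hi) (3 / 2 * d) d (- lo) (mirror k) /\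
    Derive (mirror k) (- lo) = / Derive F lo /\
    (forall y, - d < y < hi -> F (k y) = y) /\
    (forall x, - d < x < hi -> - d < F x < hi -> k (F x) = x).
Proof.
  intros hs. assert (hinc := fun x y => source_sink_incr x y hs).
  destruct hs as [[h1 [h2 h3]] hC hpos elo ehi hl hm hr g1 g2].
  destruct (local_inverse (S n) d F) as [k [kC [kF kk]]]; auto; try lra.
  { apply hl. lra. }
  assert (hw : hi < F (3 / 2 * d)) by (rewrite <- ehi at 1; apply hinc; lra).
  assert (kr : forall y, - (3 / 2 * d) < y <= hi ->
     - (3 / 2 * d) < k y < 3 / 2 * d /\ F (k y) = y /\ is_derive k y (/ Derive F (k y))).
  { intros y hy. apply kF. lra. }
  assert (klo : k lo = lo) by (rewrite <- elo at 1; apply kk; lra).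
  assert (flt : forall x y, - (2 * d) < x < 2 * d -> - (2 * d) < y < 2 * d -> F x < F y -> x < y).
  { apply increasing_le_of_lt. exact hinc. }
  assert (mder : forall y, - hi < y < 3 / 2 * d ->
     is_derive (mirror k) y (/ Derive F (k (- y)))).
  { intros y hy. apply mirror_is_derive. apply kr. lra. }
  assert (mC : C_on (S (S n)) (fun x => - hi < x < 3 / 2 * d) (mirror k)).
  { apply (mirror_C_on _ (- (3 / 2 * d)) hi); try lra.
    apply (C_on_sub _ _ _ _ (open_oo _ _)) with (2 := kC). intros; lra. }
  assert (dlo : Derive (mirror k) (- lo) = / Derive F lo).
  { apply is_derive_unique. assert (i := mder (- lo) ltac:(lra)).
    now rewrite Ropp_involutive, klo in i. }
  exists k. split; [|split; [exact dlo|split]].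
  - constructor.
    + constructor.
      * lra.
      * unfold mirror. rewrite Ropp_involutive, klo. reflexivity.
      * intros x y a b c. unfold mirror. apply Ropp_lt_contravar.
        destruct (kr (- x) ltac:(lra)) as [p1 [p2 _]]. destruct (kr (- y) ltac:(lra)) as [q1 [q2 _]].
        apply flt; lra.
      * intros x hx. unfold mirror. destruct (kr (- x) ltac:(lra)) as [p1 [p2 _]].
        assert (p3 := hm (- x) ltac:(lra)). assert (k (- x) < - x) by (apply flt; lra). lra.
      * intros x hx. unfold mirror. destruct (kr (- x) ltac:(lra)) as [p1 [p2 _]].
        assert (p3 := hl (- x) ltac:(lra)). assert (- x < k (- x)) by (apply flt; lra). lra.
      * intros x hx. exact (C_on_continuous mC hx).
    + exact mC.
    + intros y hy. rewrite (is_derive_unique _ _ _ (mder y hy)).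
      destruct (kr (- y) ltac:(lra)) as [p1 _]. apply Rinv_0_lt_compat. apply hpos. lra.
    + rewrite dlo. rewrite <- Rinv_1. apply Rinv_lt_contravar; lra.
    + intros y hy. exists (- F (- y)).
      assert (a1 : lo < F (- y)) by (rewrite <- elo at 1; apply hinc; lra).
      assert (a2 : F (- y) < hi) by (rewrite <- ehi; apply hinc; lra).
      split; [lra|]. unfold mirror. rewrite Ropp_involutive, kk; lra.
    + lra.
  - intros y hy. apply kr. lra.
  - intros x hx hy. apply kk; lra.
Qed.

Lemma iter_le n d F lo hi x m :
  source_sink n d F lo hi -> x <= lo -> (forall j, sym_interval d (Nat.iter j F x)) ->
  Nat.iter m F x <= lo.
Proof.
  intros hs hx hD. assert (o := ss_order hs).
  induction m as [|m IH]; [exact hx|]. simpl. destruct (hD m) as [a b].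
  destruct (Req_dec (Nat.iter m F x) lo) as [e|ne].
  - rewrite e, (ss_lo hs). lra.
  - left. apply Rlt_le_trans with (F lo); [|right; apply (ss_lo hs)].
    apply (source_sink_incr _ _ hs); lra.
Qed.

Lemma source_sink_basin_attraction {n d F lo hi} :
  source_sink n d F lo hi ->
  basin_attraction (sym_interval d) F hi = (fun x => lo < x < d).
Proof.
  intros hs. apply pred_ext. intros x. assert (o := ss_order hs). split.
  - intros [hD hl]. destruct (hD 0%nat) as [a b]. simpl in a, b. split; [|exact b].
    destruct (Rlt_or_le lo x) as [c|c]; [exact c|exfalso].
    assert (h : Rbar_le hi lo).
    { apply (is_lim_seq_le (fun m => Nat.iter m F x) (fun _ => lo)); auto;
        [|apply is_lim_seq_const].
      intros m. now apply (iter_le n d F lo hi). }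
    simpl in h. lra.
  - intros hx. assert (es := es_sink _ _ _ _ _ _ (source_sink_forward hs)).
    apply (sink_shrink lo (2 * d) d) in es; [|lra].
    destruct (sink_iter _ _ _ _ x es hx) as [h1 h2].
    split; [|exact h2]. intros m. destruct (h1 m). unfold sym_interval. lra.
Qed.

Lemma source_sink_basin_repulsion {n d F lo hi} :
  source_sink n d F lo hi ->
  basin_repulsion (sym_interval d) F lo = (fun x => - d < x < hi).
Proof.
  intros hs. apply pred_ext. intros x. assert (o := ss_order hs). split.
  - intros [u [h0 [hD [hF hl]]]]. destruct (hD 0%nat) as [a b]. rewrite h0 in a, b.
    split; [exact a|]. destruct (Rlt_or_le x hi) as [c|c]; [exact c|exfalso].
    assert (G : forall m, hi <= u m).
    { induction m as [|m IH]; [lra|]. destruct (Rle_or_lt hi (u (S m))) as [q|q]; [exact q|].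
      exfalso. destruct (hD (S m)) as [a' b'].
      assert (F (u (S m)) < F hi) by (apply (source_sink_incr _ _ hs); lra).
      rewrite hF, (ss_hi hs) in H. lra. }
    assert (h : Rbar_le hi lo).
    { apply (is_lim_seq_le (fun _ => hi) u); auto. apply is_lim_seq_const. }
    simpl in h. lra.
  - intros hx. destruct (source_sink_backward hs) as [k [es [_ [kF _]]]].
    assert (sk := sink_shrink _ _ d _ _ (es_sink _ _ _ _ _ _ es) ltac:(lra)).
    destruct (sink_iter _ _ _ _ (- x) sk ltac:(lra)) as [h1 h2].
    assert (e : forall m, Nat.iter m (mirror k) (- x) = - Nat.iter m k x).
    { intros m. now rewrite iter_mirror, Ropp_involutive. }
    assert (h3 : forall m, - d < Nat.iter m k x < hi).
    { intros m. destruct (h1 m) as [h _]. rewrite e in h. lra. }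
    exists (fun m => Nat.iter m k x). split; [reflexivity|]. split; [|split].
    + intros m. specialize (h3 m). unfold sym_interval. lra.
    + intros m. simpl. apply kF. apply h3.
    + apply is_lim_seq_opp. apply (is_lim_seq_ext _ _ _ e). exact h2.
Qed.

Lemma source_sink_conjugate_hi n d F lo hi d' G lo' hi' :
  source_sink n d F lo hi -> source_sink n d' G lo' hi' -> Derive F hi = Derive G hi' ->
  conjugate_on_basins (S (S n)) (sym_interval d) (sym_interval d') F G hi hi'.
Proof.
  intros hs hs' he. left.
  assert (ef := source_sink_forward hs). assert (eg := source_sink_forward hs').
  split; [exact (sink_stable _ _ _ _ (es_sink _ _ _ _ _ _ ef))|].
  split; [exact (sink_stable _ _ _ _ (es_sink _ _ _ _ _ _ eg))|].
  rewrite (source_sink_basin_attraction hs),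
    (source_sink_basin_attraction hs').
  destruct (sink_conjugacy _ _ _ _ _ _ _ _ _ _ _ ef eg he) as [h [h1 [h2 h3]]].
  exists h. split; [|exact h2]. split; [exact h1|]. intros x hx _. now apply h3.
Qed.

Lemma source_sink_unstable {n d F lo hi} : source_sink n d F lo hi -> unstable F lo.
Proof.
  intros hs. assert (o := ss_order hs).
  assert (es := es_sink _ _ _ _ _ _ (source_sink_forward hs)).
  apply (unstable_of_escape F lo hi); [lra|]. intros x hx.
  apply (sink_iter _ _ _ _ x es). lra.
Qed.

Lemma source_sink_conjugate_lo n d F lo hi d' G lo' hi' :
  source_sink n d F lo hi -> source_sink n d' G lo' hi' -> Derive F lo = Derive G lo' ->
  conjugate_on_basins (S (S n)) (sym_interval d) (sym_interval d') F G lo lo'.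
Proof.
  intros hs hs' he. right.
  split; [exact (source_sink_unstable hs)|].
  split; [exact (source_sink_unstable hs')|].
  rewrite (source_sink_basin_repulsion hs),
    (source_sink_basin_repulsion hs').

  destruct (source_sink_backward hs) as [k [ek [dk [kF kk]]]].
  destruct (source_sink_backward hs') as [m [em [dm [mG mm]]]].
  destruct (sink_conjugacy _ _ _ _ _ _ _ _ _ _ _ ek em) as [h [h1 [h2 h3]]].
  { rewrite dk, dm, he. reflexivity. }
  assert (D : C_diffeo (S (S n)) (fun x => - d < x < hi) (fun x => - d' < x < hi') (mirror h)).
  { apply (mirror_C_diffeo _ (- hi) d (- hi') d'); auto; lra. }
  exists (mirror h). split; [split; [exact D|]|].
  - intros x hx hy. assert (e := h3 (- F x) ltac:(lra)).
    unfold mirror in e. rewrite !Ropp_involutive in e. rewrite kk in e by lra.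
    assert (hh : - d' < mirror h (F x) < hi') by (apply D; exact hy).
    unfold mirror in *. rewrite e, Ropp_involutive. symmetry. apply mG. exact hh.
  - unfold mirror. rewrite h2. ring.
Qed.

(** * Parabolic fixed points *)

Definition right_lim (f : R -> R) (l : R) : Prop := filterlim f (at_right 0) (locally l).

Lemma right_lim_eps f l :
  right_lim f l <->
  forall eps, 0 < eps -> exists d, 0 < d /\ forall x, 0 < x < d -> Rabs (f x - l) < eps.
Proof.
  split.
  - intros h eps he. destruct (h (fun z => Rabs (z - l) < eps)) as [d hd].
    + exists (mkposreal eps he). intros z hz. exact hz.
    + exists d. split; [apply cond_pos|]. intros x hx. apply hd; [|lra].
      change (Rabs (x - 0) < d). rewrite Rminus_0_r, Rabs_pos_eq; lra.
  - intros h P [eps hP]. destruct (h eps (cond_pos eps)) as [d [hd1 hd2]].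
    exists (mkposreal d hd1). intros x hx h0. apply hP. apply hd2. split; [exact h0|].
    assert (hx' : Rabs (x - 0) < d) by exact hx. apply Rabs_def2 in hx'. lra.
Qed.

Lemma right_lim_mult f g a b :
  right_lim f a -> right_lim g b -> right_lim (fun x => f x * g x) (a * b).
Proof.
  intros hf hg. exact (filterlim_comp_2 _ _ Rmult hf hg (filterlim_mult a b)).
Qed.

Lemma right_lim_comp f h a :
  right_lim f a -> continuous h a -> right_lim (fun x => h (f x)) (h a).
Proof. intros hf hh. exact (filterlim_comp _ _ _ f h _ _ _ hf hh). Qed.

Lemma right_lim_ext d f g l :
  0 < d -> (forall x, 0 < x < d -> f x = g x) -> right_lim f l -> right_lim g l.
Proof.
  intros hd he hf. apply right_lim_eps. intros eps heps.
  destruct (proj1 (right_lim_eps f l) hf eps heps) as [d' [h1 h2]].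
  destruct (pos_below d d d' d') as [t [ht ht']]; try assumption.
  exists t. split; [exact ht|]. intros x hx. rewrite <- he by lra. apply h2. lra.
Qed.

Lemma right_lim_squeeze d f b g l l' c :
  0 < d -> (forall x, 0 < x < d -> f x <= b x <= g x) ->
  right_lim f l -> right_lim g l' -> right_lim b c -> l <= c <= l'.
Proof.
  intros hd he hf hg hb.
  assert (P : at_right 0 (fun x => f x <= b x <= g x)).
  { exists (mkposreal d hd). intros x hx h0. apply he. split; [exact h0|].
    assert (hx' : Rabs (x - 0) < d) by exact hx. apply Rabs_def2 in hx'. lra. }
  split.
  - change (Rbar_le l c). apply (filterlim_le (F := at_right 0) f b); [|exact hf|exact hb].
    revert P. apply filter_imp. intros x hx. lra.
  - change (Rbar_le c l'). apply (filterlim_le (F := at_right 0) b g); [|exact hb|exact hg].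
    revert P. apply filter_imp. intros x hx. lra.
Qed.

Lemma right_lim_const c : right_lim (fun _ => c) c.
Proof. apply filterlim_const. Qed.

Lemma right_lim_id : right_lim (fun x => x) 0.
Proof.
  apply right_lim_eps. intros eps he. exists eps. split; [exact he|]. intros x hx.
  rewrite Rminus_0_r, Rabs_pos_eq; lra.
Qed.

(** Comparing [phi] with [- (l + eps) / x] and [- (l - eps) / x], whose derivatives
    bound the one of [phi] near zero. *)
Lemma primitive_of_inverse_square u l (phi phi' : R -> R) :
  0 < u -> (forall x, 0 < x < u -> is_derive phi x (phi' x)) ->
  right_lim (fun x => x ^ 2 * phi' x) l -> right_lim (fun x => x * phi x) (- l).
Proof.
  intros hu hd hl. apply right_lim_eps. intros eps he.
  destruct (proj1 (right_lim_eps _ _) hl (eps / 2) ltac:(lra)) as [d [hd1 hd2]].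
  destruct (pos_below d d u u) as [y hy]; try lra.
  assert (G : forall m x, 0 < x < y -> exists z, 0 < z < d /\ z < u /\
     phi y + m / y - (phi x + m / x) = (z ^ 2 * phi' z - m) / z ^ 2 * (y - x)).
  { intros m x hx.
    destruct (mean_value (fun t => phi t + m / t) (fun t => (t ^ 2 * phi' t - m) / t ^ 2) x y)
      as [z [hz1 hz2]].
    - intros t ht. rewrite Rmin_left, Rmax_right in ht by lra.
      assert (i1 : is_derive (fun t => m / t) t (- m / t ^ 2)).
      { auto_derive; [lra|field; lra]. }
      evar_last; [exact (is_derive_plus phi _ t _ _ (hd t ltac:(lra)) i1)|].
      unfold plus; simpl. field. lra.
    - rewrite Rmin_left, Rmax_right in hz1 by lra. exists z. split; [lra|]. split; [lra|].
      exact hz2. }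
  set (c1 := phi y + (l + eps / 2) / y). set (c2 := phi y + (l - eps / 2) / y).
  assert (hc : 0 < eps / 2 / (1 + Rabs c1 + Rabs c2)).
  { assert (p1 := Rabs_pos c1). assert (p2 := Rabs_pos c2). apply Rdiv_lt_0_compat; lra. }
  destruct (pos_below y y _ _ (proj1 hy) (proj1 hy) hc hc) as [x0 [hx0 [g1 [_ [g2 _]]]]].
  exists x0. split; [exact hx0|]. intros x hx.
  assert (hxc : x * (1 + Rabs c1 + Rabs c2) < eps / 2).
  { assert (p1 := Rabs_pos c1). assert (p2 := Rabs_pos c2).
    apply Rlt_le_trans with (eps / 2 / (1 + Rabs c1 + Rabs c2) * (1 + Rabs c1 + Rabs c2)).
    - apply Rmult_lt_compat_r; lra.
    - right. field. lra. }
  assert (sgn : forall z, 0 < z -> 0 < / z ^ 2).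
  { intros z hz. apply Rinv_0_lt_compat. now apply pow_lt. }
  destruct (G (l + eps / 2) x ltac:(lra)) as [z [hz1 [hz2 hz3]]].
  destruct (G (l - eps / 2) x ltac:(lra)) as [w [hw1 [hw2 hw3]]].
  fold c1 in hz3. fold c2 in hw3.
  assert (b1 := Rabs_def2 _ _ (hd2 z hz1)). assert (b2 := Rabs_def2 _ _ (hd2 w hw1)).
  assert (s1 := sgn z ltac:(lra)). assert (s2 := sgn w ltac:(lra)).
  assert (n1 : c1 <= phi x + (l + eps / 2) / x).
  { assert ((z ^ 2 * phi' z - (l + eps / 2)) / z ^ 2 * (y - x) <= 0); [|lra].
    unfold Rdiv. apply Rmult_le_0_r; [|lra]. apply Rmult_le_0_r; lra. }
  assert (n2 : phi x + (l - eps / 2) / x <= c2).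
  { assert (0 <= (w ^ 2 * phi' w - (l - eps / 2)) / w ^ 2 * (y - x)); [|lra].
    unfold Rdiv. apply Rmult_le_pos; [|lra]. apply Rmult_le_pos; lra. }
  apply Rmult_le_compat_l with (r := x) in n1; [|lra].
  apply Rmult_le_compat_l with (r := x) in n2; [|lra].
  replace (x * (phi x + (l + eps / 2) / x)) with (x * phi x + (l + eps / 2)) in n1
    by (field; lra).
  replace (x * (phi x + (l - eps / 2) / x)) with (x * phi x + (l - eps / 2)) in n2
    by (field; lra).
  assert (a1 := Rle_abs c2). assert (a2 := Rle_abs (- c1)). rewrite Rabs_Ropp in a2.
  assert (p1 := Rabs_pos c1). assert (p2 := Rabs_pos c2).
  assert (x * c2 <= x * Rabs c2) by (apply Rmult_le_compat_l; lra).
  assert (x * - c1 <= x * Rabs c1) by (apply Rmult_le_compat_l; lra).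
  assert (0 <= x * Rabs c1) by (apply Rmult_le_pos; lra).
  assert (0 <= x * Rabs c2) by (apply Rmult_le_pos; lra).
  apply Rabs_def1; lra.
Qed.

(** The right half of a parabolic germ [F x = x - b x^2 + O(x^3)]. The last bound
    says that [F] preserves the form [dx / x^2] up to a factor [1 + O(x^2)]; an exactly
    invariant form is the differential of a coordinate which [F] shifts by a constant. *)
Record parabolic (u b : R) (F : R -> R) : Prop := {
  pb_u : 0 < u;
  pb_C : C_on 2 (fun x => 0 < x < u) F;
  pb_0 : F 0 = 0;
  pb_pos : forall x, 0 < x < u -> 0 < F x /\ 0 < Derive F x;
  pb_dec : exists c, 0 < c /\ forall x, 0 < x < u -> c * x ^ 2 <= x - F x;
  pb_lim : 0 < b /\ right_lim (fun x => (x - F x) / x ^ 2) b;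
  pb_log : exists K, 0 < K /\ forall x, 0 < x < u ->
     Rabs (ln (Derive F x) + 2 * ln x - 2 * ln (F x)) <= K * x ^ 2 }.

Lemma parabolic_below {u b F} x : parabolic u b F -> 0 < x < u -> 0 < F x < x.
Proof.
  intros hp hx. split; [now apply (pb_pos _ _ _ hp)|].
  destruct (pb_dec _ _ _ hp) as [c [hc h]]. specialize (h x hx).
  assert (0 < x ^ 2) by (apply pow_lt; lra). nra.
Qed.

(** A solution of [E = ln (F' x^2 / F^2) + E o F]: the terms of the series are
    dominated by a multiple of [x - F x], and these differences telescope along
    orbits. *)
Lemma parabolic_correction u b F :
  parabolic u b F ->
  exists E C, 0 < C /\ forall x, 0 < x < u ->
    continuous E x /\ E x = (ln (Derive F x) + 2 * ln x - 2 * ln (F x)) + E (F x) /\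
    Rabs (E x) <= C * x.
Proof.
  intros hpar. assert (hlt := fun x => parabolic_below x hpar).
  destruct hpar as [hu hC h0 hpos [c [hc hdec]] _ [K [hK hlog]]].
  assert (hinc := derive_pos_increasing 0 u F (Derive F)
    (fun x hx => C_on_is_derive hC hx) (fun x hx => proj2 (hpos x hx))).
  assert (hcF : forall x, 0 < x < u -> continuous F x).
  { intros x hx. exact (C_on_continuous hC hx). }
  set (W := fun x => K / c * x).
  assert (hKc : 0 < K / c) by now apply Rdiv_lt_0_compat.
  assert (htail : forall n x, lin_tail F (fun _ => 1) W n x = W (Nat.iter n F x)).
  { induction n as [|n IH]; intros x; [reflexivity|].
    rewrite Nat.iter_succ_r. simpl. rewrite IH, Rabs_R1. ring. }
  assert (cln : forall x, 0 < x -> continuous ln x).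
  { intros x hx. apply (ex_derive_continuous ln). eexists. now apply is_derive_ln. }
  assert (cvg : forall x, 0 < x < u -> is_lim_seq (fun n => Nat.iter n F x) 0).
  { intros x hx. apply (iter_decreasing_cvg F 0 x); [lra|exact h0|].
    intros y hy. destruct (hlt y ltac:(lra)). split; [lra|]. apply hcF. lra. }
  assert (mono : forall n x y, 0 < x -> x <= y -> y < u ->
     0 < Nat.iter n F x <= Nat.iter n F y /\ Nat.iter n F y < u).
  { intros n x y hx hxy hy. induction n as [|n [[i1 i2] i3]]; simpl; [lra|].
    destruct (hlt (Nat.iter n F x) ltac:(lra)). destruct (hlt (Nat.iter n F y) ltac:(lra)).
    split; [|lra]. split; [lra|]. destruct i2 as [i2|i2]; [|rewrite i2; lra].
    left. apply hinc; lra. }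
  destruct (linear_equation_continuous (fun x => 0 < x < u) F
    (fun x => ln (Derive F x) + 2 * ln x - 2 * ln (F x)) (fun _ => 1) W) as [E hE].
  - intros x hx. specialize (hlt x hx). lra.
  - intros x hx. destruct (hpos x hx) as [p1 p2].
    split; [now apply hcF|]. split; [|apply continuous_const].
    apply (continuous_minus (fun x => ln (Derive F x) + 2 * ln x) (fun x => 2 * ln (F x))).
    + apply (continuous_plus (fun x => ln (Derive F x)) (fun x => 2 * ln x)).
      * apply (continuous_comp (Derive F) ln); [|now apply cln].
        exact (C_on_continuous (C_on_Derive hC) hx).
      * apply (continuous_mult (fun _ => 2) ln); [apply continuous_const|]. apply cln. lra.
    + apply (continuous_mult (fun _ => 2) (fun x => ln (F x))); [apply continuous_const|].
      apply (continuous_comp F ln); [now apply hcF|now apply cln].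
  - intros x hx. unfold W. split; [apply Rmult_le_pos; lra|]. rewrite Rabs_R1.
    specialize (hlog x hx). specialize (hdec x hx).
    assert (e : K * x ^ 2 <= K / c * (x - F x)).
    { apply Rle_trans with (K / c * (c * x ^ 2)); [right; field; lra|].
      apply Rmult_le_compat_l; lra. }
    lra.
  - intros x hx eps. set (x1 := (x + u) / 2).
    assert (hx1 : 0 < x1 < u) by (unfold x1; lra).
    assert (hl := cvg x1 hx1). apply is_lim_seq_spec in hl.
    assert (heK : 0 < eps / (K / c)) by (apply Rdiv_lt_0_compat; [apply cond_pos|lra]).
    destruct (hl (mkposreal _ heK)) as [N hN]. specialize (hN N (le_n N)). simpl in hN.
    exists N. assert (ho : 0 < x < x1) by (unfold x1; lra).
    generalize (open_oo 0 x1 x ho). apply filter_imp. intros y hy. split; [lra|].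
    rewrite htail. unfold W. destruct (mono N y x1 ltac:(lra) ltac:(lra) ltac:(lra)) as [m1 m2].
    rewrite Rminus_0_r in hN. apply Rabs_def2 in hN.
    apply Rle_trans with (K / c * (eps / (K / c))); [|right; field; lra].
    apply Rmult_le_compat_l; lra.
  - exists E, (K / c). split; [exact hKc|]. intros x hx. destruct (hE x hx) as [e1 [e2 e3]].
    split; [exact e1|]. split; [rewrite Rmult_1_l in e2; exact e2|exact e3].
Qed.

Lemma exp_le x y : x <= y -> exp x <= exp y.
Proof. intros [h| ->]; [left; now apply exp_increasing|apply Rle_refl]. Qed.

(** The primitive [phi] of [e^E / x^2] is shifted by [F], by a constant which the
    behaviour at zero identifies as [b]. *)
Lemma parabolic_abel u b F u0 :
  parabolic u b F -> 0 < u0 < u ->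
  exists phi, C_on 1 (fun x => 0 < x < u) phi /\ phi u0 = 0 /\
    (forall x, 0 < x < u -> 0 < Derive phi x) /\
    (forall x, 0 < x < u -> phi (F x) = phi x - 1) /\
    right_lim (fun x => x ^ 2 * Derive phi x) (/ b).
Proof.
  intros hpar hu0. destruct (parabolic_correction u b F hpar) as [E [C [hC0 hE]]].
  assert (hlt := fun x => parabolic_below x hpar).
  destruct hpar as [hu hC _ hpos _ [hb hlim] _].
  set (rho := fun x => exp (E x) * / x ^ 2).
  assert (hrc : forall x, 0 < x < u -> continuous rho x).
  { intros x hx. apply (continuous_mult (fun x => exp (E x)) (fun x => / x ^ 2)).
    - apply (continuous_comp E exp); [now apply hE|apply continuous_exp].
    - apply (ex_derive_continuous (fun x => / x ^ 2)). auto_derive.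
      assert (0 < x ^ 2) by (apply pow_lt; lra). simpl in *. lra. }
  destruct (continuous_primitive 0 u u0 rho hu0 hrc) as [psi [hpsi0 hpsi]].
  assert (hrp : forall x, 0 < x -> 0 < rho x).
  { intros x hx. apply Rmult_lt_0_compat; [apply exp_pos|].
    apply Rinv_0_lt_compat. now apply pow_lt. }
  assert (hrF : forall x, 0 < x < u -> rho (F x) * Derive F x = rho x).
  { intros x hx. destruct (hE x hx) as [_ [e _]]. destruct (hpos x hx) as [p1 p2].
    unfold rho. rewrite e.
    replace (ln (Derive F x) + 2 * ln x - 2 * ln (F x) + E (F x))
      with (ln (Derive F x) + (ln x + ln x) + (- ln (F x) + - ln (F x)) + E (F x)) by ring.
    rewrite !exp_plus, !exp_Ropp, !exp_ln by lra. field. lra. }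
  assert (hshift : forall x y, 0 < x < u -> 0 < y < u ->
     psi x - psi (F x) = psi y - psi (F y)).
  { apply derive_zero_const. intros x hx.
    assert (i := is_derive_comp psi F x _ _ (hpsi (F x) ltac:(specialize (hlt x hx); lra))
                   (C_on_is_derive hC hx)).
    evar_last; [exact (is_derive_minus psi _ x _ _ (hpsi x hx) i)|].
    unfold minus, plus, opp, scal; simpl. unfold mult; simpl. rewrite <- (hrF x hx). ring. }
  set (s := psi u0 - psi (F u0)).
  (* [s = b]: by the mean value theorem, [s] is close to [(x - F x) / x^2] *)
  assert (hxq : right_lim (fun x => x * ((x - F x) / x ^ 2)) 0).
  { rewrite <- (Rmult_0_l b). apply right_lim_mult; [apply right_lim_id|exact hlim]. }
  assert (hFx : right_lim (fun x => F x / x) 1).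
  { apply (right_lim_ext u (fun x => 1 - x * ((x - F x) / x ^ 2))); [exact hu| |].
    - intros x hx. field. lra.
    - assert (h := right_lim_comp _ (fun z => 1 - z) 0 hxq). simpl in h.
      rewrite Rminus_0_r in h. apply h.
      apply (ex_derive_continuous (fun z => 1 - z)). auto_derive. exact I. }
  assert (hexp : forall k, right_lim (fun x => exp (k * x)) 1).
  { intros k. assert (h := right_lim_comp _ (fun z => exp (k * z)) 0 right_lim_id).
    simpl in h. rewrite Rmult_0_r, exp_0 in h. apply h.
    apply (ex_derive_continuous (fun z => exp (k * z))). auto_derive. exact I. }
  assert (hsb : s = b).
  { assert (B : forall x, 0 < x < u ->
       (x - F x) / x ^ 2 * exp (- C * x) <= s <=
       (x - F x) / x ^ 2 * exp (C * x) * / (F x / x) ^ 2).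
    { intros x hx. destruct (hlt x hx) as [l1 l2].
      destruct (mean_value psi rho (F x) x) as [z [hz1 hz2]].
      { intros t ht. rewrite Rmin_left, Rmax_right in ht by lra. apply hpsi. lra. }
      rewrite Rmin_left, Rmax_right in hz1 by lra.
      rewrite (hshift x u0 hx hu0) in hz2. fold s in hz2. rewrite hz2.
      destruct (hE z ltac:(lra)) as [_ [_ hEz]]. apply Rabs_le_between in hEz.
      assert (E1 : exp (- C * x) <= exp (E z)).
      { apply exp_le. assert (C * z <= C * x) by (apply Rmult_le_compat_l; lra). lra. }
      assert (E2 : exp (E z) <= exp (C * x)).
      { apply exp_le. assert (C * z <= C * x) by (apply Rmult_le_compat_l; lra). lra. }
      assert (P1 : / x ^ 2 <= / z ^ 2).
      { apply Rinv_le_contravar; [apply pow_lt; lra|]. apply pow_incr. lra. }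
      assert (P2 : / z ^ 2 <= / F x ^ 2).
      { apply Rinv_le_contravar; [apply pow_lt; lra|]. apply pow_incr. lra. }
      assert (P0 : 0 < / x ^ 2) by (apply Rinv_0_lt_compat, pow_lt; lra).
      assert (X1 := exp_pos (- C * x)).
      unfold rho. split.
      - replace ((x - F x) / x ^ 2 * exp (- C * x)) with (exp (- C * x) * / x ^ 2 * (x - F x))
          by (field; lra).
        apply Rmult_le_compat_r; [lra|]. apply Rmult_le_compat; lra.
      - replace ((x - F x) / x ^ 2 * exp (C * x) * / (F x / x) ^ 2)
          with (exp (C * x) * / F x ^ 2 * (x - F x)) by (field; lra).
        apply Rmult_le_compat_r; [lra|]. apply Rmult_le_compat; lra. }
    assert (R1 : right_lim (fun x => (x - F x) / x ^ 2 * exp (- C * x)) b).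
    { rewrite <- (Rmult_1_r b). apply right_lim_mult; auto. }
    assert (R2 : right_lim (fun x => (x - F x) / x ^ 2 * exp (C * x) * / (F x / x) ^ 2) b).
    { replace b with (b * 1 * / 1 ^ 2) by field. apply right_lim_mult.
      - apply right_lim_mult; auto.
      - apply (right_lim_comp _ (fun z => / z ^ 2) 1 hFx).
        apply (ex_derive_continuous (fun z => / z ^ 2)). auto_derive. lra. }
    destruct (right_lim_squeeze u _ (fun _ => s) _ b b s hu B R1 R2 (right_lim_const s)).
    lra. }
  assert (hd : forall x, 0 < x < u -> is_derive (fun x => / b * psi x) x (/ b * rho x)).
  { intros x hx. apply (is_derive_scal psi). now apply hpsi. }
  assert (hD : forall x, 0 < x < u -> Derive (fun x : R => / b * psi x) x = / b * rho x).
  { intros x hx. apply is_derive_unique. now apply hd. }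
  assert (hbi : 0 < / b) by now apply Rinv_0_lt_compat.
  exists (fun x => / b * psi x). split; [|split; [|split; [|split]]].
  - apply C_on_S_intro with (fun x => / b * rho x); [exact hd|]. apply C_on_0.
    split; [apply open_oo|]. intros x hx.
    apply (continuous_mult (fun _ => / b) rho); [apply continuous_const|auto].
  - rewrite hpsi0. ring.
  - intros x hx. rewrite hD by exact hx.
    apply Rmult_lt_0_compat; [exact hbi|]. apply hrp. lra.
  - intros x hx. assert (e := hshift x u0 hx hu0). fold s in e. rewrite hsb in e.
    replace (psi (F x)) with (psi x - b) by lra. field. lra.
  - apply (right_lim_ext u (fun x => / b * exp (E x))); [exact hu| |].
    + intros x hx. rewrite hD by exact hx. unfold rho. field. lra.
    + assert (hE0 : right_lim E 0).
      { apply right_lim_eps. intros eps he.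
        assert (q : 0 < eps / C) by now apply Rdiv_lt_0_compat.
        destruct (pos_below _ _ _ _ hu hu q q) as [t [ht [g1 [_ [g2 _]]]]].
        exists t. split; [exact ht|]. intros x hx.
        rewrite Rminus_0_r. apply Rle_lt_trans with (C * x); [apply hE; lra|].
        apply Rlt_le_trans with (C * (eps / C)); [apply Rmult_lt_compat_l; lra|].
        right. field. lra. }
      assert (G := right_lim_comp E exp 0 hE0 (continuous_exp 0)). rewrite exp_0 in G.
      assert (G' := right_lim_mult _ _ _ _ (right_lim_const (/ b)) G).
      rewrite Rmult_1_r in G'. exact G'.
Qed.

(** In the coordinate [omega = - 1 / phi] the unit shift becomes [t |-> t / (1 + t)],
    which no longer depends on the germ. Moreover [omega] extends to the fixed point in
    a continuously differentiable way. *)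
Lemma parabolic_coordinate u b F u0 :
  parabolic u b F -> 0 < u0 < u ->
  exists om, C_on 1 (fun x => 0 < x < u0) om /\
    (forall x, 0 < x < u0 -> 0 < Derive om x /\ 0 < om x) /\
    (forall y, 0 < y -> exists x, 0 < x < u0 /\ om x = y) /\
    (forall x, 0 < x < u0 -> om (F x) * (1 + om x) = om x) /\
    right_lim (fun x => om x / x) b /\ right_lim (Derive om) b.
Proof.
  intros hpar hu0. destruct (parabolic_abel u b F u0 hpar hu0) as [phi [hC [hz [hp [hF hl]]]]].
  assert (hlt := fun x => parabolic_below x hpar).
  destruct hpar as [hu _ _ _ _ [hb _] _].
  assert (hder : forall x, 0 < x < u -> is_derive phi x (Derive phi x)).
  { intros x hx. exact (C_on_is_derive hC hx). }
  assert (hinc := derive_pos_increasing 0 u phi (Derive phi) hder hp).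
  assert (hneg : forall x, 0 < x < u0 -> phi x < 0).
  { intros x hx. rewrite <- hz. apply hinc; lra. }
  assert (hxphi := primitive_of_inverse_square u (/ b) phi (Derive phi) hu hder hl).
  assert (hunb : forall K, exists x, 0 < x < u0 /\ phi x < K).
  { intros K. set (x0 := u0 / 2).
    assert (B : forall n, 0 < Nat.iter n F x0 < u0 /\ phi (Nat.iter n F x0) = phi x0 - INR n).
    { induction n as [|n [i1 i2]]; [simpl; unfold x0; split; [lra|ring]|].
      rewrite S_INR. simpl Nat.iter. specialize (hlt (Nat.iter n F x0) ltac:(lra)).
      split; [lra|]. rewrite hF by lra. rewrite i2. ring. }
    destruct (INR_unbounded (phi x0 - K)) as [n hn]. destruct (B n) as [b1 b2].
    exists (Nat.iter n F x0). split; [exact b1|]. lra. }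
  assert (hbi : 0 < / b) by now apply Rinv_0_lt_compat.
  assert (hdom : forall x, 0 < x < u0 -> is_derive (fun x => - / phi x) x (Derive phi x / phi x ^ 2)).
  { intros x hx. specialize (hneg x hx).
    assert (i := is_derive_inv phi x _ (hder x ltac:(lra)) ltac:(lra)).
    evar_last; [exact (is_derive_opp _ x _ i)|]. unfold opp; simpl. field. lra. }
  assert (hD : forall x, 0 < x < u0 ->
    Derive (fun x : R => - / phi x) x = Derive phi x / phi x ^ 2).
  { intros x hx. apply is_derive_unique. now apply hdom. }
  exists (fun x => - / phi x). split; [|split; [|split; [|split; [|split]]]].
  - apply C_on_opp. apply C_on_inv.
    + apply (C_on_interval 0 u); [lra|lra|exact hC].
    + intros x hx. specialize (hneg x hx). lra.
  - intros x hx. specialize (hneg x hx). split.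
    + rewrite hD by exact hx.
      apply Rdiv_lt_0_compat; [apply hp; lra|]. nra.
    + rewrite <- Rinv_opp. apply Rinv_0_lt_compat. lra.
  - intros y hy. destruct (hunb (- / y)) as [a [ha1 ha2]].
    assert (0 < / y) by now apply Rinv_0_lt_compat.
    destruct (IVT_ge phi a u0 (- / y)) as [x [hx1 hx2]]; try lra.
    + intros t ht. apply (C_on_continuous hC). lra.
    + exists x. assert (x <> u0) by (intros ->; lra). split; [lra|]. rewrite hx2. field. lra.
  - intros x hx. specialize (hneg x hx). rewrite hF by lra. field. lra.
  - apply (right_lim_ext u0 (fun x => - / (x * phi x))); [lra| |].
    + intros x hx. specialize (hneg x hx). field. lra.
    + replace b with (- / - / b) by (field; lra).
      apply (right_lim_comp _ (fun z => - / z) (- / b) hxphi).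
      apply (ex_derive_continuous (fun z => - / z)). auto_derive. lra.
  - apply (right_lim_ext u0 (fun x => x ^ 2 * Derive phi x * / (x * phi x) ^ 2)); [lra| |].
    + intros x hx. specialize (hneg x hx). rewrite hD by exact hx.
      field. lra.
    + assert (c2 : continuous (fun z => / z ^ 2) (- / b)).
      { apply (ex_derive_continuous (fun z => / z ^ 2)). auto_derive. nra. }
      assert (G := right_lim_mult _ _ _ _ hl (right_lim_comp _ _ _ hxphi c2)).
      replace (/ b * / (- / b) ^ 2) with b in G by (field; lra). exact G.
Qed.

(** ** Gluing the two halves *)

Record half_coordinate (u b : R) (om : R -> R) : Prop := {
  hc_C : C_on 1 (fun x => 0 < x < u) om;
  hc_pos : forall x, 0 < x < u -> 0 < Derive om x /\ 0 < om x;
  hc_onto : forall y, 0 < y -> exists x, 0 < x < u /\ om x = y;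
  hc_slope : right_lim (fun x => om x / x) b;
  hc_deriv : right_lim (Derive om) b }.

Definition glue (right left : R -> R) (x : R) : R :=
  if Rlt_dec 0 x then right x else if Rlt_dec x 0 then - left (- x) else 0.

Lemma glue_pos f g x : 0 < x -> glue f g x = f x.
Proof. intros h. unfold glue. destruct (Rlt_dec 0 x); [reflexivity|lra]. Qed.

Lemma glue_neg f g x : x < 0 -> glue f g x = - g (- x).
Proof.
  intros h. unfold glue. destruct (Rlt_dec 0 x); [lra|]. destruct (Rlt_dec x 0); [reflexivity|lra].
Qed.

Lemma glue_0 f g : glue f g 0 = 0.
Proof. unfold glue. destruct (Rlt_dec 0 0); [lra|reflexivity]. Qed.

Lemma glue_is_derive u b f g :
  0 < u -> half_coordinate u b f -> half_coordinate u b g ->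
  exists D, D 0 = b /\ (forall x, - u < x < u -> is_derive (glue f g) x (D x) /\ continuous D x) /\
    (forall x, 0 < x < u -> D x = Derive f x) /\ (forall x, - u < x < 0 -> D x = Derive g (- x)).
Proof.
  intros hu [fC fp _ fs fd] [gC gp _ gs gd].
  set (D := fun x => if Rlt_dec 0 x then Derive f x else if Rlt_dec x 0 then Derive g (- x) else b).
  assert (Dp : forall x, 0 < x -> D x = Derive f x).
  { intros x h. unfold D. destruct (Rlt_dec 0 x); [reflexivity|lra]. }
  assert (Dn : forall x, x < 0 -> D x = Derive g (- x)).
  { intros x h. unfold D. destruct (Rlt_dec 0 x); [lra|].
    destruct (Rlt_dec x 0); [reflexivity|lra]. }
  assert (D0 : D 0 = b).
  { unfold D. destruct (Rlt_dec 0 0); [lra|reflexivity]. }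
  clearbody D. exists D. split; [exact D0|]. split.
  2: { split; intros x hx; [apply Dp|apply Dn]; lra. }
  intros x hx. destruct (Rtotal_order x 0) as [c|[c|c]].
  - assert (hloc : locally x (fun y => - u < y < 0)) by (apply (open_oo (- u) 0); lra).
    assert (hx' : 0 < - x < u) by lra. split.
    + apply (is_derive_ext_loc (mirror g)).
      * generalize hloc. apply filter_imp. intros y hy. symmetry. apply glue_neg. lra.
      * rewrite Dn by exact c. apply mirror_is_derive. exact (C_on_is_derive gC hx').
    + apply (continuous_ext_loc _ (fun y => Derive g (- y))).
      * generalize hloc. apply filter_imp. intros y hy. symmetry. apply Dn. lra.
      * apply (continuous_comp Ropp (Derive g)); [apply continuous_Ropp|].
        exact (C_on_continuous (C_on_Derive gC) hx').
  - subst x. split.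
    + apply is_derive_slope. intros eps. rewrite D0.
      destruct (proj1 (right_lim_eps _ _) fs eps (cond_pos eps)) as [d1 [h1 h1']].
      destruct (proj1 (right_lim_eps _ _) gs eps (cond_pos eps)) as [d2 [h2 h2']].
      assert (ho : - d2 < 0 < d1) by lra.
      generalize (open_oo (- d2) d1 0 ho). apply filter_imp. intros y hy. rewrite glue_0.
      destruct (Rtotal_order y 0) as [q|[q|q]].
      * exists (g (- y) / - y). split; [rewrite glue_neg by exact q; field; lra|].
        apply h2'. lra.
      * exists b. subst y. rewrite glue_0. split; [ring|].
        rewrite Rminus_diag, Rabs_R0. apply cond_pos.
      * exists (f y / y). split; [rewrite glue_pos by exact q; field; lra|].
        apply h1'. lra.
    + apply continuous_eps. intros eps. rewrite D0.
      destruct (proj1 (right_lim_eps _ _) fd eps (cond_pos eps)) as [d1 [h1 h1']].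
      destruct (proj1 (right_lim_eps _ _) gd eps (cond_pos eps)) as [d2 [h2 h2']].
      assert (ho : - d2 < 0 < d1) by lra.
      generalize (open_oo (- d2) d1 0 ho). apply filter_imp. intros y hy.
      destruct (Rtotal_order y 0) as [q|[q|q]].
      * rewrite Dn by exact q. apply h2'. lra.
      * subst y. rewrite D0, Rminus_diag, Rabs_R0. apply cond_pos.
      * rewrite Dp by exact q. apply h1'. lra.
  - assert (hloc : locally x (fun y => 0 < y < u)) by (apply (open_oo 0 u); lra).
    assert (hx' : 0 < x < u) by lra. split.
    + apply (is_derive_ext_loc f).
      * generalize hloc. apply filter_imp. intros y hy. symmetry. apply glue_pos. lra.
      * rewrite Dp by exact c. exact (C_on_is_derive fC hx').
    + apply (continuous_ext_loc _ (Derive f)).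
      * generalize hloc. apply filter_imp. intros y hy. symmetry. apply Dp. lra.
      * exact (C_on_continuous (C_on_Derive fC) hx').
Qed.

Lemma glue_C_diffeo u b f g :
  0 < u -> 0 < b -> half_coordinate u b f -> half_coordinate u b g ->
  C_diffeo 1 (sym_interval u) (fun _ => True) (glue f g).
Proof.
  intros hu hb hf hg.
  destruct (glue_is_derive u b f g hu hf hg) as [D [D0 [hD [Dp Dn]]]].
  destruct hf as [_ fp fo _ _]. destruct hg as [_ gp go _ _].
  apply (C_diffeo_of_increasing 0 (- u) u).
  - apply C_on_S_intro with D; [intros x hx; now apply hD|]. apply C_on_0.
    split; [apply open_oo|intros x hx; now apply hD].
  - intros x hx. rewrite (is_derive_unique _ _ _ (proj1 (hD x hx))).
    destruct (Rtotal_order x 0) as [c|[c|c]].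
    + rewrite Dn by lra. apply gp. lra.
    + subst x. lra.
    + rewrite Dp by lra. apply fp. lra.
  - apply open_true.
  - auto.
  - intros y _. destruct (Rtotal_order y 0) as [c|[c|c]].
    + destruct (go (- y)) as [x [hx1 hx2]]; [lra|]. exists (- x). split; [lra|].
      rewrite glue_neg by lra. rewrite Ropp_involutive, hx2. ring.
    + exists 0. split; [lra|]. subst y. apply glue_0.
    + destruct (fo y) as [x [hx1 hx2]]; [lra|]. exists x. split; [lra|].
      rewrite glue_pos by lra. exact hx2.
Qed.

(** * Members of the family *)

(** A map [F x = x (1 + nu + x chi x)] on an interval so small that [F] is increasing
    and that [nu + x chi x], the sign of which governs the motion on each side of the
    fixed point [0], is decreasing with a zero in the half interval. *)
Record fold (n : nat) (d nu : R) (F chi dchi : R -> R) (K c : R) : Prop := {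
  fd_d : 0 < d;
  fd_K : 1 <= K;
  fd_c : 0 < c;
  fd_s1 : 32 * (d * K) <= 1;
  fd_s2 : 2 * (d * K) < c;
  fd_nu : Rabs nu < d * c;
  fd_C : C_on (S (S n)) (fun x => - (2 * d) < x < 2 * d) F;
  fd_chi : forall x, - (2 * d) < x < 2 * d ->
    is_derive chi x (dchi x) /\ Rabs (chi x) <= K /\ Rabs (dchi x) <= K /\ chi x <= - c /\
    F x = x * (1 + nu + x * chi x) }.

Arguments fd_d {n d nu F chi dchi K c}.
Arguments fd_K {n d nu F chi dchi K c}.
Arguments fd_c {n d nu F chi dchi K c}.
Arguments fd_s1 {n d nu F chi dchi K c}.
Arguments fd_s2 {n d nu F chi dchi K c}.
Arguments fd_nu {n d nu F chi dchi K c}.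
Arguments fd_C {n d nu F chi dchi K c}.
Arguments fd_chi {n d nu F chi dchi K c}.

Lemma fold_0 {n d nu F chi dchi K c} : fold n d nu F chi dchi K c -> F 0 = 0.
Proof.
  intros hf. assert (hd := fd_d hf).
  destruct (fd_chi hf 0 ltac:(lra)) as [_ [_ [_ [_ e]]]]. rewrite e. ring.
Qed.

Lemma fold_small {n d nu F chi dchi K c} x :
  fold n d nu F chi dchi K c -> - (2 * d) < x < 2 * d ->
  Rabs x * K <= / 16 /\ Rabs x <= / 16 /\ Rabs nu < / 32 /\ Rabs x * K < c.
Proof.
  intros [hd hK hc h1 h2 h3 _ H] hx.
  assert (hxa : Rabs x <= 2 * d) by (apply Rabs_le; lra).
  assert (p := Rabs_pos x).
  assert (g1 : Rabs x * K <= 2 * d * K) by (apply Rmult_le_compat_r; lra).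
  assert (g2 : Rabs x * 1 <= Rabs x * K) by (apply Rmult_le_compat_l; lra).
  assert (hcK : c <= K).
  { destruct (H x hx) as [_ [q1 [_ [q2 _]]]]. apply Rabs_le_between in q1. lra. }
  assert (g3 : d * c <= d * K) by (apply Rmult_le_compat_l; lra).
  lra.
Qed.

Lemma fold_derive {n d nu F chi dchi K c} x :
  fold n d nu F chi dchi K c -> - (2 * d) < x < 2 * d ->
  is_derive (fun x => nu + x * chi x) x (chi x + x * dchi x) /\ chi x + x * dchi x < 0 /\
  Derive F x = 1 + (nu + x * chi x) + x * (chi x + x * dchi x) /\ 0 < Derive F x.
Proof.
  intros hf hx. destruct (fold_small x hf hx) as [s1 [s2 [s3 s4]]].
  assert (H := fd_chi hf). destruct (H x hx) as [h1 [h2 [h3 [h4 h5]]]].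
  assert (i0 : is_derive (fun x => nu + x * chi x) x (chi x + x * dchi x)).
  { assert (i1 := is_derive_mult (fun x => x) chi x _ _ (is_derive_id x) h1 Rmult_comm).
    evar_last; [exact (is_derive_plus (fun _ => nu) _ x _ _ (is_derive_const nu x) i1)|].
    unfold plus, mult, one, zero; simpl. ring. }
  assert (iF : is_derive F x (1 + (nu + x * chi x) + x * (chi x + x * dchi x))).
  { apply (is_derive_ext_loc (fun x => x + x * (nu + x * chi x))).
    - generalize (open_oo _ _ x hx). apply filter_imp. intros y hy.
      destruct (H y hy) as [_ [_ [_ [_ e]]]].
      assert (g : y + y * (nu + y * chi y) = F y) by (rewrite e; ring). exact g.
    - assert (i1 := is_derive_mult (fun x => x) _ x _ _ (is_derive_id x) i0 Rmult_comm).
      evar_last; [exact (is_derive_plus (fun x => x) _ x _ _ (is_derive_id x) i1)|].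
      unfold plus, mult, one; simpl. ring. }
  assert (b1 : Rabs (x * chi x) <= / 16).
  { rewrite Rabs_mult. apply Rle_trans with (2 := s1).
    apply Rmult_le_compat_l; [apply Rabs_pos|exact h2]. }
  assert (b2 : Rabs (x * dchi x) <= Rabs x * K).
  { rewrite Rabs_mult. apply Rmult_le_compat_l; [apply Rabs_pos|exact h3]. }
  assert (b3 : Rabs (x * (x * dchi x)) <= / 16).
  { rewrite Rabs_mult. assert (p := Rabs_pos x). assert (p' := Rabs_pos (x * dchi x)).
    apply Rle_trans with (/ 16 * 1); [|lra]. apply Rmult_le_compat; lra. }
  apply Rabs_le_between in b1. apply Rabs_le_between in b2. apply Rabs_le_between in b3.
  apply Rabs_def2 in s3.
  split; [exact i0|]. split; [lra|]. rewrite (is_derive_unique _ _ _ iF). split; [reflexivity|].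
  replace (1 + (nu + x * chi x) + x * (chi x + x * dchi x))
    with (1 + nu + 2 * (x * chi x) + x * (x * dchi x)) by ring. lra.
Qed.

Lemma fold_decreasing {n d nu F chi dchi K c} x y :
  fold n d nu F chi dchi K c -> - (2 * d) < x -> x < y -> y < 2 * d ->
  nu + y * chi y < nu + x * chi x.
Proof.
  intros hf hx hxy hy.
  assert (- (nu + x * chi x) < - (nu + y * chi y)); [|lra].
  apply (derive_pos_increasing (- (2 * d)) (2 * d) (fun x => - (nu + x * chi x))
    (fun x => - (chi x + x * dchi x))); auto.
  - intros z hz. apply (is_derive_opp (fun x => nu + x * chi x)).
    apply (fold_derive z hf hz).
  - intros z hz. destruct (fold_derive z hf hz) as [_ [h _]]. lra.
Qed.

Lemma fold_root {n d nu F chi dchi K c} :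
  fold n d nu F chi dchi K c -> exists x1, - d < x1 < d /\ nu + x1 * chi x1 = 0.
Proof.
  intros hf. assert (hd := fd_d hf). assert (H := fd_chi hf).
  assert (hnu := Rabs_def2 _ _ (fd_nu hf)).
  destruct (H d ltac:(lra)) as [_ [_ [_ [c1 _]]]].
  destruct (H (- d) ltac:(lra)) as [_ [_ [_ [c2 _]]]].
  assert (e1 : d * chi d <= d * - c) by (apply Rmult_le_compat_l; lra).
  assert (e2 : d * chi (- d) <= d * - c) by (apply Rmult_le_compat_l; lra).
  destruct (IVT_ge (fun x => - (nu + x * chi x)) (- d) d 0) as [x [hx1 hx2]]; try lra.
  - intros x hx. apply (continuous_comp (fun x => nu + x * chi x) Ropp); [|apply continuous_Ropp].
    apply (ex_derive_continuous (fun x => nu + x * chi x)). eexists.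
    apply (fold_derive x hf). lra.
  - exists x. split; [|lra].
    assert (x <> d) by (intros ->; lra). assert (x <> - d) by (intros ->; lra). lra.
Qed.

Lemma fold_root_unique {n d nu F chi dchi K c} x y :
  fold n d nu F chi dchi K c -> - (2 * d) < x < 2 * d -> - (2 * d) < y < 2 * d ->
  nu + x * chi x = 0 -> nu + y * chi y = 0 -> x = y.
Proof.
  intros hf hx hy ex ey. destruct (Rtotal_order x y) as [q|[q|q]]; auto; exfalso.
  - assert (h := fold_decreasing x y hf ltac:(lra) q ltac:(lra)). lra.
  - assert (h := fold_decreasing y x hf ltac:(lra) q ltac:(lra)). lra.
Qed.

Lemma fold_fixed {n d nu F chi dchi K c} x1 x :
  fold n d nu F chi dchi K c -> - d < x1 < d -> nu + x1 * chi x1 = 0 ->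
  fixed_in (sym_interval d) F x <-> x = 0 \/ x = x1.
Proof.
  intros hf hx1 e1.
  assert (H := fd_chi hf). split.
  - intros [hx e]. unfold sym_interval in hx. destruct (H x ltac:(lra)) as [_ [_ [_ [_ e']]]].
    rewrite e' in e. assert (g : x * (nu + x * chi x) = 0) by lra.
    apply Rmult_integral in g. destruct g as [g|g]; [now left|right].
    apply (fold_root_unique x x1 hf); auto; lra.
  - intros hx. assert (hx' : - d < x < d) by (destruct hx; subst; lra).
    split; [exact hx'|]. destruct (H x ltac:(lra)) as [_ [_ [_ [_ e']]]]. rewrite e'.
    destruct hx as [->| ->]; [ring|]. replace (1 + nu + x1 * chi x1) with 1 by lra. ring.
Qed.

Lemma fold_multipliers {n d nu F chi dchi K c x1} :
  fold n d nu F chi dchi K c -> - d < x1 < d -> nu + x1 * chi x1 = 0 ->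
  Derive F 0 = 1 + nu /\ Derive F x1 = 1 + x1 * (chi x1 + x1 * dchi x1).
Proof.
  intros hf hx1 e.
  destruct (fold_derive 0 hf ltac:(lra)) as [_ [_ [e0 _]]].
  destruct (fold_derive x1 hf ltac:(lra)) as [_ [_ [e1 _]]].
  rewrite e0, e1. lra.
Qed.

Lemma fold_source_sink {n d nu F chi dchi K c x1} :
  fold n d nu F chi dchi K c -> - d < x1 < d -> nu + x1 * chi x1 = 0 -> nu <> 0 ->
  (0 < nu /\ 0 < x1 /\ source_sink n d F 0 x1) \/ (nu < 0 /\ x1 < 0 /\ source_sink n d F x1 0).
Proof.
  intros hf hx1 e hnu.
  assert (H := fd_chi hf).
  assert (dec := fun x y => fold_decreasing x y hf).
  destruct (fold_multipliers hf hx1 e) as [m0 m1].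
  destruct (fold_derive x1 hf ltac:(lra)) as [_ [neg _]].
  assert (Fx : forall x, - (2 * d) < x < 2 * d -> F x = x + x * (nu + x * chi x)).
  { intros x hx. destruct (H x hx) as [_ [_ [_ [_ e']]]]. rewrite e'. ring. }
  assert (pos : forall x, - (2 * d) < x < 2 * d -> 0 < Derive F x).
  { intros x hx. apply (fold_derive x hf hx). }
  assert (x10 : x1 <> 0) by (intros ->; lra).
  assert (sgn : forall x, - (2 * d) < x < 2 * d ->
    (x < x1 -> 0 < nu + x * chi x) /\ (x1 < x -> nu + x * chi x < 0)).
  { intros x hx. split; intros hl; rewrite <- e; apply dec; lra. }
  assert (at0 := sgn 0 ltac:(lra)). assert (F0 := fold_0 hf).
  assert (F1 : F x1 = x1) by (rewrite Fx by lra; rewrite e; ring).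
  destruct (Rlt_or_le 0 x1) as [q|q].
  - left. split; [lra|]. split; [lra|]. constructor; auto; try lra; try exact (fd_C hf);
      try (intros x hx; rewrite Fx by lra; destruct (sgn x ltac:(lra)); nra).
    rewrite m1. nra.
  - right. split; [lra|]. split; [lra|]. constructor; auto; try lra; try exact (fd_C hf);
      try (intros x hx; rewrite Fx by lra; destruct (sgn x ltac:(lra)); nra).
    rewrite m1. nra.
Qed.

(** The sign of [nu] decides which of the two fixed points is the source, hence the
    fixed points correspond in the same order for both maps. *)
Lemma fold_conjugate_on_basins n d e nu F chi dchi K c x1 G chi' dchi' K' c' y1 p :
  fold n d nu F chi dchi K c -> fold n e nu G chi' dchi' K' c' ->
  - d < x1 < d -> nu + x1 * chi x1 = 0 -> - e < y1 < e -> nu + y1 * chi' y1 = 0 ->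
  Derive F x1 = Derive G y1 -> nu <> 0 -> fixed_in (sym_interval d) F p ->
  exists q, fixed_in (sym_interval e) G q /\
    conjugate_on_basins (S (S n)) (sym_interval d) (sym_interval e) F G p q.
Proof.
  intros hF hG hx ex hy ey hm hnu hp.
  assert (h0 : Derive F 0 = Derive G 0).
  { rewrite (proj1 (fold_multipliers hF hx ex)).
    now rewrite (proj1 (fold_multipliers hG hy ey)). }
  apply (fold_fixed x1 p hF hx ex) in hp.
  assert (hq := fun q => proj2 (fold_fixed y1 q hG hy ey)).
  destruct (fold_source_sink hF hx ex hnu) as [[a1 [a2 a3]]|[a1 [a2 a3]]];
  destruct (fold_source_sink hG hy ey hnu) as [[b1 [b2 b3]]|[b1 [b2 b3]]];
  try lra; destruct hp as [->| ->].
  - exists 0. split; [auto|]. now apply (source_sink_conjugate_lo n d F 0 x1 e G 0 y1).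
  - exists y1. split; [auto|]. now apply (source_sink_conjugate_hi n d F 0 x1 e G 0 y1).
  - exists 0. split; [auto|]. now apply (source_sink_conjugate_hi n d F x1 0 e G y1 0).
  - exists y1. split; [auto|]. now apply (source_sink_conjugate_lo n d F x1 0 e G y1 0).
Qed.

(** ** The parabolic member *)

Lemma ln_near_1 r : / 2 <= r -> Rabs (ln r) <= 2 * Rabs (r - 1).
Proof.
  intros hr. assert (h1 := exp_ineq1_le (ln r)). rewrite exp_ln in h1 by lra.
  assert (h2 := exp_ineq1_le (- ln r)). rewrite exp_Ropp, exp_ln in h2 by lra.
  assert (h4 := Rle_abs (r - 1)). assert (h5 := Rle_abs (- (r - 1))). rewrite Rabs_Ropp in h5.
  assert (h6 : / r - 1 <= 2 * Rabs (r - 1)).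
  { replace (/ r - 1) with ((1 - r) * / r) by (field; lra).
    assert (q : 0 < / r <= 2).
    { split; [apply Rinv_0_lt_compat; lra|]. rewrite <- (Rinv_inv 2).
      apply Rinv_le_contravar; lra. }
    apply Rle_trans with (Rabs (r - 1) * / r); [apply Rmult_le_compat_r; lra|].
     rewrite (Rmult_comm 2). apply Rmult_le_compat_l; lra. }
  apply Rabs_le. lra.
Qed.

(** The expansion [F' x^2 / F^2 = 1 + x^2 (chi' - chi^2) / (1 + x chi)^2] has no term of
    first order in [x]. *)
Lemma fold_parabolic_bounds {n d F chi dchi K c} x :
  fold n d 0 F chi dchi K c -> - (2 * d) < x < 2 * d -> x <> 0 ->
  F x = x * (1 + x * chi x) /\ / 2 <= 1 + x * chi x <= 2 /\
  c * x ^ 2 <= x - F x /\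
  Rabs (ln (Derive F x) + 2 * ln (Rabs x) - 2 * ln (Rabs (F x))) <= 8 * K ^ 2 * x ^ 2.
Proof.
  intros hf hx hx0. destruct (fold_small x hf hx) as [s1 [s2 [s3 s4]]].
  destruct (fd_chi hf x hx) as [h1 [h2 [h3 [h4 h5]]]].
  destruct (fold_derive x hf hx) as [_ [_ [hD hDp]]].
  assert (hK := fd_K hf).
  rewrite Rplus_0_r in h5.
  assert (b1 : Rabs (x * chi x) <= / 16).
  { rewrite Rabs_mult. apply Rle_trans with (2 := s1).
    apply Rmult_le_compat_l; [apply Rabs_pos|exact h2]. }
  assert (b1' := proj1 (Rabs_le_between _ _) b1).
  assert (hx2 : 0 < x ^ 2) by (apply pow2_gt_0; exact hx0).
  split; [exact h5|]. split; [lra|]. split; [rewrite h5; nra|].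
  set (q := 1 + x * chi x) in *.
  assert (hq : 15 / 16 <= q) by (unfold q; lra).
  assert (hr : Derive F x * (/ q) ^ 2 - 1 = x ^ 2 * (dchi x - chi x ^ 2) * (/ q) ^ 2).
  { rewrite hD. unfold q. field. fold q. lra. }
  assert (hiq : 0 < / q <= 16 / 15).
  { split; [apply Rinv_0_lt_compat; lra|]. replace (16 / 15) with (/ (15 / 16)) by field.
    apply Rinv_le_contravar; lra. }
  assert (hiq2 : 0 <= (/ q) ^ 2 <= 2) by nra.
  assert (hch : Rabs (dchi x - chi x ^ 2) <= 2 * K ^ 2).
  { assert (t := Rabs_triang (dchi x) (- chi x ^ 2)). rewrite Rabs_Ropp in t.
    rewrite <- RPow_abs in t. assert (p := Rabs_pos (chi x)).
    unfold Rminus. nra. }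
  assert (hr2 : Rabs (Derive F x * (/ q) ^ 2 - 1) <= 4 * K ^ 2 * x ^ 2).
  { rewrite hr, !Rabs_mult, (Rabs_pos_eq (x ^ 2)), (Rabs_pos_eq ((/ q) ^ 2)) by lra.
    assert (p := Rabs_pos (dchi x - chi x ^ 2)).
    apply Rle_trans with (x ^ 2 * (2 * K ^ 2) * 2); [|right; ring].
    apply Rmult_le_compat; try lra; [apply Rmult_le_pos; lra|].
    apply Rmult_le_compat_l; lra. }
  assert (hsm : K ^ 2 * x ^ 2 <= / 256).
  { replace (K ^ 2 * x ^ 2) with ((Rabs x * K) ^ 2) by (rewrite Rpow_mult_distr, pow2_abs; ring).
    assert (p := Rabs_pos x). assert (0 <= Rabs x * K) by (apply Rmult_le_pos; lra). nra. }
  assert (hhalf : / 2 <= Derive F x * (/ q) ^ 2).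
  { apply Rabs_le_between in hr2. lra. }
  assert (hax : 0 < Rabs x) by now apply Rabs_pos_lt.
  assert (e : ln (Derive F x) + 2 * ln (Rabs x) - 2 * ln (Rabs (F x))
              = ln (Derive F x * (/ q) ^ 2)).
  { rewrite h5, Rabs_mult, (Rabs_pos_eq q), (ln_mult (Rabs x) q) by lra.
    rewrite ln_mult; [|lra|apply pow_lt; lra].
    simpl. rewrite Rmult_1_r, ln_mult, ln_Rinv by lra. ring. }
  rewrite e. apply Rle_trans with (1 := ln_near_1 _ hhalf). lra.
Qed.

Lemma right_lim_continuous f : continuous f 0 -> right_lim f (f 0).
Proof.
  intros h. exact (right_lim_comp (fun x => x) f 0 right_lim_id h).
Qed.

Lemma fold_parabolic_right {n d F chi dchi K c} :
  fold n d 0 F chi dchi K c -> parabolic (2 * d) (- chi 0) F.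
Proof.
  intros hf. assert (hd := fd_d hf). assert (H := fd_chi hf).
  assert (hc := fd_c hf). assert (hK := fd_K hf).
  assert (B := fun x => fold_parabolic_bounds x hf).
  constructor.
  - lra.
  - apply (C_on_sub _ (fun x => - (2 * d) < x < 2 * d)); [apply open_oo|intros; lra|].
    apply (C_on_le (S (S n))); [lia|]. exact (fd_C hf).
  - exact (fold_0 hf).
  - intros x hx. destruct (B x ltac:(lra) ltac:(lra)) as [b1 [b2 _]].
    split; [rewrite b1; apply Rmult_lt_0_compat; lra|].
    apply (fold_derive x hf). lra.
  - exists c. split; [exact hc|]. intros x hx. apply B; lra.
  - destruct (H 0 ltac:(lra)) as [i [_ [_ [h0 _]]]]. split; [lra|].
    apply (right_lim_ext (2 * d) (fun x => - chi x)); [lra| |].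
    + intros x hx. destruct (B x ltac:(lra) ltac:(lra)) as [b1 _]. rewrite b1. field. lra.
    + apply (right_lim_continuous (fun x => - chi x)).
      apply (continuous_comp chi Ropp); [|apply continuous_Ropp].
      apply (ex_derive_continuous chi). now exists (dchi 0).
  - exists (8 * K ^ 2). split; [nra|]. intros x hx.
    destruct (B x ltac:(lra) ltac:(lra)) as [b1 [b2 [_ b4]]].
    rewrite (Rabs_pos_eq x), (Rabs_pos_eq (F x)) in b4; [exact b4| |lra].
    rewrite b1. apply Rmult_le_pos; lra.
Qed.

(** On the left half the fixed point repels, and it is the inverse map which is
    parabolic. *)
Lemma fold_parabolic_left {n d F chi dchi K c} :
  fold n d 0 F chi dchi K c ->
  exists k, parabolic (3 / 2 * d) (- chi 0) (mirror k) /\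
    (forall y, - d < y < 0 -> F (k y) = y) /\
    (forall x, - d < x < 0 -> - d < F x < 0 -> k (F x) = x).
Proof.
  intros hf. assert (hd := fd_d hf). assert (H := fd_chi hf).
  assert (hc := fd_c hf). assert (hK := fd_K hf).
  assert (B := fun x => fold_parabolic_bounds x hf).
  assert (Dp : forall x, - (2 * d) < x < 2 * d -> 0 < Derive F x).
  { intros x hx. apply (fold_derive x hf hx). }
  assert (F0 := fold_0 hf).
  assert (below : forall x, - (2 * d) < x < 2 * d -> x <> 0 -> F x < x).
  { intros x hx h0. destruct (B x hx h0) as [_ [_ [b3 _]]].
    assert (0 < x ^ 2) by (apply pow2_gt_0; exact h0). nra. }
  destruct (local_inverse (S n) d F) as [k [kC [kF kk]]].
  { exact hd. } { exact (fd_C hf). } { exact Dp. } { apply below; lra. }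
  assert (hw : 0 < F (3 / 2 * d)).
  { destruct (B (3 / 2 * d) ltac:(lra) ltac:(lra)) as [b1 [b2 _]]. rewrite b1.
    apply Rmult_lt_0_compat; lra. }
  assert (k0 : k 0 = 0) by (rewrite <- F0 at 1; apply kk; lra).
  assert (kr : forall y, 0 < y < 3 / 2 * d -> - (3 / 2 * d) < k (- y) < 0 /\ F (k (- y)) = - y /\
            is_derive (mirror k) y (/ Derive F (k (- y))) /\ y <= 2 * - k (- y) /\ - k (- y) < y).
  { intros y hy. destruct (kF (- y) ltac:(lra)) as [k1 [k2 k3]].
    assert (hn : k (- y) < 0).
    { destruct (Rtotal_order (k (- y)) 0) as [q|[q|q]]; auto; exfalso.
      - rewrite q, F0 in k2. lra.
      - destruct (B (k (- y)) ltac:(lra) ltac:(lra)) as [b1 [b2 _]].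
        assert (0 < F (k (- y))) by (rewrite b1; apply Rmult_lt_0_compat; lra). lra. }
    split; [lra|]. split; [exact k2|]. split; [now apply mirror_is_derive|].
    assert (q := below (k (- y)) ltac:(lra) ltac:(lra)).
    destruct (B (k (- y)) ltac:(lra) ltac:(lra)) as [b1 [b2 _]].
    split; [|lra]. rewrite k2 in b1. nra. }
  exists k. split; [constructor|split].
  - lra.
  - apply (mirror_C_on _ (- (3 / 2 * d)) 0); try lra. apply (C_on_le (S (S n))); [lia|].
    apply (C_on_sub _ _ _ _ (open_oo _ _)) with (2 := kC). intros; lra.
  - unfold mirror. rewrite Ropp_0, k0. ring.
  - intros y hy. destruct (kr y hy) as [q1 [q2 [q3 _]]]. split; [unfold mirror; lra|].
    rewrite (is_derive_unique _ _ _ q3). apply Rinv_0_lt_compat. apply Dp. lra.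
  - exists (c / 4). split; [lra|]. intros y hy. destruct (kr y hy) as [q1 [q2 [_ [q4 _]]]].
    destruct (B (k (- y)) ltac:(lra) ltac:(lra)) as [_ [_ [b3 _]]]. rewrite q2 in b3.
    unfold mirror. assert (y ^ 2 <= 4 * k (- y) ^ 2) by nra. nra.
  - destruct (H 0 ltac:(lra)) as [i [_ [_ [h0 _]]]]. split; [lra|].
    set (w := fun y => k (- y)).
    apply (right_lim_ext (3 / 2 * d) (fun y => - chi (w y) * / (1 + w y * chi (w y)) ^ 2)); [lra| |].
    + intros y hy. destruct (kr y hy) as [q1 [q2 _]].
      destruct (B (k (- y)) ltac:(lra) ltac:(lra)) as [b1 [b2 _]]. unfold mirror, w.
      set (z := k (- y)) in *. replace y with (- (z * (1 + z * chi z))) by lra. field. lra.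
    + assert (w0 : w 0 = 0) by (unfold w; rewrite Ropp_0; exact k0).
      assert (cw : continuous w 0).
      { apply (continuous_comp Ropp k); [apply continuous_Ropp|]. rewrite Ropp_0.
        apply (C_on_continuous kC). lra. }
      assert (ci : continuous chi 0) by (apply (ex_derive_continuous chi); now exists (dchi 0)).
      assert (cm : continuous (fun z => - chi z * / (1 + z * chi z) ^ 2) (w 0)).
      { rewrite w0.
        apply (continuous_mult (fun z => - chi z) (fun z => / (1 + z * chi z) ^ 2)).
        - apply (continuous_comp chi Ropp); [exact ci|apply continuous_Ropp].
        - apply (continuous_comp (fun z => 1 + z * chi z) (fun z => / z ^ 2)).
          + apply (continuous_plus (fun _ => 1) (fun z => z * chi z)); [apply continuous_const|].
            apply (continuous_mult (fun z => z) chi); [apply continuous_id|exact ci].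
          + apply (ex_derive_continuous (fun z => / z ^ 2)). auto_derive.
            rewrite Rmult_0_l, Rplus_0_r. lra. }
      assert (G := right_lim_continuous _
        (continuous_comp w (fun z => - chi z * / (1 + z * chi z) ^ 2) 0 cw cm)).
      cbv beta in G. rewrite w0 in G. replace (- chi 0 * / (1 + 0 * chi 0) ^ 2) with (- chi 0) in G by field.
      exact G.
  - exists (8 * K ^ 2). split; [nra|]. intros y hy.
    destruct (kr y hy) as [q1 [q2 [q3 [q4 q5]]]]. rewrite (is_derive_unique _ _ _ q3).
    destruct (B (k (- y)) ltac:(lra) ltac:(lra)) as [b1 [b2 [_ b4]]]. rewrite q2 in b4.
    rewrite (Rabs_left (k (- y))), Rabs_Ropp, (Rabs_pos_eq y) in b4 by lra.
    assert (dp := Dp (k (- y)) ltac:(lra)). rewrite ln_Rinv by exact dp. unfold mirror.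
    replace (- ln (Derive F (k (- y))) + 2 * ln y - 2 * ln (- k (- y)))
      with (- (ln (Derive F (k (- y))) + 2 * ln (- k (- y)) - 2 * ln y)) by ring.
    rewrite Rabs_Ropp. apply Rle_trans with (1 := b4).
    apply Rmult_le_compat_l; [nra|]. nra.
  - intros y hy. apply kF. lra.
  - intros x hx hy. apply kk; lra.
Qed.

(** The common model [t |-> t / (1 + t)] is the time-one map of [t' = - t^2]. The
    last two clauses give the half interval which [F], respectively its inverse, maps into
    the interval. *)
Lemma fold_parabolic_normal_form {n d F chi dchi K c} :
  fold n d 0 F chi dchi K c ->
  exists om, C_diffeo 1 (sym_interval d) (fun _ => True) om /\
    om 0 = 0 /\ (forall x, 0 < x < d -> 0 < om x) /\ (forall x, - d < x < 0 -> om x < 0) /\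
    (forall x, sym_interval d x -> sym_interval d (F x) -> om (F x) * (1 + om x) = om x) /\
    (forall x, 0 <= x < d -> sym_interval d (F x)) /\
    (forall z, - d < z < 0 -> exists x, - d < x < 0 /\ F x = z).
Proof.
  intros hf. assert (hd := fd_d hf).
  assert (B := fun x => fold_parabolic_bounds x hf).
  assert (F0 := fold_0 hf).
  assert (hR := fold_parabolic_right hf).
  destruct (fold_parabolic_left hf) as [k [hL [kF kk]]].
  assert (hb := proj1 (pb_lim _ _ _ hR)).
  assert (Fpos : forall x, 0 < x < d -> 0 < F x < x).
  { intros x hx. apply (parabolic_below x hR). lra. }
  assert (mpos : forall y, 0 < y < d -> 0 < mirror k y < y).
  { intros y hy. apply (parabolic_below y hL). lra. }
  destruct (parabolic_coordinate _ _ _ d hR ltac:(lra)) as [f [f1 [f2 [f3 [f4 [f5 f6]]]]]].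
  destruct (parabolic_coordinate _ _ _ d hL ltac:(lra)) as [g [g1 [g2 [g3 [g4 [g5 g6]]]]]].
  exists (glue f g). split.
  { apply (glue_C_diffeo d (- chi 0)); auto; constructor; auto. }
  split; [apply glue_0|]. split; [intros x hx; rewrite glue_pos by lra; now apply f2|].
  split; [intros x hx; rewrite glue_neg by lra; specialize (g2 (- x) ltac:(lra)); lra|].
  split; [|split].
  - intros x hx hFx. unfold sym_interval in *. destruct (Rtotal_order x 0) as [q|[q|q]].
    + assert (hFn : F x < 0).
      { destruct (B x ltac:(lra) ltac:(lra)) as [b1 [b2 _]]. rewrite b1. nra. }
      rewrite !glue_neg by lra.
      assert (e := g4 (- F x) ltac:(lra)). unfold mirror in e. rewrite Ropp_involutive in e.
      rewrite kk in e by lra. nra.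
    + subst x. rewrite F0, glue_0. ring.
    + destruct (Fpos x ltac:(lra)). rewrite !glue_pos by lra. apply f4. lra.
  - intros x hx. unfold sym_interval. destruct (Req_dec x 0) as [q|q]; [subst; rewrite F0; lra|].
    destruct (Fpos x ltac:(lra)). lra.
  - intros z hz. exists (k z). split; [|now apply kF].
    assert (m := mpos (- z) ltac:(lra)). unfold mirror in m. rewrite Ropp_involutive in m. lra.
Qed.

Lemma fold_parabolic_conjugacy n d F chi dchi K c e G chi' dchi' K' c' :
  fold n d 0 F chi dchi K c -> fold n e 0 G chi' dchi' K' c' ->
  exists h, C_conjugacy 1 (sym_interval d) (sym_interval e) F G h.
Proof.
  intros hF hG.
  destruct (fold_parabolic_normal_form hF) as [om [D1 [z1 [p1 [n1 [c1 [i1 s1]]]]]]].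
  destruct (fold_parabolic_normal_form hG) as [th [D2 [z2 [p2 [n2 [c2 [i2 s2]]]]]]].
  destruct (C_diffeo_through _ _ _ _ om th D1 D2) as [h [hD hh]].
  assert (inj : forall y z, sym_interval e y -> sym_interval e z -> th y = th z -> y = z).
  { destruct D2 as [_ [_ [k [_ [_ [hk _]]]]]]. intros y z hy hz q.
    rewrite <- (hk y hy), <- (hk z hz). now rewrite q. }
  assert (hm : forall x, sym_interval d x -> sym_interval e (h x)) by apply hD.
  assert (sgn : forall x, sym_interval e x -> (0 <= th x -> 0 <= x) /\ (th x < 0 -> x < 0)).
  { intros x hx. unfold sym_interval in hx. destruct (Rtotal_order x 0) as [q|[q|q]].
    - specialize (n2 x ltac:(lra)). split; lra.
    - subst. lra.
    - specialize (p2 x ltac:(lra)). split; lra. }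
  exists h. split; [exact hD|]. intros x hx hFx.
  assert (e1 := c1 x hx hFx).
  rewrite <- (hh x hx), <- (hh (F x) hFx) in e1.
  destruct (Rle_or_lt 0 (th (h x))) as [q|q].
  - assert (a := proj1 (sgn _ (hm x hx)) q). assert (b := hm x hx).
    assert (iG := i2 (h x) ltac:(unfold sym_interval in b; lra)).
    apply inj; auto. assert (e2 := c2 (h x) b iG).
    apply Rmult_eq_reg_r with (1 + th (h x)); lra.
  - (* the image of [h x] is not known to stay in the interval: compare preimages *)
    assert (x0 : x < 0).
    { destruct (Rlt_or_le x 0) as [w|w]; [exact w|exfalso].
      rewrite hh in q by exact hx. unfold sym_interval in hx.
      destruct (Req_dec x 0) as [->|w']; [lra|]. specialize (p1 x ltac:(lra)). lra. }
    assert (Fx0 : F x < 0).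
    {  unfold sym_interval in hx.
      destruct (fold_parabolic_bounds x hF ltac:(lra) ltac:(lra)) as [b1 [b2 _]].
      rewrite b1. nra. }
    assert (t1 : th (h (F x)) < 0).
    { rewrite hh by exact hFx. apply n1. unfold sym_interval in hFx. lra. }
    assert (b := hm _ hFx). assert (a := proj2 (sgn _ b) t1).
    destruct (s2 (h (F x)) ltac:(unfold sym_interval in b; lra)) as [z [hz1 hz2]].
    assert (hz : sym_interval e z) by (unfold sym_interval; lra).
    assert (e2 := c2 z hz ltac:(rewrite hz2; exact b)). rewrite hz2 in e2.
    assert (ez : z = h x); [|now rewrite <- ez].
    apply inj; auto. apply Rmult_eq_reg_r with (1 - th (h (F x))); lra.
Qed.

(** * The unfolding and its normal form *)

(** Used with [m = chi_xx], which for a function [f] of class C^4 is only continuous: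
    the third derivative of [f] at [0] exists although that of [chi] need not. *)
Lemma is_derive_square_mult (m : R -> R) : continuous m 0 -> is_derive (fun x => x ^ 2 * m x) 0 0.
Proof.
  intros hm. apply is_derive_slope. intros eps.
  assert (hc : continuous (fun x => x * m x) 0).
  { apply (continuous_mult (fun x => x) m); [apply continuous_id|exact hm]. }
  generalize (proj1 (continuous_eps _ _) hc eps). apply filter_imp. intros y hy.
  exists (y * m y). split; [ring|]. now rewrite Rmult_0_l in hy.
Qed.

Lemma unfolding_jet n s (f chi : R -> R -> R) (nu : R -> R) :
  0 < s -> C_on_2d (S (S n)) (rect s s) chi ->
  (forall x mu, rect s s (x, mu) -> f x mu = x * (1 + nu mu + x * chi x mu)) ->
  (forall mu, sym_interval s mu -> d_x f 0 mu = 1 + nu mu) /\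
  d_x (d_x f) 0 0 = 2 * chi 0 0 /\ d_x (d_x (d_x f)) 0 0 = 6 * d_x chi 0 0.
Proof.
  intros hs hchi hf.
  assert (hx1 := C2_d_x hchi).
  assert (D1 : forall x mu, rect s s (x, mu) ->
    is_derive (fun z => f z mu) x (1 + nu mu + 2 * x * chi x mu + x ^ 2 * d_x chi x mu)).
  { intros x mu hr.
    apply (is_derive_ext_loc (fun z => z * (1 + nu mu + z * chi z mu))).
    - generalize (proj1 (open_slices _ x mu (open_rect s s) hr)). apply filter_imp.
      intros z hz. symmetry. now apply hf.
    - assert (i1 := is_derive_mult (fun z => z) _ x _ _ (is_derive_id x)
        (C2_is_derive_x hchi hr) Rmult_comm).
      assert (i2 := is_derive_plus (fun _ => 1 + nu mu) _ x _ _ (is_derive_const _ x) i1).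
      assert (i3 := is_derive_mult (fun z => z) _ x _ _ (is_derive_id x) i2 Rmult_comm).
      evar_last; [exact i3|]. unfold plus, mult, one, zero; simpl. ring. }
  assert (E1 : forall x mu, rect s s (x, mu) ->
    d_x f x mu = 1 + nu mu + 2 * x * chi x mu + x ^ 2 * d_x chi x mu).
  { intros x mu hr. apply is_derive_unique. now apply D1. }
  assert (hr0 : forall mu, sym_interval s mu -> rect s s (0, mu)).
  { intros mu hmu. split; simpl; [lra|exact hmu]. }
  assert (hsym0 : sym_interval s 0) by (unfold sym_interval; lra).
  assert (hloc : locally 0 (fun x => rect s s (x, 0))).
  { exact (proj1 (open_slices _ 0 0 (open_rect s s) (hr0 0 hsym0))). }
  assert (E2 : forall x, rect s s (x, 0) ->
    d_x (d_x f) x 0 = 2 * chi x 0 + 4 * x * d_x chi x 0 + x ^ 2 * d_x (d_x chi) x 0).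
  { intros x hr. apply is_derive_unique.
    apply (is_derive_ext_loc (fun x => 1 + nu 0 + 2 * x * chi x 0 + x ^ 2 * d_x chi x 0)).
    - generalize (proj1 (open_slices _ x 0 (open_rect s s) hr)). apply filter_imp.
      intros z hz. symmetry. now apply E1.
    - assert (j1 : is_derive (fun x => 2 * x) x 2) by (auto_derive; [exact I|ring]).
      assert (j2 : is_derive (fun x => x ^ 2) x (2 * x)) by (auto_derive; [exact I|ring]).
      assert (i1 := is_derive_mult _ _ x _ _ j1 (C2_is_derive_x hchi hr) Rmult_comm).
      assert (i2 := is_derive_mult _ _ x _ _ j2 (C2_is_derive_x hx1 hr) Rmult_comm).
      assert (i3 := is_derive_plus (fun _ => 1 + nu 0) _ x _ _ (is_derive_const _ x) i1).
      evar_last; [exact (is_derive_plus _ _ x _ _ i3 i2)|].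
      unfold plus, mult, zero; simpl. ring. }
  split; [|split].
  - intros mu hmu. rewrite E1 by auto. ring.
  - rewrite E2 by auto. ring.
  - apply is_derive_unique.
    apply (is_derive_ext_loc
      (fun x => 2 * chi x 0 + 4 * x * d_x chi x 0 + x ^ 2 * d_x (d_x chi) x 0)).
    + generalize hloc. apply filter_imp. intros z hz. symmetry. now apply E2.
    + assert (hr := hr0 0 hsym0).
      assert (j1 : is_derive (fun x => 4 * x) 0 4) by (auto_derive; [exact I|ring]).
      assert (i1 := is_derive_scal (fun x => chi x 0) 0 2 _ (C2_is_derive_x hchi hr)).
      assert (i2 := is_derive_mult _ _ 0 _ _ j1 (C2_is_derive_x hx1 hr) Rmult_comm).
      assert (i3 : is_derive (fun x => x ^ 2 * d_x (d_x chi) x 0) 0 0).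
      { apply (is_derive_square_mult (fun x => d_x (d_x chi) x 0)).
        apply slice_x_continuous. apply (@C2_continuous n (rect s s)); [|exact hr].
        now apply C2_d_x. }
      evar_last; [exact (is_derive_plus _ _ 0 _ _ (is_derive_plus _ _ 0 _ _ i1 i2) i3)|].
      unfold plus, mult; simpl. ring.
Qed.

Lemma g_fold n e nu a A :
  0 < e -> 0 <= A -> Rabs a <= A -> 32 * (e * (2 + A)) <= 1 -> Rabs nu < e * / 2 ->
  fold n e nu (fun y => g y nu a) (fun y => - (1) + a * y) (fun _ => a) (2 + A) (/ 2).
Proof.
  intros he hA ha hs hnu. constructor; auto; try lra.
  - apply C_on_ext with (fun y => y * (1 + nu + y * (- (1) + a * y))).
    + intros y _. unfold g. ring.
    + assert (ho := open_oo (- (2 * e)) (2 * e)).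
      assert (cst : forall k, C_on (S (S n)) (fun x => - (2 * e) < x < 2 * e) (fun _ => k)).
      { intros k. exact (C_on_const _ _ k ho). }
      assert (idt := C_on_id (S (S n)) _ ho).
      exact (C_on_mult _ _ _ _ idt (C_on_plus _ _ _ _ (cst (1 + nu))
        (C_on_mult _ _ _ _ idt (C_on_plus _ _ _ _ (cst (- (1)))
          (C_on_mult _ _ _ _ (cst a) idt))))).
  - intros y hy. assert (b : Rabs (a * y) <= / 2).
    { rewrite Rabs_mult. assert (Rabs y <= 2 * e) by (apply Rabs_le; lra).
      assert (p := Rabs_pos a). assert (p' := Rabs_pos y).
      apply Rle_trans with (A * (2 * e)); [apply Rmult_le_compat; lra|]. nra. }
    assert (b' := proj1 (Rabs_le_between _ _) b).
    split; [auto_derive; [exact I|ring]|]. split; [apply Rabs_le; lra|]. split; [lra|].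
    split; [lra|]. unfold g. ring.
Qed.

(** That [y1] be a fixed point of [g] with the multiplier of [x1] is a pair of linear
    conditions on [y1] and [a y1^2]. Their solution is [y1 = x1 (x1 dchi - chi)] and
    [a y1^2 = x1^2 dchi]; the factor [x1^2], which vanishes with [nu], cancels in [a]. *)
Lemma matching_parameters nu x1 chi dchi :
  nu + x1 * chi = 0 -> x1 * dchi - chi <> 0 ->
  let a := dchi / (x1 * dchi - chi) ^ 2 in let y1 := x1 * (x1 * dchi - chi) in
  nu + y1 * (- (1) + a * y1) = 0 /\
  1 + y1 * (- (1) + a * y1 + y1 * a) = 1 + x1 * (chi + x1 * dchi).
Proof.
  intros h h0 a y1.
  assert (e : a * y1 ^ 2 = x1 ^ 2 * dchi) by (unfold a, y1; field; exact h0).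
  split.
  - replace (nu + y1 * (- (1) + a * y1)) with (nu - y1 + a * y1 ^ 2) by ring.
    rewrite e. unfold y1. lra.
  - replace (1 + y1 * (- (1) + a * y1 + y1 * a)) with (1 - y1 + 2 * (a * y1 ^ 2)) by ring.
    rewrite e. unfold y1. ring.
Qed.

Lemma nonzero_near (nu : R -> R) l :
  nu 0 = 0 -> is_derive nu 0 l -> 0 < l ->
  exists d, 0 < d /\ forall mu, sym_interval d mu -> mu <> 0 -> nu mu <> 0.
Proof.
  intros h0 hd hl. apply is_derive_Reals in hd. destruct (hd l hl) as [d hd'].
  exists d. split; [apply cond_pos|]. intros mu hmu hne e.
  assert (h := hd' mu hne ltac:(unfold sym_interval in hmu; apply Rabs_def1; lra)).
  rewrite Rplus_0_l, e, h0 in h. unfold Rdiv in h.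
  rewrite Rminus_diag, Rmult_0_l, Rminus_0_l, Rabs_Ropp, Rabs_pos_eq in h; lra.
Qed.

Theorem theorem3p2 (r : nat) (D : R * R -> Prop) (f : R -> R -> R)
  (hr : (4 <= r)%nat)
  (hD : D (0, 0))
  (hf : C_on_2d r D f)
  (hfix : locally 0 (fun mu => f 0 mu = 0))
  (hfx : d_x f 0 0 = 1)
  (hfxx : d_x (d_x f) 0 0 < 0)
  (hfxmu : d_mu (d_x f) 0 0 > 0) :
  exists (N : R -> Prop) (mu0 : R),
    open_nbhd 0 N /\ 0 < mu0 /\
    (forall x mu, N x -> sym_interval mu0 mu -> D (x, mu)) /\
    (forall mu, sym_interval mu0 mu -> mu <> 0 ->
       exists x1 x2, x1 <> x2 /\
         forall x, fixed_in N (fun z => f z mu) x <-> (x = x1 \/ x = x2)) /\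
    exists (M : R -> Prop) (nu a : R -> R),
      open_nbhd 0 M /\
      C_on (r - 1) (sym_interval mu0) nu /\
      C_on (r - 3) (sym_interval mu0) a /\
      nu 0 = 0 /\
      Derive nu 0 = d_mu (d_x f) 0 0 /\
      a 0 = 2 * d_x (d_x (d_x f)) 0 0 / (3 * d_x (d_x f) 0 0 ^ 2) /\
      (forall mu, sym_interval mu0 mu -> mu <> 0 ->
         forall p, fixed_in N (fun x => f x mu) p ->
           exists q, fixed_in M (fun y => g y (nu mu) (a mu)) q /\
             conjugate_on_basins (r - 1) N M
               (fun x => f x mu) (fun y => g y (nu mu) (a mu)) p q) /\
      (exists h, C_conjugacy 1 N M
                   (fun x => f x 0) (fun y => g y (nu 0) (a 0)) h).
Proof.
  destruct r as [|[|[|[|n]]]]; try lia.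
  replace (S (S (S (S n))) - 1)%nat with (S (S (S n))) by lia.
  replace (S (S (S (S n))) - 3)%nat with (S n) by lia.
  (* a square inside [D], on which [f = x (1 + nu + x chi)] *)
  assert (hl : locally_2d (fun x mu => D (x, mu) /\ f 0 mu = 0) 0 0).
  { apply locally_2d_and; [exact (proj1 (open_2d D) (C2_open hf) 0 0 hD)|].
    destruct hfix as [d hd]. exists d. intros u v _ hv. now apply hd. }
  destruct (locally_2d_rect _ hl) as [e0 [he0 h0]].
  assert (hf0 : C_on_2d (S (S (S (S n)))) (rect e0 e0) f).
  { apply (C2_sub _ D); [apply open_rect| |exact hf]. intros [x mu] h. now apply (h0 x mu). }
  destruct (hadamard _ _ _ _ hf0) as [k0 [hk0 hfk]].
  destruct (hadamard _ _ _ _ hk0) as [chi [hchi hkchi]].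
  set (nu := fun mu => k0 0 mu - 1).
  assert (hform : forall x mu, rect e0 e0 (x, mu) -> f x mu = x * (1 + nu mu + x * chi x mu)).
  { intros x mu h. rewrite (hfk x mu h), (hkchi x mu h), (proj2 (h0 x mu h)). unfold nu. ring. }
  destruct (unfolding_jet n e0 f chi nu he0 hchi hform) as [J1 [J2 J3]].
  assert (hs0 : sym_interval e0 0) by (unfold sym_interval; lra).
  assert (hnu0 : nu 0 = 0) by (specialize (J1 0 hs0); lra).
  assert (hnuC : C_on (S (S (S n))) (sym_interval e0) nu).
  { apply C_on_plus; [|apply C_on_const; apply open_sym_interval].
    apply (C2_curve _ (rect e0 e0) k0 _ (fun _ => 0) hk0).
    - apply C_on_const. apply open_sym_interval.
    - intros mu hmu. split; simpl; [lra|exact hmu]. }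
  assert (hnuD : Derive nu 0 = d_mu (d_x f) 0 0).
  { unfold d_mu. symmetry. transitivity (Derive (fun mu => 1 + nu mu) 0).
    - apply Derive_ext_loc. generalize (open_sym_interval e0 0 hs0). apply filter_imp. exact J1.
    - assert (i := C_on_is_derive hnuC hs0). apply is_derive_unique.
      evar_last; [exact (is_derive_plus (fun _ => 1) nu 0 _ _ (is_derive_const 1 0) i)|].
      unfold plus, zero; simpl. ring. }
  (* bounds near the origin, and the radii of the neighbourhoods *)
  set (dchi := d_x chi).
  assert (hdchi : C_on_2d (S n) (rect e0 e0) dchi) by now apply C2_d_x.
  set (c := - chi 0 0 / 2). set (K := Rabs (chi 0 0) + Rabs (dchi 0 0) + 1).
  assert (hc : 0 < c) by (unfold c; lra).
  assert (hr00 : rect e0 e0 (0, 0)) by (split; simpl; lra).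
  assert (hm1 : 0 < Rmin c 1) by (apply Rmin_glb_lt; lra).
  destruct (locally_2d_rect _ (locally_2d_and _ _ _ _
    (C2_continuous hchi hr00 (mkposreal _ hm1))
    (C2_continuous hdchi hr00 (mkposreal 1 Rlt_0_1)))) as [e1 [he1 h1]].
  simpl in h1.
  assert (hK : 1 <= K).
  { unfold K. assert (p1 := Rabs_pos (chi 0 0)). assert (p2 := Rabs_pos (dchi 0 0)). lra. }
  assert (hbd : forall x mu, rect e1 e1 (x, mu) ->
     Rabs (chi x mu) <= K /\ Rabs (dchi x mu) <= K /\ chi x mu <= - c).
  { intros x mu h. destruct (h1 x mu h) as [b1 b2].
    assert (m1 := Rmin_l c 1). assert (m2 := Rmin_r c 1).
    assert (t1 := Rabs_triang_inv (chi x mu) (chi 0 0)).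
    assert (t2 := Rabs_triang_inv (dchi x mu) (dchi 0 0)).
    assert (p1 := Rabs_pos (chi 0 0)). assert (p2 := Rabs_pos (dchi 0 0)).
    apply Rabs_def2 in b1. destruct b1 as [b1 b1'].
    assert (b3 : Rabs (chi x mu - chi 0 0) < 1) by (apply Rabs_def1; lra).
    unfold K. split; [lra|]. split; [lra|]. unfold c in *. lra. }
  assert (hd : exists d,
    0 < d /\ 2 * d <= e0 /\ 2 * d <= e1 /\ 32 * (d * K) <= 1 /\ 4 * (d * K) <= c).
  { destruct (pos_below (e0 / 2) (e1 / 2) (/ 32) (c / 4)) as [t [ht ht']]; try lra.
    exists (t / K). assert (q1 : t / K * K = t) by (field; lra).
    assert (q2 : 0 < t / K) by (apply Rdiv_lt_0_compat; lra). nra. }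
  destruct hd as [d [hd0 [hd1 [hd2 [hd3 hd4]]]]].
  set (A := 4 * K / c ^ 2).
  assert (hA : 0 <= A).
  { left. apply Rdiv_lt_0_compat; [lra|]. apply pow_lt. lra. }
  set (e := / (32 * (2 + A))).
  assert (he : 0 < e) by (apply Rinv_0_lt_compat; lra).
  assert (he2 : 32 * (e * (2 + A)) <= 1) by (right; unfold e; field; lra).
  clearbody e.
  destruct (nonzero_near nu (Derive nu 0) hnu0) as [m2 [hm2 hnz]].
  { exact (C_on_is_derive hnuC hs0). }
  { rewrite hnuD. exact hfxmu. }
  destruct (pos_below (d * c) (d * c) (e * / 2) (e * c / (2 * K))) as [eta [heta heta']]; try nra.
  { apply Rdiv_lt_0_compat; nra. }
  destruct (continuous_near nu 0 eta heta (C_on_continuous hnuC hs0)) as [m3 [hm3 hnu3]].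
  destruct (pos_below e0 e1 m2 m3) as [mu0 [hmu [hmu1 [hmu2 [hmu3 hmu4]]]]]; try lra.
  assert (in0 : forall x mu, - (2 * d) < x < 2 * d -> sym_interval mu0 mu -> rect e0 e0 (x, mu)).
  { intros x mu hx hm. unfold sym_interval in hm. split; simpl; lra. }
  assert (in1 : forall x mu, - (2 * d) < x < 2 * d -> sym_interval mu0 mu -> rect e1 e1 (x, mu)).
  { intros x mu hx hm. unfold sym_interval in hm. split; simpl; lra. }
  assert (sm : forall mu, sym_interval mu0 mu -> sym_interval e0 mu).
  { intros mu hm. unfold sym_interval in *. lra. }
  assert (hnub : forall mu, sym_interval mu0 mu ->
     Rabs (nu mu) < d * c /\ Rabs (nu mu) < e * / 2 /\ 2 * K * Rabs (nu mu) < e * c).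
  { intros mu hm. unfold sym_interval in hm.
    assert (h := hnu3 mu ltac:(unfold around; lra)). rewrite hnu0, Rminus_0_r in h.
    split; [lra|]. split; [lra|].
    apply Rlt_le_trans with (2 * K * (e * c / (2 * K))); [|right; field; lra].
    apply Rmult_lt_compat_l; lra. }
  (* the members of the family, and the branch [x1] of nonzero fixed points *)
  assert (Ff : forall mu, sym_interval mu0 mu -> fold (S n) d (nu mu) (fun x => f x mu)
     (fun x => chi x mu) (fun x => dchi x mu) K c).
  { intros mu hm. constructor; auto; try lra.
    - apply hnub, hm.
    - apply (C_on_sub _ (fun x => rect e0 e0 (x, mu))); [apply open_oo|intros; auto|].
      apply (C_on_le (S (S (S (S n))))); [lia|]. now apply C2_slice_x.
    - intros x hx. destruct (hbd x mu (in1 x mu hx hm)) as [b1 [b2 b3]].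
      split; [exact (C2_is_derive_x hchi (in0 x mu hx hm))|].
      exact (conj b1 (conj b2 (conj b3 (hform x mu (in0 x mu hx hm))))). }
  assert (hx1 : exists x1 : R -> R, forall mu, sym_interval mu0 mu ->
     - d < x1 mu < d /\ nu mu + x1 mu * chi (x1 mu) mu = 0).
  { exists (fun mu => epsilon (inhabits 0) (fun x => - d < x < d /\ nu mu + x * chi x mu = 0)).
    intros mu hm. apply (epsilon_spec (inhabits 0) (fun x => - d < x < d /\ nu mu + x * chi x mu = 0)).
    exact (fold_root (Ff mu hm)). }
  destruct hx1 as [x1 hx1].
  assert (subr : forall z, rect d mu0 z -> rect e0 e0 z).
  { intros [x mu] [a1 a2]. simpl in *. apply in0; [lra|exact a2]. }
  assert (hk0' : C_on_2d (S (S (S n))) (rect d mu0) k0).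
  { apply (C2_sub _ (rect e0 e0)); [apply open_rect|exact subr|exact hk0]. }
  assert (hk0x : forall x mu, rect d mu0 (x, mu) -> d_x k0 x mu < 0).
  { intros x mu [a1 a2]. simpl in a1, a2.
    destruct (fold_derive x (Ff mu a2) ltac:(lra)) as [i [neg _]].
    replace (d_x k0 x mu) with (chi x mu + x * dchi x mu); [exact neg|].
    symmetry. apply is_derive_unique.
    apply (is_derive_ext_loc (fun x => 1 + (nu mu + x * chi x mu))).
    - assert (a3 : - (2 * d) < x < 2 * d) by lra.
      generalize (open_oo _ _ x a3). apply filter_imp. intros y hy.
      assert (e' : 1 + (nu mu + y * chi y mu) = k0 y mu); [|exact e'].
      rewrite (hkchi y mu (in0 y mu hy a2)). unfold nu. ring.
    - evar_last; [exact (is_derive_plus (fun _ => 1) _ x _ _ (is_derive_const 1 x) i)|].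
      apply plus_zero_l. }
  assert (hx1k : forall mu, sym_interval mu0 mu -> - d < x1 mu < d /\ k0 (x1 mu) mu = 1).
  { intros mu hm. destruct (hx1 mu hm) as [a1 a2]. split; [exact a1|].
    rewrite (hkchi _ _ (in0 (x1 mu) mu ltac:(lra) hm)). unfold nu in a2. lra. }
  assert (hx1C : C_on (S (S (S n))) (sym_interval mu0) x1).
  { apply (implicit_C_on _ k0 d mu0 x1 1); auto. intros mu hm.
    apply (implicit_continuous k0 d mu0 x1 1); auto. apply (C2_le (S (S (S n)))); [lia|exact hk0']. }
  set (den := fun mu => x1 mu * dchi (x1 mu) mu - chi (x1 mu) mu).
  assert (hden : forall mu, sym_interval mu0 mu -> c / 2 <= den mu <= 2 * K).
  { intros mu hm. destruct (hx1 mu hm) as [a1 _].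
    destruct (hbd _ _ (in1 (x1 mu) mu ltac:(lra) hm)) as [b1 [b2 b3]].
    assert (b4 : Rabs (x1 mu * dchi (x1 mu) mu) <= d * K).
    { rewrite Rabs_mult. apply Rmult_le_compat; try apply Rabs_pos; [|exact b2].
      apply Rabs_le. lra. }
    apply Rabs_le_between in b1. apply Rabs_le_between in b4. unfold den. lra. }
  set (a := fun mu => dchi (x1 mu) mu / den mu ^ 2).
  assert (haA : forall mu, sym_interval mu0 mu -> Rabs (a mu) <= A).
  { intros mu hm. destruct (hx1 mu hm) as [a1 _]. assert (hdm := hden mu hm).
    destruct (hbd _ _ (in1 (x1 mu) mu ltac:(lra) hm)) as [_ [b2 _]].
    unfold a, Rdiv. rewrite Rabs_mult.
    assert (hc2 : 0 < (c / 2) ^ 2) by (apply pow_lt; lra).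
    assert (hd2' : (c / 2) ^ 2 <= den mu ^ 2) by (apply pow_incr; lra).
    rewrite (Rabs_pos_eq (/ den mu ^ 2)) by (left; apply Rinv_0_lt_compat; lra).
    apply Rle_trans with (K * / (c / 2) ^ 2); [|right; unfold A; field; lra].
    apply Rmult_le_compat; [apply Rabs_pos|left; apply Rinv_0_lt_compat; lra|exact b2|].
    apply Rinv_le_contravar; lra. }
  assert (haC : C_on (S n) (sym_interval mu0) a).
  { assert (hx1C' : C_on (S n) (sym_interval mu0) x1).
    { apply (C_on_le (S (S (S n)))); [lia|exact hx1C]. }
    assert (hin : forall mu, sym_interval mu0 mu -> rect e0 e0 (x1 mu, mu)).
    { intros mu hm. apply in0; [|exact hm]. destruct (hx1 mu hm). lra. }
    assert (c1 : C_on (S n) (sym_interval mu0) (fun mu => dchi (x1 mu) mu)).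
    { apply (C2_curve _ (rect e0 e0)); auto. }
    assert (c2 : C_on (S n) (sym_interval mu0) (fun mu => chi (x1 mu) mu)).
    { apply (C2_curve _ (rect e0 e0)); auto. apply (C2_le (S (S n))); [lia|exact hchi]. }
    assert (c3 : C_on (S n) (sym_interval mu0) den).
    { apply C_on_plus; [now apply C_on_mult|now apply C_on_opp]. }
    apply C_on_mult; [exact c1|]. apply C_on_inv.
    - apply C_on_ext with (fun mu => den mu * den mu); [intros; ring|]. now apply C_on_mult.
    - intros mu hm. apply pow_nonzero. specialize (hden mu hm). lra. }
  assert (Gf : forall mu, sym_interval mu0 mu -> fold (S n) e (nu mu)
     (fun y => g y (nu mu) (a mu)) (fun y => - (1) + a mu * y) (fun _ => a mu) (2 + A) (/ 2)).
  { intros mu hm. apply g_fold; auto. apply hnub, hm. }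
  assert (m00 : sym_interval mu0 0) by (unfold sym_interval; lra).
  exists (sym_interval d), mu0.
  split; [split; [apply open_sym_interval|unfold sym_interval; lra]|].
  split; [exact hmu|]. split.
  { intros x mu hx hm. unfold sym_interval in hx. apply (h0 x mu). apply in0; [lra|exact hm]. }
  split.
  { intros mu hm hne. destruct (hx1 mu hm) as [a1 a2]. exists 0, (x1 mu). split.
    - intros e'. rewrite <- e' in a2. apply (hnz mu); [|exact hne|lra].
      unfold sym_interval in *. lra.
    - intros x. apply (fold_fixed _ x (Ff mu hm) a1 a2). }
  exists (sym_interval e), nu, a.
  split; [split; [apply open_sym_interval|unfold sym_interval; lra]|].
  split; [exact (C_on_sub _ _ _ _ (open_sym_interval mu0) sm hnuC)|].
  split; [exact haC|]. split; [exact hnu0|]. split; [exact hnuD|]. split; [|split].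
  - destruct (hx1 0 m00) as [a1 a2].
    assert (x10 : x1 0 = 0).
    { apply (fold_root_unique (x1 0) 0 (Ff 0 m00)); lra. }
    unfold a, den. rewrite x10, J2, J3. fold dchi. field. lra.
  - intros mu hm hne p hp. destruct (hx1 mu hm) as [a1 a2]. assert (hdm := hden mu hm).
    destruct (matching_parameters (nu mu) (x1 mu) (chi (x1 mu) mu) (dchi (x1 mu) mu) a2)
      as [mp1 mp2].
    { fold (den mu). lra. }
    fold (den mu) in mp1, mp2. fold (a mu) in mp1, mp2.
    set (y1 := x1 mu * den mu) in *.
    assert (hy1 : - e < y1 < e).
    { destruct (hbd _ _ (in1 (x1 mu) mu ltac:(lra) hm)) as [_ [_ b3]].
      destruct (hnub mu hm) as [_ [_ b4]].
      assert (b5 : Rabs (x1 mu) * c <= Rabs (nu mu)).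
      { replace (nu mu) with (x1 mu * - chi (x1 mu) mu) by lra. rewrite Rabs_mult.
        apply Rmult_le_compat_l; [apply Rabs_pos|]. rewrite Rabs_pos_eq; lra. }
      assert (b6 : Rabs y1 <= Rabs (x1 mu) * (2 * K)).
      { unfold y1. rewrite Rabs_mult. apply Rmult_le_compat_l; [apply Rabs_pos|].
        rewrite Rabs_pos_eq; lra. }
      assert (b7 : Rabs y1 < e); [|apply Rabs_def2 in b7; lra].
      apply Rmult_lt_reg_r with c; [exact hc|].
      assert (Rabs y1 * c <= Rabs (x1 mu) * (2 * K) * c) by (apply Rmult_le_compat_r; lra).
      assert (2 * K * (Rabs (x1 mu) * c) <= 2 * K * Rabs (nu mu))
        by (apply Rmult_le_compat_l; lra).
      lra. }
    apply (fold_conjugate_on_basins _ _ _ _ _ _ _ _ _ (x1 mu) _ _ _ _ _ y1 p (Ff mu hm) (Gf mu hm));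
      auto.
    + rewrite (proj2 (fold_multipliers (Ff mu hm) a1 a2)).
      rewrite (proj2 (fold_multipliers (Gf mu hm) hy1 mp1)).
      symmetry. exact mp2.
    + apply hnz; [|exact hne]. unfold sym_interval in *. lra.
  - assert (F0 := Ff 0 m00). assert (G0 := Gf 0 m00). rewrite hnu0 in F0, G0. rewrite hnu0.
    exact (fold_parabolic_conjugacy _ _ _ _ _ _ _ _ _ _ _ _ _ F0 G0).
Qed.
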